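(* The staged unique assembly verification problem is $\mathrm{coNP}$-hard, even when restricted to staged systems with 4 stages and temperature $\tau=2$.
   Context: Tile assembly model. A tile is a non-rotatable unit square each of whose four edges is labeled with a glue from a finite set $\Sigma$; each glue $g$ has a nonnegative integer strength $\mathrm{str}(g,g)$, distinct glues have strength $0$ with each other, and there is a null glue of strength $0$. A configuration is a partial function $A:\mathbb{Z}^2\to T$ for a tile set $T$; an assembly is a configuration up to translation; its size $|A|$ is its number of tiles, and its shape is its domain up to translation. The bond graph of a configuration has one vertex per occupied position and an edge between each pair of adjacent occupied positions, weighted by the strength of the pair of abutting glues. An assembly is $\tau$-stable if every edge cut of its bond graph has total weight at least $\tau$. Assemblies $A,B$ are $\tau$-combinable into $C$ if some translates of $A$ and $B$ have disjoint domains, their union is a translate of $C$, and $C$ is $\tau$-stable. For a bin $(S,\tau)$ with set $S$ of initial assemblies, the set of produced assemblies is the smallest set containing $S$ and closed under: if produced $A,B$ are $\tau$-combinable into $C$ then $C$ is produced. A produced assembly is terminal if it is not $\tau$-combinable with any produced assembly. Staged systems. An $r$-stage $b$-bin mix graph is a directed graph on vertices $m_{i,j}$ ($1\le i\le r$, $1\le j\le b$) whose edges all have the form $(m_{i,j},m_{i+1,j'})$. A staged system $\langle M, \{T_1,\dots,T_b\},\tau\rangle$ consists of such a mix graph $M$, tile sets $T_1,\dots,T_b$, and a temperature $\tau$. Bin $(i,j)$ has initial assemblies $R_{1,j}=$ the single tiles of $T_j$, and for $i\ge 2$, $R_{i,j}$ is the union of the sets of terminal assemblies of the bins $(i-1,k)$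 with $(m_{i-1,k},m_{i,j})\in M$; each bin operates at temperature $\tau$. The output of the system is the union of the sets of terminal assemblies of the bins in the final stage $r$. Staged unique assembly verification (staged UAV) problem: given a staged system $\Gamma$ and an assembly $A$, does $\Gamma$ uniquely assemble $A$, i.e. is $A$ the unique terminal assembly (output) of $\Gamma$? Hardness is with respect to polynomial-time many-one reductions. *)

(* Defs.v *)
From mathcomp Require Import all_boot all_algebra.
Set Implicit Arguments. Unset Strict Implicit. Unset Printing Implicit Defensive.
Import GRing.Theory.

(* Glues are natural numbers.  The strength of glue g (i.e. str(g,g)) is
   [nth 0 strs g]; distinct glues have strength 0 (built into [bond]).
   Any glue g >= size strs (or with strength 0) serves as a null glue. *)
Definition glue_str (strs : seq nat) (g : nat) : nat := nth 0 strs g.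

(* A tile: (north, east, south, west) glues; tiles are not rotatable. *)
Definition tile := (nat * nat * nat * nat)%type.
Definition tN (t : tile) : nat := t.1.1.1.
Definition tE (t : tile) : nat := t.1.1.2.
Definition tS (t : tile) : nat := t.1.2.
Definition tW (t : tile) : nat := t.2.

Definition pos := (int * int)%type.
Definition padd (p q : pos) : pos := ((p.1 + q.1)%R, (p.2 + q.2)%R).

Definition config := seq (pos * tile).
Definition dom (c : config) : seq pos := map fst c.
Definition wf_config (c : config) : bool := uniq (dom c).
Fixpoint lookup (c : config) (p : pos) : option tile :=
  match c with
  | [::] => None
  | e :: c' => if e.1 == p then Some e.2 else lookup c' p
  end.

Definition bond (strs : seq nat) (e1 e2 : pos * tile) : nat :=
  let: (p, t) := e1 in let: (q, u) := e2 in
  if q == padd p ((Posz 1), (Posz 0)) then (if tE t == tW u then glue_str strs (tE t) else 0)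
  else if q == padd p ((-1)%R, (Posz 0)) then (if tW t == tE u then glue_str strs (tW t) else 0)
  else if q == padd p ((Posz 0), (Posz 1)) then (if tN t == tS u then glue_str strs (tN t) else 0)
  else if q == padd p ((Posz 0), (-1)%R) then (if tS t == tN u then glue_str strs (tS t) else 0)
  else 0.

Definition cut_weight (strs : seq nat) (c : config) (S : pred pos) : nat :=
  \sum_(e1 <- c | S e1.1) \sum_(e2 <- c | ~~ S e2.1) bond strs e1 e2.

Definition stable (strs : seq nat) (tau : nat) (c : config) : Prop :=
  forall S : pred pos, has (fun e => S e.1) c -> has (fun e => ~~ S e.1) c ->
    tau <= cut_weight strs c S.

Definition shift (v : pos) (c : config) : config :=
  map (fun e => (padd e.1 v, e.2)) c.

Definition asm_eq (c1 c2 : config) : Prop :=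
  wf_config c1 /\ wf_config c2 /\
  exists v : pos, forall p, lookup (shift v c1) p = lookup c2 p.

Definition disjoint_dom (c1 c2 : config) : bool :=
  all (fun p => p \notin dom c2) (dom c1).

Definition combinable (strs : seq nat) (tau : nat) (A B C : config) : Prop :=
  exists A' B', asm_eq A A' /\ asm_eq B B' /\ disjoint_dom A' B' /\
    asm_eq (A' ++ B') C /\ stable strs tau C.

Inductive produced (strs : seq nat) (tau : nat) (S0 : config -> Prop) :
  config -> Prop :=
| Prod_init A : S0 A -> wf_config A -> produced strs tau S0 A
| Prod_eq A B : produced strs tau S0 A -> asm_eq A B -> produced strs tau S0 B
| Prod_comb A B C : produced strs tau S0 A -> produced strs tau S0 B ->
    combinable strs tau A B C -> produced strs tau S0 C.

Definition terminal (strs : seq nat) (tau : nat) (S0 : config -> Prop)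
  (A : config) : Prop :=
  produced strs tau S0 A /\
  forall B C, produced strs tau S0 B -> ~ combinable strs tau A B C.

(* Stages and bins are 0-indexed: stage i in 0..r-1, bin j in 0..b-1.
   An edge (i, k, j) of the mix graph is (m_{i,k}, m_{i+1,j}). *)
Record staged := Staged {
  st_r : nat;
  st_b : nat;
  st_edges : seq (nat * nat * nat);
  st_tiles : seq (seq tile);
  st_strs : seq nat;
  st_tau : nat
}.

Definition wf_staged (G : staged) : bool :=
  (size (st_tiles G) == st_b G) &&
  all (fun e : nat * nat * nat => (e.1.1.+1 < st_r G) && (e.1.2 < st_b G) && (e.2 < st_b G))
      (st_edges G).

Definition single_tiles (T : seq tile) (A : config) : Prop :=
  exists p t, t \in T /\ A = [:: (p, t)].

Fixpoint bin_terminal (G : staged) (i j : nat) : config -> Prop :=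
  match i with
  | 0 => terminal (st_strs G) (st_tau G) (single_tiles (nth [::] (st_tiles G) j))
  | i'.+1 => terminal (st_strs G) (st_tau G)
      (fun A => exists k, ((i', k, j) \in st_edges G) /\ bin_terminal G i' k A)
  end.

Definition output (G : staged) (A : config) : Prop :=
  0 < st_r G /\ exists j, j < st_b G /\ bin_terminal G (st_r G).-1 j A.

Definition uniquely_assembles (G : staged) (A : config) : Prop :=
  wf_config A /\ forall X, output G X <-> asm_eq X A.

Fixpoint nbits (fuel n : nat) : seq bool :=
  match fuel with
  | 0 => [::]
  | f.+1 => if n is 0 then [::] else odd n :: nbits f n./2
  end.
(* binary, self-delimiting *)
Definition enc_nat (n : nat) : seq bool :=
  flatten [seq [:: true; b] | b <- nbits n n] ++ [:: false].
Definition enc_int (z : int) : seq bool :=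
  match z with Posz n => true :: enc_nat n | Negz n => false :: enc_nat n end.
Definition enc_seq (T : Type) (f : T -> seq bool) (s : seq T) : seq bool :=
  flatten [seq true :: f x | x <- s] ++ [:: false].
Definition enc_tile (t : tile) : seq bool :=
  enc_nat (tN t) ++ enc_nat (tE t) ++ enc_nat (tS t) ++ enc_nat (tW t).
Definition enc_pos (p : pos) : seq bool := enc_int p.1 ++ enc_int p.2.
Definition enc_config (c : config) : seq bool :=
  enc_seq (fun e => enc_pos e.1 ++ enc_tile e.2) c.
Definition enc_staged (G : staged) : seq bool :=
  enc_nat (st_r G) ++ enc_nat (st_b G) ++
  enc_seq (fun e : nat * nat * nat => enc_nat e.1.1 ++ enc_nat e.1.2 ++ enc_nat e.2)
          (st_edges G) ++
  enc_seq (enc_seq enc_tile) (st_tiles G) ++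
  enc_seq enc_nat (st_strs G) ++ enc_nat (st_tau G).
Definition enc_instance (G : staged) (A : config) : seq bool :=
  enc_staged G ++ enc_config A.

Definition staged_UAV_4_2 (x : seq bool) : Prop :=
  exists G A, x = enc_instance G A /\ wf_staged G /\
    st_r G = 4 /\ st_tau G = 2 /\ uniquely_assembles G A.

(* Single-tape deterministic TM.  States 'I_(Q+3): 0 = start, 1 = accept,
   2 = reject (halting).  Symbols 'I_(S+3): 0 = blank, 1 = bit false,
   2 = bit true, others are work symbols.  Moves 'I_3: 0 left, 1 stay,
   2 right. *)
Record TM := MkTM {
  tm_Q : nat;
  tm_S : nat;
  tm_delta : 'I_(tm_Q.+3) -> 'I_(tm_S.+3) -> 'I_(tm_Q.+3) * 'I_(tm_S.+3) * 'I_3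
}.

Record tm_conf (M : TM) := TMConf {
  tc_state : 'I_(tm_Q M).+3;
  tc_tape : int -> 'I_(tm_S M).+3;
  tc_head : int
}.

Definition halting (M : TM) (q : 'I_(tm_Q M).+3) : bool :=
  (val q == 1) || (val q == 2).

Definition sym_of_bit (M : TM) (b : bool) : 'I_(tm_S M).+3 :=
  if b then inord 2 else inord 1.

Definition init_conf (M : TM) (x : seq bool) : tm_conf M :=
  TMConf (inord 0)
    (fun z : int => match z with
      | Posz n => if n < size x then sym_of_bit M (nth false x n) else inord 0
      | Negz _ => inord 0 end)
    0%R.

Definition tm_step (M : TM) (c : tm_conf M) : tm_conf M :=
  if halting (tc_state c) then c else
  let: (q', s', m) := tm_delta (tc_state c) (tc_tape c (tc_head c)) in
  TMConf q' (fun z => if z == tc_head c then s' else tc_tape c z)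
         (tc_head c + Posz (val m) - 1)%R.

Definition tm_run (M : TM) (x : seq bool) (t : nat) : tm_conf M :=
  iter t (tm_step (M := M)) (init_conf M x).

Fixpoint read_bits (M : TM) (fuel : nat) (tape : int -> 'I_(tm_S M).+3) (n : nat)
  : seq bool :=
  match fuel with
  | 0 => [::]
  | f.+1 => let s := tape (Posz n) in
            if val s == 1 then false :: read_bits f tape n.+1
            else if val s == 2 then true :: read_bits f tape n.+1
            else [::]
  end.

Definition tm_output (M : TM) (x : seq bool) (t : nat) : seq bool :=
  read_bits (size x + t) (tc_tape (tm_run M x t)) 0.

Definition poly_computable (f : seq bool -> seq bool) : Prop :=
  exists (M : TM) (c : nat), forall x, exists t,
    t <= c * (size x).+1 ^ c /\ halting (tc_state (tm_run M x t)) /\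
    tm_output M x t = f x.

Definition poly_decidable (V : seq bool -> Prop) : Prop :=
  exists (M : TM) (c : nat), forall y, exists t,
    t <= c * (size y).+1 ^ c /\ halting (tc_state (tm_run M y t)) /\
    (V y <-> val (tc_state (tm_run M y t)) = 1).

Definition enc_pair (x w : seq bool) : seq bool :=
  enc_seq (fun b => [:: b]) x ++ enc_seq (fun b => [:: b]) w.

Definition in_NP (L : seq bool -> Prop) : Prop :=
  exists (V : seq bool -> Prop) (c : nat), poly_decidable V /\
    forall x, L x <-> exists w, size w <= c * (size x).+1 ^ c /\ V (enc_pair x w).

Definition in_coNP (L : seq bool -> Prop) : Prop := in_NP (fun x => ~ L x).

Definition poly_reduces (L1 L2 : seq bool -> Prop) : Prop :=
  exists f, poly_computable f /\ forall x, L1 x <-> L2 (f x).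

Definition coNP_hard (L : seq bool -> Prop) : Prop :=
  forall L', in_coNP L' -> poly_reduces L' L.

(* Main.v *)
(** Nothing bounds the size of produced assemblies, and an assembly that can
always grow is never terminal.  One bin, repeated over the four stages, is
therefore enough.  Its tiles grow an L consisting of a row with strong
horizontal glues, which spells a padded input tape [enc_pair x w] for a
nondeterministically chosen witness [w] of bounded length, and of a constant
column.  The cells inside the L have glues of strength 1 only, hence attach
exactly where both their west and south neighbours match; each row of cells is
a run of a nondeterministic transducer that performs one step of the verifier.
Every assembly containing a piece of the L can be prolonged, every cell tile
fits somewhere, and the tile [alpha] fits only at the end of a row in which the
verifier accepts.  So the single tile [alpha] is the unique terminal assembly
exactly when [x] has no witness, and otherwise there is no terminal assembly.

The length bound on [w] is hard-wired in numbered glues, of which the system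
has [O(c (n + 1)^c)]; the reduction that writes down this system is a program
for a machine with eight stacks, held on eight tracks of the Turing tape. *)

Require Import Defs.
From HB Require Import structures.
From mathcomp Require Import all_boot all_order all_algebra zify.
From Stdlib Require Import Classical ClassicalEpsilon FunctionalExtensionality.
Set Implicit Arguments. Unset Strict Implicit. Unset Printing Implicit Defensive.
Import GRing.Theory Order.TTheory Num.Theory.

(** * Prefix-freeness of the encoding *)

(** Assemblies, and not only single tiles, combine with each other, so growth tile by tile cannot be
    presupposed. The invariant is instead that in every produced assembly all tiles but one, the
    root, have their input neighbours present; two assemblies then bind only at an input of one of
    the roots. Besides assemblies rooted at a corner, this leaves only lone cells and fragments of a
    row or of a column.

    Two demands on the cell tiles compete: each of them has to fit somewhere, whether or not a
    computation uses it, while [alpha] may fit only after acceptance. Auxiliary corners with freely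
    chosen inputs meet the first demand; leaving the state [HFinal] out of the auxiliary columns
    protects the second.

    Rows whose run gets stuck are harmless, because [alpha] needs a complete rectangle below and to
    the left of it. Rows may carry any number of blanks, so the head always finds enough tape in
    some row. The later stages change nothing, as they start from copies of [alpha] alone or from
    nothing. *)

Definition prefix_code (T : Type) (f : T -> seq bool) :=
  forall a b u v, f a ++ u = f b ++ v -> a = b /\ u = v.

Lemma prefix_code_pair (T1 T2 : Type) (f : T1 -> seq bool) (g : T2 -> seq bool) :
  prefix_code f -> prefix_code g -> prefix_code (fun p => f p.1 ++ g p.2).
Proof.
move=> Hf Hg [a1 a2] [b1 b2] u v /=; rewrite -!catA => /Hf [-> /Hg [-> ->]].
by [].
Qed.

Lemma prefix_code_seq (T : Type) (f : T -> seq bool) :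
  prefix_code f -> prefix_code (enc_seq f).
Proof.
move=> Hf; elim=> [|a s IHs] [|b t] u v //=; rewrite /enc_seq /=.
- by case=> ->.
- by case; rewrite -!catA => /Hf [-> E]; case: (IHs t u v); rewrite /enc_seq -?catA // => -> ->.
Qed.

Lemma nbits_inj m n k l : m <= k -> n <= l -> nbits k m = nbits l n -> m = n.
Proof.
elim: k m n l => [|k IH] m n l.
  rewrite leqn0 => /eqP ->; case: l => [|l]; first by rewrite leqn0 => /eqP ->.
  by case: n.
case: m => [|m] Hm; first by case: l => [|l]; case: n.
case: l => [|l]; first by case: n.
case: n => [|n] // Hn [Hodd Hhalf].
have Hm2 : uphalf m <= k by rewrite uphalfE; lia.
have Hn2 : uphalf n <= l by rewrite uphalfE; lia.
have H := IH _ _ _ Hm2 Hn2 Hhalf.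
by rewrite -(odd_double_half m.+1) -(odd_double_half n.+1) /= Hodd H.
Qed.

Lemma prefix_code_nat : prefix_code enc_nat.
Proof.
move=> m n u v; rewrite /enc_nat -!catA /= => E.
suff [H ->] : nbits m m = nbits n n /\ u = v by split=> //; exact: nbits_inj H.
elim: (nbits m m) (nbits n n) E => [|a s IHs] [|b t] //=.
- by case=> ->.
- by case=> -> /IHs [-> ->].
Qed.

Lemma prefix_code_int : prefix_code enc_int.
Proof. by move=> [m|m] [n|n] u v //= [/prefix_code_nat [-> ->]]. Qed.

Lemma prefix_code_tile : prefix_code enc_tile.
Proof.
move=> [[[n e] s] w] [[[n' e'] s'] w'] u v; have Hn := prefix_code_nat.
rewrite /enc_tile /tN /tE /tS /tW; move: enc_nat Hn => f Hn; rewrite -!catA.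
by move/Hn=> [/= -> /Hn [/= -> /Hn [/= -> /Hn [/= -> ->]]]].
Qed.

Lemma prefix_code_config : prefix_code enc_config.
Proof.
apply: prefix_code_seq; apply: prefix_code_pair; last exact: prefix_code_tile.
by apply: prefix_code_pair; exact: prefix_code_int.
Qed.

Lemma prefix_code_staged : prefix_code enc_staged.
Proof.
have Hn := prefix_code_nat.
have He : prefix_code (fun e : nat * nat * nat => enc_nat e.1.1 ++ enc_nat e.1.2 ++ enc_nat e.2).
  move=> [[a b] c] [[a' b'] c'] u v; move: enc_nat Hn => f Hn; rewrite -!catA.
  by move/Hn=> [/= -> /Hn [/= -> /Hn [/= -> ->]]].
move=> [r b e t s k] [r' b' e' t' s' k'] u v; have Ht := prefix_code_tile.
have Hs := prefix_code_seq.
rewrite /enc_staged; move: enc_nat enc_tile enc_seq Hn He Ht Hs => f g h Hn He Ht Hs.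
rewrite -!catA => /Hn [/= -> /Hn [/= -> /(Hs _ _ He) [/= -> ]]].
by move/(Hs _ _ (Hs _ _ Ht))=> [/= -> /(Hs _ _ Hn) [/= -> /Hn [/= -> ->]]].
Qed.

(** The target language quantifies existentially over the instance that a bit string encodes, so a
    property of the constructed instance can be read back only if no other instance has the same
    code. *)
Lemma enc_instance_inj G A G' A' :
  enc_instance G A = enc_instance G' A' -> G = G' /\ A = A'.
Proof.
rewrite /enc_instance => /prefix_code_staged [-> E]; split=> //.
by case: (@prefix_code_config A A' [::] [::]); rewrite ?cats0.
Qed.

(** * Configurations, shifts and stability *)

Definition popp (v : pos) : pos := ((- v.1)%R, (- v.2)%R).

Lemma paddA p q r : padd (padd p q) r = padd p (padd q r).
Proof. by rewrite /padd /= !addrA. Qed.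
Lemma padd0 p : padd p (Posz 0, Posz 0) = p.
Proof. by case: p => x y; rewrite /padd /= !addr0. Qed.
Lemma paddK v : cancel (padd^~ v) (padd^~ (popp v)).
Proof. by move=> [x y]; rewrite /padd /= !addrK. Qed.
Lemma padd_inj v : injective (padd^~ v).
Proof. exact: can_inj (paddK v). Qed.

Lemma shiftD v w c : shift w (shift v c) = shift (padd v w) c.
Proof. by rewrite /shift -map_comp; apply: eq_map => e /=; rewrite paddA. Qed.

Lemma shift0 c : shift (Posz 0, Posz 0) c = c.
Proof. by rewrite -[RHS]map_id; apply: eq_map => -[p t]; rewrite padd0. Qed.

Lemma shiftK v c : shift (popp v) (shift v c) = c.
Proof. by rewrite shiftD -[RHS]shift0; congr shift; rewrite /padd /= !subrr. Qed.

Lemma dom_shift v c : dom (shift v c) = map (padd^~ v) (dom c).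
Proof. by rewrite /dom /shift -!map_comp. Qed.

Lemma wf_shift v c : wf_config (shift v c) = wf_config c.
Proof. by rewrite /wf_config dom_shift map_inj_uniq //; exact: padd_inj. Qed.

Lemma wf_uniq c : wf_config c -> uniq c.
Proof. exact: map_uniq. Qed.

Lemma mem_dom c p : reflect (exists t, (p, t) \in c) (p \in dom c).
Proof.
apply: (iffP mapP) => [[[q t] H /= ->]|[t H]]; first by exists t.
by exists (p, t).
Qed.

Lemma lookupP c p t : wf_config c -> lookup c p = Some t <-> (p, t) \in c.
Proof.
rewrite /wf_config; elim: c => [|[q u] c IH] //= /andP [Hq Hc].
rewrite inE xpair_eqE [p == q]eq_sym; case: (eqVneq q p) => [E|_] /=; last exact: IH.
split=> [[->]|]; first by rewrite eqxx.
case/orP => [/eqP -> //|H]; case/negP: Hq.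
by rewrite E; apply/mem_dom; exists t.
Qed.

Lemma wf_inj c p t u : wf_config c -> (p, t) \in c -> (p, u) \in c -> t = u.
Proof. by move=> W /(lookupP _ _ W) E /(lookupP _ _ W); rewrite E => -[]. Qed.

Lemma asm_eq_perm c d :
  asm_eq c d <-> [/\ wf_config c, wf_config d & exists v, perm_eq (shift v c) d].
Proof.
split=> [[Wc [Wd [v E]]]|[Wc Wd [v E]]].
  split=> //; exists v; apply: uniq_perm; try by apply: wf_uniq; rewrite ?wf_shift.
  have Wv : wf_config (shift v c) by rewrite wf_shift.
  move=> [p t]; apply/idP/idP.
    by move/(lookupP _ _ Wv); rewrite E => /(lookupP _ _ Wd).
  by move/(lookupP _ _ Wd); rewrite -E => /(lookupP _ _ Wv).
do 2!split=> //; exists v => p.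
have Wv : wf_config (shift v c) by rewrite wf_shift.
case Ed: (lookup d p) => [t|].
  by apply/(lookupP _ _ Wv); rewrite (perm_mem E); apply/(lookupP _ _ Wd).
case Ec: (lookup _ p) => [t|] //; move/(lookupP _ _ Wv): Ec.
by rewrite (perm_mem E) => /(lookupP _ _ Wd); rewrite Ed.
Qed.

Lemma asm_eq_refl c : wf_config c -> asm_eq c c.
Proof. by move=> W; apply/asm_eq_perm; split=> //; exists (Posz 0, Posz 0); rewrite shift0. Qed.

Lemma asm_eq_sym c d : asm_eq c d -> asm_eq d c.
Proof.
move/asm_eq_perm=> [Wc Wd [v E]]; apply/asm_eq_perm; split=> //; exists (popp v).
by rewrite -[X in perm_eq _ X](shiftK v) perm_sym perm_map.
Qed.

Lemma asm_eq_trans c d e : asm_eq c d -> asm_eq d e -> asm_eq c e.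
Proof.
move=> /asm_eq_perm [Wc Wd [v E]] /asm_eq_perm [_ We [w F]]; apply/asm_eq_perm; split=> //.
exists (padd v w); rewrite -shiftD; apply: perm_trans F; exact: perm_map.
Qed.

Lemma asm_eq_shift v c : wf_config c -> asm_eq c (shift v c).
Proof. by move=> W; apply/asm_eq_perm; split; rewrite ?wf_shift //; exists v. Qed.

Arguments bond : simpl never.

(** * Bond strengths and edge cuts *)

Section Bonds.
Variable strs : seq nat.
Notation str := (glue_str strs).

Lemma bondE x y a b :
  bond strs ((x, y), a) (((x + 1)%R, y), b) = if tE a == tW b then str (tE a) else 0.
Proof. by rewrite /bond /padd /= addr0 eqxx. Qed.

Lemma bondN x y a b :
  bond strs ((x, y), a) ((x, (y + 1)%R), b) = if tN a == tS b then str (tN a) else 0.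
Proof.
rewrite /bond /padd /= !xpair_eqE !addr0 !eqxx /=.
have -> : (x == x + 1)%R = false by lia.
by have -> : (x == x - 1)%R = false by lia.
Qed.

Variant bond_spec (x y : int) (a : tile) : int -> int -> tile -> nat -> Prop :=
| BondE b : tE a = tW b -> bond_spec x y a (x + 1)%R y b (str (tE a))
| BondW b : tW a = tE b -> bond_spec x y a (x - 1)%R y b (str (tW a))
| BondN b : tN a = tS b -> bond_spec x y a x (y + 1)%R b (str (tN a))
| BondS b : tS a = tN b -> bond_spec x y a x (y - 1)%R b (str (tS a)).

Lemma bondP x y a x' y' b : bond strs ((x, y), a) ((x', y'), b) > 0 ->
  bond_spec x y a x' y' b (bond strs ((x, y), a) ((x', y'), b)).
Proof.
rewrite /bond /padd /= !addr0.
case: eqP => [[-> ->]|_]; first by case: eqP => // E _; constructor.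
case: eqP => [[-> ->]|_]; first by case: eqP => // E _; constructor.
case: eqP => [[-> ->]|_]; first by case: eqP => // E _; constructor.
case: eqP => [[-> ->]|_]; first by case: eqP => // E _; constructor.
by [].
Qed.

Lemma bond_sym e f : bond strs e f = bond strs f e.
Proof.
case: e f => [[x y] a] [[x' y'] b].
have H u v : 0 < bond strs u v -> bond strs v u = bond strs u v.
  case: u v => [[x1 y1] t] [[x2 y2] s] /bondP [] {}s E; rewrite E /bond /padd /= !addr0 !xpair_eqE.
  - by rewrite addrK !eqxx /= E eqxx; have -> : (x1 == x1 + 1 + 1)%R = false by lia.
  - by rewrite subrK !eqxx /= E eqxx.
  - rewrite addrK !eqxx /= E eqxx; have -> : (x1 == x1 + 1)%R = false by lia.
    have -> : (x1 == x1 - 1)%R = false by lia.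
    by have -> : (y1 == y1 + 1 + 1)%R = false by lia.
  - rewrite subrK !eqxx /= E eqxx; have -> : (x1 == x1 + 1)%R = false by lia.
    by have -> : (x1 == x1 - 1)%R = false by lia.
case: (posnP (bond strs (x, y, a) (x', y', b))) => [E|/H //].
by case: (posnP (bond strs (x', y', b) (x, y, a))) => [->|/H ->].
Qed.

Lemma bond_shift v e f : bond strs (padd e.1 v, e.2) (padd f.1 v, f.2) = bond strs e f.
Proof.
case: e f => [p a] [q b] /=; rewrite /bond.
have E d : (padd q v == padd (padd p v) d) = (q == padd p d).
  rewrite -[RHS](inj_eq (@padd_inj v)); congr (_ == _).
  by rewrite !paddA; congr padd; rewrite /padd /= addrC [(_ + d.2)%R]addrC.
by rewrite !E.
Qed.

Definition cross (A B : config) := \sum_(e <- A) \sum_(f <- B) bond strs e f.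

Lemma cross_sym A B : cross A B = cross B A.
Proof.
rewrite /cross exchange_big /=; apply: eq_bigr => f _; apply: eq_bigr => e _.
exact: bond_sym.
Qed.

Lemma cross_gt0 A B : 0 < cross A B -> exists e f, [/\ e \in A, f \in B & 0 < bond strs e f].
Proof.
move=> H; have : has (fun e => has (fun f => 0 < bond strs e f) B) A.
  apply: contraLR H => /hasPn H; rewrite -eqn0Ngt; apply/eqP; apply: big1_seq => e /= He.
  by apply: big1_seq => f /= Hf; move/hasPn: (H e He) => /(_ f Hf); case: bond.
by case/hasP => e He /hasP [f Hf Hb]; exists e, f.
Qed.

Lemma leq_cross_mem e A f B : e \in A -> f \in B -> bond strs e f <= cross A B.
Proof.
move=> He Hf; rewrite /cross (big_rem e) //= (big_rem f) //=.
by rewrite -addnA leq_addr.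
Qed.

Lemma leq_cross1 e A f : e \in A -> bond strs e f <= cross A [:: f].
Proof. by move=> He; apply: leq_cross_mem => //; rewrite inE. Qed.

Lemma leq_cross2 e e' A f : e != e' -> e \in A -> e' \in A ->
  bond strs e f + bond strs e' f <= cross A [:: f].
Proof.
move=> ne He He'; rewrite /cross (big_rem e) //= big_seq1 leq_add2l.
rewrite (big_rem e') /=; first by rewrite big_seq1 leq_addr.
by apply: rem_mem => //; rewrite eq_sym.
Qed.

Lemma cut_weight_perm c d S : perm_eq c d -> cut_weight strs c S = cut_weight strs d S.
Proof.
by move=> E; rewrite /cut_weight (perm_big _ E); apply: eq_bigr => e _; rewrite (perm_big _ E).
Qed.

Variable tau : nat.

Lemma stable_perm c d : perm_eq c d -> stable strs tau c -> stable strs tau d.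
Proof.
move=> E H S; rewrite -!(perm_has _ E) => S1 S2.
by rewrite -(cut_weight_perm _ E); apply: H.
Qed.

Lemma stable_shift v c : stable strs tau c -> stable strs tau (shift v c).
Proof.
move=> H S; rewrite /shift !has_map => S1 S2.
have := H (fun p => S (padd p v)) S1 S2; rewrite /cut_weight big_map.
under [X in _ <= X -> _]eq_bigr do (under eq_bigr do rewrite -(bond_shift v)).
by under [X in _ -> _ <= X]eq_bigr do rewrite big_map.
Qed.

Lemma stable_asm_eq c d : asm_eq c d -> stable strs tau c -> stable strs tau d.
Proof. by move/asm_eq_perm=> [_ _ [v E]] H; apply: stable_perm E _; exact: stable_shift. Qed.

(** The cut that separates [dom A] from the rest has exactly this weight. Combinations are analysed
    through this single cut. *)
Lemma stable_cross A B : wf_config (A ++ B) -> A != [::] -> B != [::] ->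
  stable strs tau (A ++ B) -> tau <= cross A B.
Proof.
rewrite /wf_config /dom map_cat cat_uniq => /and3P [_ Hd _] A0 B0 H.
have SA e : e \in A -> e.1 \in dom A by move=> He; apply/mapP; exists e.
have SB e : e \in B -> e.1 \notin dom A.
  move=> He; apply: contra Hd => Hd; apply/hasP; exists e.1 => //.
  by apply/mapP; exists e.
have := H (mem (dom A)).
have -> : cut_weight strs (A ++ B) (mem (dom A)) = cross A B.
  rewrite /cut_weight /cross big_cat /= [X in _ + X]big1_seq ?addn0; last first.
    by move=> e /andP [/= H1 /SB]; rewrite H1.
  rewrite big_seq_cond [RHS]big_seq; apply: eq_big => [e|e _].
    by case He: (e \in A) => //=; rewrite SA.
  rewrite big_cat /= big1_seq ?add0n; last by move=> f /andP [/= /negP Hf /SA].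
  rewrite big_seq_cond [RHS]big_seq; apply: eq_bigl => f.
  by case Hf: (f \in B) => //=; rewrite SB.
apply.
  case: A A0 SA {H Hd SB} => [|e A] // _ SA; rewrite /= SA //; exact: mem_head.
case: B B0 SB {H Hd} => [|e B] // _ SB; rewrite has_cat /= SB ?orbT //; exact: mem_head.
Qed.

(** A cut of the enlarged assembly either splits [A], where the stability of [A] suffices, or
    separates the new tile from all of [A], where its weight is the bond between the two. *)
Lemma stable_attach A p t : stable strs tau A -> tau <= cross A [:: (p, t)] ->
  stable strs tau (A ++ [:: (p, t)]).
Proof.
move=> H C S; rewrite !has_cat /= !orbF => S1 S2.
have leA : has (fun e => S e.1) A -> has (fun e => ~~ S e.1) A ->
    tau <= cut_weight strs (A ++ [:: (p, t)]) S.
  move=> /H {}H /H {}H; apply: leq_trans H _.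
  rewrite /cut_weight big_cat /=; apply: leq_trans (leq_addr _ _).
  by apply: leq_sum => e _; rewrite big_cat leq_addr.
case SA: (has (fun e => S e.1) A) in S1 leA; last first.
  move/negbT/hasPn in SA; rewrite /= in S1.
  apply: leq_trans C _; rewrite cross_sym /cross /cut_weight big_cat /=.
  apply: leq_trans (leq_addl _ _); rewrite big_seq1 big_cons /= S1 big_nil addn0.
  rewrite big_cat /=; apply: leq_trans (leq_addr _ _).
  rewrite big_seq [X in _ <= X]big_seq_cond; apply: eq_leq; apply: eq_bigl => e.
  by case He: (e \in A) => //=; rewrite SA.
case NA: (has (fun e => ~~ S e.1) A) in S2 leA; first exact: leA.
move/negbT/hasPn in NA; rewrite /= in S2.
apply: leq_trans C _; rewrite /cross /cut_weight big_cat /=.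
apply: leq_trans (leq_addr _ _).
rewrite big_seq [X in _ <= X]big_seq_cond; apply: eq_leq; apply: eq_big => [e|e _].
  by case He: (e \in A) => //=; rewrite -[S _]negbK NA.
rewrite big_seq1 big_cat /= big1_seq ?add0n; last first.
  by move=> f /andP [/= Hf /NA]; rewrite Hf.
by rewrite big_cons big_nil S2 addn0.
Qed.

Lemma stable1 p t : stable strs tau [:: (p, t)].
Proof. by move=> S /=; rewrite !orbF => ->. Qed.

(** * Produced assemblies *)

Section Produced.
Variable S0 : config -> Prop.
Hypothesis stable0 : forall A, S0 A -> stable strs tau A.

Lemma produced_wf A : produced strs tau S0 A -> wf_config A.
Proof.
by case=> [{}A _ //|{}A B _ [_ [W _]] //|B C {}A _ _ [A' [B' [_ [_ [_ [[_ [W _]] _]]]]]]].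
Qed.

Lemma produced_stable A : produced strs tau S0 A -> stable strs tau A.
Proof.
elim=> [{}A /stable0 H //|{}A B _ H /stable_asm_eq E|B C {}A _ _ _ _]; first exact: E.
by move=> [A' [B' [_ [_ [_ [_ W]]]]]].
Qed.

End Produced.

Variable T : seq tile.
Notation prod := (produced strs tau (single_tiles T)).

Lemma single_tiles_stable A : single_tiles T A -> stable strs tau A.
Proof. by move=> [p [t [_ ->]]]; exact: stable1. Qed.

Lemma produced_tile p t : t \in T -> prod [:: (p, t)].
Proof. by move=> Ht; apply: Prod_init => //; exists p, t. Qed.

Lemma combinable_sym A B C : combinable strs tau A B C -> combinable strs tau B A C.
Proof.
move=> [A' [B' [HA [HB [D [E W]]]]]]; exists B', A'; do 2!split=> //.
move: E => /asm_eq_perm [WE WC [v Ev]].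
split.
  apply/allP => p Hp; apply/negP => Hp'; move/allP: D => /(_ _ Hp').
  by rewrite Hp.
split=> //; apply/asm_eq_perm; split=> //.
  rewrite /wf_config /dom map_cat uniq_catC -map_cat; exact: WE.
by exists v; apply: perm_trans Ev; apply: perm_map; rewrite perm_catC.
Qed.

Lemma attach_combinable A p t : prod A -> p \notin dom A ->
  tau <= cross A [:: (p, t)] ->
  combinable strs tau A [:: ((Posz 0, Posz 0), t)] (A ++ [:: (p, t)]).
Proof.
move=> PA Hp C; have WA := produced_wf PA.
have WAt : wf_config (A ++ [:: (p, t)]).
  by rewrite /wf_config /dom map_cat cat_uniq; apply/and3P; split; rewrite //= orbF.
exists A, [:: (p, t)]; split; first exact: asm_eq_refl.
split.
  have := @asm_eq_shift p [:: ((Posz 0, Posz 0), t)] isT; rewrite /shift /=.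
  by rewrite /padd /= !add0r; case: (p).
split; first by apply/allP => q Hq; rewrite inE; apply: contraNneq Hp => /= <-.
split; first exact: asm_eq_refl.
by apply: stable_attach => //; apply: produced_stable PA; exact: single_tiles_stable.
Qed.

Lemma produced_attach A p t : prod A -> t \in T -> p \notin dom A ->
  tau <= cross A [:: (p, t)] -> prod (A ++ [:: (p, t)]).
Proof.
move=> PA Ht Hp C; apply: Prod_comb (attach_combinable PA Hp C) => //.
exact: produced_tile.
Qed.

Lemma produced_neq0 A : prod A -> A != [::].
Proof.
elim=> [{}A [p [t [_ ->]]] //|{}A B PA A0 /asm_eq_perm [_ _ [v /perm_size]]|].
  by case: A A0 {PA} => // e A _; case: B.
move=> B C {}A PB B0 PC C0 [A' [B' [/asm_eq_perm [_ _ [v /perm_size E1]] [_ [_ [/asm_eq_perm [_ _ [w /perm_size E2]] _]]]]]].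
move: E1 E2; rewrite /shift !size_map size_cat; case: A => // <-.
by case: B B0 {PB}.
Qed.

End Bonds.

(** * L-shaped systems: cells attach only in the corner of their west and south neighbours *)

Lemma wf_seq1 (A : config) e : wf_config A -> e \in A -> (forall f, f \in A -> f = e) -> A = [:: e].
Proof.
case: A => [|f [|h A]] // W _ H; have Ef : f = e by apply: H; exact: mem_head.
  by rewrite Ef.
have Eh : h = e by apply: H; rewrite !inE eqxx orbT.
by move: W; rewrite Ef Eh /wf_config /= inE eqxx.
Qed.

Inductive glue_kind := Null | Lett | Stat | HStrong | VStrong.
Inductive kind := KCorner | KRow | KCol | KCell.

Section LTiles.
Variables (strs : seq nat) (glue_class : nat -> glue_kind) (T : seq tile) (alpha : tile).

Hypothesis strE : forall g, glue_str strs g =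
  match glue_class g with Null => 0 | Lett | Stat => 1 | HStrong | VStrong => 2 end.

(* Only the south and west sides are inputs: a tile never binds through its north or east
   side to a tile whose own south or west neighbour is already there. *)
Definition tile_kind (t : tile) : kind :=
  match glue_class (tS t), glue_class (tW t) with
  | Null, Null => KCorner
  | Null, _ => KRow
  | _, Null => KCol
  | _, _ => KCell
  end.

(** The output classes are chosen so that a matching glue reveals the kinds of the neighbours:
    [HStrong] continues a corner or row by a row, [VStrong] a corner or column by a column, while
    [Stat] and [Lett] lead into cells only. *)
Definition well_kinded (t : tile) : Prop :=
  match tile_kind t with
  | KCorner => glue_class (tE t) = HStrong /\ glue_class (tN t) = VStrong
  | KRow => glue_class (tW t) = HStrong /\ glue_class (tE t) = HStrong /\ (glue_class (tN t) = Null \/ glue_class (tN t) = Lett)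
  | KCol => glue_class (tS t) = VStrong /\ glue_class (tE t) = Stat /\ (glue_class (tN t) = Null \/ glue_class (tN t) = VStrong)
  | KCell => glue_class (tS t) = Lett /\ glue_class (tW t) = Stat /\ (glue_class (tN t) = Null \/ glue_class (tN t) = Lett) /\
             (glue_class (tE t) = Null \/ glue_class (tE t) = Stat)
  end.

Hypothesis T_kinded : forall t, t \in T -> well_kinded t.

Lemma kind_W t : t \in T -> glue_class (tW t) <> Null <-> tile_kind t = KRow \/ tile_kind t = KCell.
Proof.
move/T_kinded; rewrite /well_kinded /tile_kind.
by case: (glue_class (tS t)) => //; case: (glue_class (tW t)) => //; intuition.
Qed.

Lemma kind_S t : t \in T -> glue_class (tS t) <> Null <-> tile_kind t = KCol \/ tile_kind t = KCell.
Proof.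
move/T_kinded; rewrite /well_kinded /tile_kind.
by case: (glue_class (tS t)) => //; case: (glue_class (tW t)) => //; intuition.
Qed.

Lemma kind_E a b : a \in T -> b \in T -> tE a = tW b -> tile_kind b = KRow \/ tile_kind b = KCell ->
  tile_kind b = KRow /\ (tile_kind a = KCorner \/ tile_kind a = KRow) \/ tile_kind b = KCell /\ (tile_kind a = KCol \/ tile_kind a = KCell).
Proof.
move=> /T_kinded + /T_kinded + E; rewrite /well_kinded.
by case: (tile_kind b); case: (tile_kind a); rewrite E; move=> Ha Hb H; intuition congruence.
Qed.

Lemma kind_N a b : a \in T -> b \in T -> tN a = tS b -> tile_kind b = KCol \/ tile_kind b = KCell ->
  tile_kind b = KCol /\ (tile_kind a = KCorner \/ tile_kind a = KCol) \/ tile_kind b = KCell /\ (tile_kind a = KRow \/ tile_kind a = KCell).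
Proof.
move=> /T_kinded + /T_kinded + E; rewrite /well_kinded.
by case: (tile_kind b); case: (tile_kind a); rewrite E; move=> Ha Hb H; intuition congruence.
Qed.

Definition west (A : config) x y t := exists2 a, ((x - 1)%R, y, a) \in A & tE a = tW t.
Definition south (A : config) x y t := exists2 a, (x, (y - 1)%R, a) \in A & tN a = tS t.

Definition fed (A : config) x y t : Prop :=
  match tile_kind t with
  | KCorner => False
  | KRow => west A x y t
  | KCol => south A x y t
  | KCell => west A x y t /\ south A x y t
  end.

Definition placed (x0 y0 x y : int) t : Prop :=
  match tile_kind t with
  | KCorner => False
  | KRow => y = y0 /\ (x0 < x)%R
  | KCol => x = x0 /\ (y0 < y)%R
  | KCell => (x0 < x)%R /\ (y0 < y)%R
  end.

(* Two assemblies can only bind at an input of one of their roots, which makes this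
   shape stable under combination. *)
Definition rooted (A : config) x0 y0 r : Prop :=
  [/\ (x0, y0, r) \in A,
      forall x y t, (x, y, t) \in A -> (x, y, t) <> (x0, y0, r) -> fed A x y t /\ placed x0 y0 x y t,
      tile_kind r <> KCorner -> forall e, e \in A -> tile_kind e.2 = tile_kind r
    & tile_kind r = KCell -> forall e, e \in A -> e = (x0, y0, r)].

Definition legal (A : config) : Prop :=
  [/\ wf_config A, forall e, e \in A -> e.2 \in T & exists x0 y0 r, rooted A x0 y0 r].

Lemma fed_sub A B x y t : {subset A <= B} -> fed A x y t -> fed B x y t.
Proof.
move=> sAB; have W : west A x y t -> west B x y t by case=> a /sAB; exists a.
have S : south A x y t -> south B x y t by case=> a /sAB; exists a.
by rewrite /fed; case: tile_kind => // -[/W ? /S].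
Qed.

(** Positions in a well-formed configuration are distinct, so at most one tile of [A] contributes to
    the sum. *)
Lemma cross_le1 A f p : wf_config A -> (forall e, e \in A -> bond strs e f <= 1) ->
  (forall e, e \in A -> 0 < bond strs e f -> e.1 = p) -> cross strs A [:: f] <= 1.
Proof.
move=> W H1 H; rewrite /cross; under eq_bigr do rewrite big_seq1.
elim: A W H1 H => [|e A IH] W H1 H; first by rewrite big_nil.
rewrite big_cons; case: (posnP (bond strs e f)) => [->|H0].
  rewrite add0n; apply: IH => [|u Hu|u Hu].
  - by case/andP: W.
  - by apply: H1; rewrite inE Hu orbT.
  - by apply: H; rewrite inE Hu orbT.
rewrite big1_seq ?addn0; first by apply: H1; exact: mem_head.
move=> u /= Hu; case: (posnP (bond strs u f)) => // Hu0.
have E1 := H _ (mem_head _ _) H0; have E2 : u.1 = p by apply: H => //; rewrite inE Hu orbT.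
move: W; rewrite /wf_config /= => /andP [/negP []]; rewrite E1 -E2; exact: map_f.
Qed.


Definition feeds (e f : pos * tile) : Prop :=
  (e.1 = ((f.1.1 - 1)%R, f.1.2) /\ tE e.2 = tW f.2 /\ (tile_kind f.2 = KRow \/ tile_kind f.2 = KCell)) \/
  (e.1 = (f.1.1, (f.1.2 - 1)%R) /\ tN e.2 = tS f.2 /\ (tile_kind f.2 = KCol \/ tile_kind f.2 = KCell)).

Lemma bond_feeds e f : e.2 \in T -> f.2 \in T -> 0 < bond strs e f -> feeds e f \/ feeds f e.
Proof.
case: e f => [[x y] a] [[x' y'] b] /= Ta Tb H0; move: (H0); case: (bondP H0) Tb => {H0}b' E Tb';
  rewrite strE /feeds /= ?addrK ?subrK => H.
- by left; left; do 2!split=> //; apply/kind_W => //; rewrite -E => E0; rewrite E0 in H.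
- by right; left; do 2!split=> //; apply/kind_W => // E0; rewrite E0 in H.
- by left; right; do 2!split=> //; apply/kind_S => //; rewrite -E => E0; rewrite E0 in H.
- by right; right; do 2!split=> //; apply/kind_S => // E0; rewrite E0 in H.
Qed.

Lemma bond_cell_le1 e f : f.2 \in T -> tile_kind f.2 = KCell -> bond strs e f <= 1.
Proof.
case: e f => [[x y] a] [[x' y'] b] /= Tb Kb.
case: (posnP (bond strs (x, y, a) (x', y', b))) => [-> //|H0].
have := T_kinded Tb; rewrite /well_kinded Kb; case: (bondP H0) => b' E [H1 [H2 [H3 H4]]];
  rewrite strE E ?H1 ?H2 //.
- by case: H4 => ->.
- by case: H3 => ->.
Qed.

(** * Gluing rooted assemblies *)

Section Glue.
Variables (A B : config).
Hypotheses (WA : wf_config A) (WB : wf_config B).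
Hypothesis TA : forall e, e \in A -> e.2 \in T.
Hypothesis TB : forall e, e \in B -> e.2 \in T.
Hypothesis D : forall p t u, (p, t) \in A -> (p, u) \in B -> False.

(** Being fed, [s] is not a corner, so all of [B] has the kind of [s] and lies where this kind
    prescribes relative to [s], which itself lies correctly relative to [r]. After gluing, [r] is
    the only tile that may lack inputs. *)
Lemma glue_rooted x0 y0 r x1 y1 s :
  rooted A x0 y0 r -> rooted B x1 y1 s -> fed A x1 y1 s -> rooted (A ++ B) x0 y0 r.
Proof.
move=> [rA FA KA IA] [sB FB KB IB] Fs.
have Ts : s \in T := TB sB.
have Tr : r \in T := TA rA.
have fedW : tile_kind s = KRow \/ tile_kind s = KCell -> exists2 a, ((x1 - 1)%R, y1, a) \in A &
    tile_kind s = KRow /\ (tile_kind a = KCorner \/ tile_kind a = KRow) \/ tile_kind s = KCell /\ (tile_kind a = KCol \/ tile_kind a = KCell).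
  move=> H; have [a aA E] : west A x1 y1 s by move: Fs; rewrite /fed; case: H => -> // -[].
  by exists a => //; apply: kind_E => //; exact: (TA aA).
have fedS : tile_kind s = KCol \/ tile_kind s = KCell -> exists2 a, (x1, (y1 - 1)%R, a) \in A &
    tile_kind s = KCol /\ (tile_kind a = KCorner \/ tile_kind a = KCol) \/ tile_kind s = KCell /\ (tile_kind a = KRow \/ tile_kind a = KCell).
  move=> H; have [a aA E] : south A x1 y1 s by move: Fs; rewrite /fed; case: H => -> // -[].
  by exists a => //; apply: kind_N => //; exact: (TA aA).
have sC : tile_kind s <> KCorner by move: Fs; rewrite /fed; case: (tile_kind s).
have same : tile_kind r <> KCorner -> tile_kind s = tile_kind r.
  move=> rC; have /= HA := KA rC; case: (tile_kind s) fedW fedS sC => // fedW fedS _.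
  - by case: fedW => [|a /HA /= E]; intuition congruence.
  - by case: fedS => [|a /HA /= E]; intuition congruence.
  - case: fedW => [|a /HA /= E]; first by right.
    by case: fedS => [|b /HA /= E']; intuition congruence.
(* A cell root would be all of [A], and one position cannot be both west and south of [s]. *)
have notI : tile_kind r <> KCell.
  move=> rI; have /= HA := IA rI; have sI : tile_kind s = KCell by rewrite same rI.
  case: fedW => [|a /HA [Ex Ey _] _]; first by right.
  by case: fedS => [|b /HA [Ex' Ey' _] _]; [right | lia].
have Ps : placed x0 y0 x1 y1 s.
  have P a x y : (x, y, a) \in A -> (x, y, a) = (x0, y0, r) \/ placed x0 y0 x y a.
    by move=> aA; case: (classic ((x, y, a) = (x0, y0, r))) => [|/(FA _ _ _ aA) []]; auto.
  rewrite /placed; case E: (tile_kind s) (fedW) (fedS) same => [|||] // HW HS same.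
  - case: HW => [|a /P Pa Ka]; first by left.
    case: Pa => [[Ex Ey _]|]; first by lia.
    by rewrite /placed; case: Ka => -[] // _ [] -> //; lia.
  - case: HS => [|a /P Pa Ka]; first by left.
    case: Pa => [[Ex Ey _]|]; first by lia.
    by rewrite /placed; case: Ka => -[] // _ [] -> //; lia.
  - case: HW => [|a aA Ka]; first by right.
    have rC : tile_kind r = KCorner.
      by case Er: (tile_kind r) same notI => // same notI; case: same.
    case: (P _ _ _ aA) => [[_ _ Ea]|].
      by move: Ka; rewrite Ea rC; intuition congruence.
    by rewrite /placed; case: Ka => -[] // _ [] -> //; lia.
split.
- by rewrite mem_cat rA.
- move=> x y t; rewrite mem_cat => /orP [tA ne|tB ne].
    case: (FA _ _ _ tA ne) => F P; split=> //; apply: fed_sub F.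
    by move=> e; rewrite mem_cat => ->.
  case: (classic ((x, y, t) = (x1, y1, s))) => [[-> -> ->]|ne1].
    by split=> //; apply: fed_sub Fs => e; rewrite mem_cat => ->.
  case: (FB _ _ _ tB ne1) => F P; split.
    by apply: fed_sub F => e; rewrite mem_cat orbC => ->.
  have /= Kt := KB sC _ tB.
  by move: P Ps; rewrite /placed Kt; case: (tile_kind s) => //; lia.
- move=> rC e; rewrite mem_cat => /orP [/(KA rC) //|/(KB sC) ->]; exact: same.
- by move/notI.
Qed.

End Glue.

(** A tile of [B] other than its root already has its input neighbours inside [B], and [A] cannot
    occupy these positions again. *)
Lemma feeds_root (A B : config) e x1 y1 s f : (forall p t u, (p, t) \in A -> (p, u) \in B -> False) ->
  rooted B x1 y1 s -> e \in A -> f \in B -> feeds e f -> f = (x1, y1, s).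
Proof.
move=> D [_ FB _ _]; case: e f => p a [[x y] t] eA fB Ff.
case: (classic ((x, y, t) = (x1, y1, s))) => // /(FB _ _ _ fB) [F _].
case: Ff => /= -[Ep [Ea Kt]].
  have [b bB _] : west B x y t by move: F; rewrite /fed; case: Kt => -> // -[].
  by rewrite Ep in eA; case: (D _ _ _ eA bB).
have [b bB _] : south B x y t by move: F; rewrite /fed; case: Kt => -> // -[].
by rewrite Ep in eA; case: (D _ _ _ eA bB).
Qed.

(** Only a cell needs an argument: it is then all of [B], and its bonds have strength at most 1. If
    it fed a tile of [A], that tile would be a root and a cell, hence all of [A], leaving a single
    bond. So all bonds enter the cell, and reaching 2 takes both its west and its south side. *)
Lemma feeds_fed (A B : config) e x0 y0 r x1 y1 s :
  wf_config A -> wf_config B -> (forall e, e \in A -> e.2 \in T) -> (forall e, e \in B -> e.2 \in T) ->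
  (forall p t u, (p, t) \in A -> (p, u) \in B -> False) ->
  rooted A x0 y0 r -> rooted B x1 y1 s -> 2 <= cross strs A B ->
  e \in A -> feeds e (x1, y1, s) -> fed A x1 y1 s.
Proof.
move=> WA WB TA TB D RA RB C eA Fe.
have [sB _ _ IB] := RB; have Ts : s \in T := TB _ sB.
have F0 : tile_kind s <> KCell -> fed A x1 y1 s.
  case: e Fe eA => p a Fe eA; rewrite /fed; case: Fe => /= -[Ep [Ea Ks]]; rewrite Ep in eA.
    by case: Ks => -> // _; exists a.
  by case: Ks => -> // _; exists a.
case Ks: (tile_kind s) F0 => F0; try exact: F0.
have EB : B = [:: (x1, y1, s)] by exact: wf_seq1 (IB Ks).
have le1 f : bond strs f (x1, y1, s) <= 1 by exact: bond_cell_le1.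
rewrite EB in C.
have big p : (forall f, f \in A -> 0 < bond strs f (x1, y1, s) -> f.1 = p) -> False.
  by move=> /(cross_le1 WA (fun f _ => le1 f)); rewrite leqNgt C.
case: (classic (exists2 f, f \in A & feeds (x1, y1, s) f)) => [[f fA Ff]|nF].
  have Ef : f = (x0, y0, r).
    by apply: (feeds_root _ RA sB fA Ff) => p t u H1 H2; apply: D H2 H1.
  have Kr : tile_kind r = KCell.
    rewrite Ef in fA Ff; case: Ff => /= -[_ [E K]].
      by have := kind_E Ts (TA _ fA) E K; rewrite Ks; intuition.
    by have := kind_N Ts (TA _ fA) E K; rewrite Ks; intuition.
  by have [_ _ _ IA] := RA; case: (big (x0, y0)) => g /(IA Kr) ->.
have all_feed f : f \in A -> 0 < bond strs f (x1, y1, s) -> feeds f (x1, y1, s).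
  by move=> fA /(bond_feeds (f := (x1, y1, s)) (TA _ fA) Ts) [//|Ff]; case: nF; exists f.
rewrite /fed Ks; split.
  apply: NNPP => nW; apply: (big (x1, (y1 - 1)%R)) => -[p a] fA /(all_feed _ fA) [] /= [Ep [Ea _]] //.
  by case: nW; rewrite Ep in fA; exists a.
apply: NNPP => nW; apply: (big ((x1 - 1)%R, y1)) => -[p a] fA /(all_feed _ fA) [] /= [Ep [Ea _]] //.
by case: nW; rewrite Ep in fA; exists a.
Qed.

Lemma rooted_mem (A B : config) x y r : A =i B -> rooted A x y r -> rooted B x y r.
Proof.
move=> E [H1 H2 H3 H4]; split; first by rewrite -E.
- move=> x' y' t; rewrite -E => tA /(H2 _ _ _ tA) [F P]; split=> //.
  by apply: fed_sub F => e; rewrite E.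
- by move=> rC e; rewrite -E; exact: H3.
- by move=> rC e; rewrite -E; exact: H4.
Qed.

Lemma cross_legal A B : legal A -> legal B -> wf_config (A ++ B) -> 2 <= cross strs A B ->
  (exists x1 y1 s, rooted B x1 y1 s /\ fed A x1 y1 s) \/
  (exists x0 y0 r, rooted A x0 y0 r /\ fed B x0 y0 r).
Proof.
move=> [WA TA [x0 [y0 [r RA]]]] [WB TB [x1 [y1 [s RB]]]] W C.
have D p t u : (p, t) \in A -> (p, u) \in B -> False.
  move=> pA pB; move: W; rewrite /wf_config /dom map_cat cat_uniq => /and3P [_ /hasP []].
  by exists p; apply/mem_dom; [exists u|exists t].
have [e [f [eA fB ef]]] : exists e f, [/\ e \in A, f \in B & 0 < bond strs e f].
  by apply: cross_gt0; apply: leq_trans C.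
case: (bond_feeds (TA _ eA) (TB _ fB) ef) => F.
  have Ef := feeds_root D RB eA fB F; rewrite Ef in F.
  left; exists x1, y1, s; split=> //; exact: (feeds_fed WA WB TA TB D RA RB C eA F).
have D' p t u : (p, t) \in B -> (p, u) \in A -> False by move=> H1 H2; apply: D H2 H1.
have Ef := feeds_root D' RA fB eA F; rewrite Ef in F.
right; exists x0, y0, r; split=> //.
by apply: (feeds_fed WB WA TB TA D' RB RA _ fB F); rewrite cross_sym.
Qed.

Lemma legal_cat A B : legal A -> legal B -> wf_config (A ++ B) -> 2 <= cross strs A B ->
  legal (A ++ B).
Proof.
move=> LA LB W C; have [WA TA [x0 [y0 [r RA]]]] := LA; have [WB TB [x1 [y1 [s RB]]]] := LB.
have TAB e : e \in A ++ B -> e.2 \in T by rewrite mem_cat => /orP [/TA|/TB].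
split=> //; case: (cross_legal LA LB W C) => -[x [y [t [Rt Ft]]]].
  by exists x0, y0, r; apply: glue_rooted RA Rt Ft.
exists x1, y1, s; apply: (@rooted_mem (B ++ A)); first by move=> e; rewrite !mem_cat orbC.
by apply: glue_rooted RB Rt Ft.
Qed.

Lemma legal_perm A B : perm_eq A B -> legal A -> legal B.
Proof.
move=> E [WA TA [x [y [r RA]]]]; split.
- by rewrite /wf_config -(perm_uniq (perm_map _ E)).
- by move=> e; rewrite -(perm_mem E); exact: TA.
by exists x, y, r; apply: rooted_mem RA; exact: perm_mem.
Qed.

Lemma legal_shift v A : legal A -> legal (shift v A).
Proof.
move=> [WA TA [x [y [r [H1 H2 H3 H4]]]]]; split; first by rewrite wf_shift.
  by move=> e /mapP [f /TA Tf ->].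
case: v => vx vy; exists (x + vx)%R, (y + vy)%R, r; split.
- by apply/mapP; exists (x, y, r).
- move=> x' y' t /mapP [[[x1 y1] t1] tA /= [-> -> ->]] ne.
  have [|F P] := H2 _ _ _ tA; first by move=> [E1 E2 E3]; apply: ne; rewrite E1 E2 E3.
  have W : west A x1 y1 t1 -> west (shift (vx, vy) A) (x1 + vx)%R (y1 + vy)%R t1.
    by case=> a aA E; exists a => //; apply/mapP; exists ((x1 - 1)%R, y1, a) => //=;
       rewrite /padd /=; do 2!congr pair; lia.
  have S : south A x1 y1 t1 -> south (shift (vx, vy) A) (x1 + vx)%R (y1 + vy)%R t1.
    by case=> a aA E; exists a => //; apply/mapP; exists (x1, (y1 - 1)%R, a) => //=;
       rewrite /padd /=; do 2!congr pair; lia.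
  by move: F P; rewrite /fed /placed; case: (tile_kind t1) => [||| [/W ? /S ?]] //; 
    [move=> /W ? | move=> /S ? |]; lia || (split=> //; lia).
- by move=> rC e /mapP [f /(H3 rC) Ef ->].
- by move=> rC e /mapP [f /(H4 rC) -> ->].
Qed.

Lemma legal_asm_eq A B : asm_eq A B -> legal A -> legal B.
Proof. by move/asm_eq_perm=> [_ _ [v E]] /(legal_shift v); exact: legal_perm. Qed.

Lemma legal_tile p t : t \in T -> legal [:: (p, t)].
Proof.
move=> Tt; split=> //; first by move=> e; rewrite inE => /eqP ->.
case: p => x y; exists x, y, t; split; first exact: mem_head.
- by move=> x' y' t'; rewrite inE => /eqP.
- by move=> _ e; rewrite inE => /eqP ->.
- by move=> _ e; rewrite inE => /eqP ->.
Qed.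

Notation prod := (produced strs 2 (single_tiles T)).

Lemma combinable_cross A B C A' B' : prod A -> prod B -> asm_eq A A' -> asm_eq B B' ->
  disjoint_dom A' B' -> asm_eq (A' ++ B') C -> stable strs 2 C ->
  wf_config (A' ++ B') /\ 2 <= cross strs A' B'.
Proof.
move=> PA PB EA EB D EC SC; have [W _] := EC; split=> //.
apply: stable_cross => //; last by apply: stable_asm_eq SC; exact: asm_eq_sym.
  by apply/negP => /eqP; apply/eqP; apply: (produced_neq0 (Prod_eq PA EA)).
by apply/negP => /eqP; apply/eqP; apply: (produced_neq0 (Prod_eq PB EB)).
Qed.

Lemma produced_legal A : prod A -> legal A.
Proof.
elim=> [{}A [p [t [Tt ->]]] _|{}A B _ LA /legal_asm_eq|B C {}A PB LB PC LC]; first exact: legal_tile.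
  exact.
move=> [B' [C' [EB [EC [D [E S]]]]]]; apply: (legal_asm_eq E).
have [W C2] := combinable_cross PB PC EB EC D E S.
by apply: legal_cat => //; [apply: legal_asm_eq EB _|apply: legal_asm_eq EC _].
Qed.

Lemma ex_max_mem (I : eqType) (P : pred I) (f : I -> int) (s : seq I) : has P s ->
  exists2 e, e \in s & P e /\ forall e', e' \in s -> P e' -> (f e' <= f e)%R.
Proof.
elim: s => [|e s IH] //=; case Ps: (has P s) => [|] Pe.
  have {IH} [//|m ms [Pm Hm]] := IH.
  case Pe': (P e); last first.
    by exists m; rewrite ?inE ?ms ?orbT //; split=> // e'; rewrite inE => /orP [/eqP ->|/Hm //]; rewrite Pe'.
  case: (lerP (f e) (f m)) => H.
    by exists m; rewrite ?inE ?ms ?orbT //; split=> // e'; rewrite inE => /orP [/eqP ->|/Hm].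
  exists e; first exact: mem_head.
  by split=> // e'; rewrite inE => /orP [/eqP -> //|/Hm H' /H'] H''; apply: le_trans H'' (ltW H).
exists e; first exact: mem_head.
rewrite orbF in Pe; split=> // e'; rewrite inE => /orP [/eqP -> //|H' Pe'].
by case/hasP: Ps; exists e'.
Qed.

(** * Complete rectangles *)

Definition on_grid (a b : nat) (g : nat -> nat -> tile) : Prop :=
  [/\ forall i j, i <= a -> j <= b -> g i j \in T, tile_kind (g 0 0) = KCorner,
      forall i, i < a -> tile_kind (g i.+1 0) = KRow /\ tE (g i 0) = tW (g i.+1 0),
      forall j, j < b -> tile_kind (g 0 j.+1) = KCol /\ tN (g 0 j) = tS (g 0 j.+1)
    & forall i j, i < a -> j < b -> [/\ tile_kind (g i.+1 j.+1) = KCell,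
        tE (g i j.+1) = tW (g i.+1 j.+1) & tN (g i.+1 j) = tS (g i.+1 j.+1)]].

(** The geometric form of being attachable: the rectangle without its top right cell is produced and
    [t] attaches to it, and conversely a cell of a corner-rooted assembly spans such a rectangle
    with the root. *)
Definition grid_reaches (t : tile) : Prop :=
  exists a b g, [/\ on_grid a.+1 b.+1 g & g a.+1 b.+1 = t].

Lemma bond_cross_row A x y a t p : a \in T -> t \in T -> (x, y, a) \in A -> p = ((x + 1)%R, y) ->
  tE a = tW t -> tile_kind t = KRow -> 2 <= cross strs A [:: (p, t)].
Proof.
move=> Ta Tt aA -> E K; apply: leq_trans (leq_cross1 strs _ aA).
by rewrite bondE E eqxx strE; have := T_kinded Tt; rewrite /well_kinded K => -[-> _].
Qed.

Lemma bond_cross_col A x y a t p : a \in T -> t \in T -> (x, y, a) \in A -> p = (x, (y + 1)%R) ->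
  tN a = tS t -> tile_kind t = KCol -> 2 <= cross strs A [:: (p, t)].
Proof.
move=> Ta Tt aA -> E K; apply: leq_trans (leq_cross1 strs _ aA).
by rewrite bondN E eqxx strE; have := T_kinded Tt; rewrite /well_kinded K => -[-> _].
Qed.

Lemma bond_cross_cell A x y a b t p : t \in T -> p = ((x + 1)%R, (y + 1)%R) ->
  (x, (y + 1)%R, a) \in A -> tE a = tW t -> ((x + 1)%R, y, b) \in A -> tN b = tS t ->
  tile_kind t = KCell -> 2 <= cross strs A [:: (p, t)].
Proof.
move=> Tt -> aA Ea bA Eb K; have ne : (x, (y + 1)%R, a) != ((x + 1)%R, y, b).
  by apply/eqP => -[]; lia.
apply: leq_trans (leq_cross2 strs _ ne aA bA).
rewrite bondE bondN Ea Eb !eqxx !strE.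
by have := T_kinded Tt; rewrite /well_kinded K => -[-> [-> _]].
Qed.

Section Grid.
Variables (a b : nat) (g : nat -> nat -> tile).
Hypothesis G : on_grid a b g.

(** Reading order, in rows of length [a.+1] from south to north: the inputs of a tile always come
    before it. *)
Definition grid_cell (k : nat) : pos * tile :=
  let i := k %% a.+1 in let j := k %/ a.+1 in (Posz i, Posz j, g i j).

Definition grid_asm (k : nat) : config := [seq grid_cell l | l <- iota 0 k].

Lemma grid_asmS k : grid_asm k.+1 = grid_asm k ++ [:: grid_cell k].
Proof. by rewrite /grid_asm -addn1 iotaD map_cat. Qed.

Lemma mem_grid_asm k i j : i <= a -> j * a.+1 + i < k -> (Posz i, Posz j, g i j) \in grid_asm k.
Proof.
move=> Hi Hk; apply/mapP; exists (j * a.+1 + i); first by rewrite mem_iota.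
by rewrite /grid_cell divnMDl // divn_small // addn0 modnMDl modn_small.
Qed.

Lemma grid_cell_new k : (grid_cell k).1 \notin dom (grid_asm k).
Proof.
apply/negP => /mapP [e /mapP [l]]; rewrite mem_iota => Hl -> /= [E1 E2].
by move: Hl; rewrite (divn_eq k a.+1) (divn_eq l a.+1) E1 E2; lia.
Qed.

Lemma grid_cross k : 0 < k -> k < a.+1 * b.+1 -> 2 <= cross strs (grid_asm k) [:: grid_cell k].
Proof.
move=> k0 kab; have [GT G0 GB GV GI] := G; rewrite /grid_cell.
have Hi : k %% a.+1 <= a by rewrite -ltnS ltn_mod.
have Hj : k %/ a.+1 <= b by rewrite -ltnS ltn_divLR // mulnC.
have Ek := divn_eq k a.+1.
case Ei: (k %% a.+1) Hi Ek => [|i]; case Ej: (k %/ a.+1) Hj => [|j] Hj Hi Ek.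
- by rewrite Ek in k0.
- have [K E] := GV j Hj; apply: (@bond_cross_col _ 0%R (Posz j) (g 0 j)) => //; try (by apply: GT => //; lia).
  + by apply: mem_grid_asm => //; lia.
  + by congr pair; lia.
- have [K E] := GB i Hi; apply: (@bond_cross_row _ (Posz i) 0%R (g i 0)) => //; try (by apply: GT => //; lia).
  + by apply: mem_grid_asm => //; lia.
  + by congr pair; lia.
- have [K E1 E2] := GI i j Hi Hj.
  have Pi : (Posz i + 1)%R = Posz i.+1 by lia.
  have Pj : (Posz j + 1)%R = Posz j.+1 by lia.
  apply: (@bond_cross_cell _ (Posz i) (Posz j) (g i j.+1) (g i.+1 j)) => //; rewrite ?Pi ?Pj //.
  + exact: GT.
  + by apply: mem_grid_asm; lia.
  + by apply: mem_grid_asm; lia.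
Qed.

Lemma grid_produced k : k < a.+1 * b.+1 -> prod (grid_asm k.+1).
Proof.
have [GT G0 GB GV GI] := G.
elim: k => [|k IH] Hk.
  by apply: produced_tile; rewrite mod0n div0n; apply: GT.
rewrite grid_asmS; apply: produced_attach => //.
- by apply: IH; exact: ltnW.
- apply: GT; first by rewrite -ltnS ltn_mod.
  by rewrite -ltnS ltn_divLR // mulnC.
- exact: grid_cell_new.
- exact: grid_cross.
Qed.

End Grid.

Lemma grid_combinable t p : grid_reaches t -> exists B C, prod B /\ combinable strs 2 [:: (p, t)] B C.
Proof.
(* [k] is the index of the top right cell in reading order, so [grid_asm a.+1 g k] is the rectangle
   without it. *)
move=> [a [b [g [G Et]]]]; set k := b.+1 * a.+2 + a.+1.
have Hk : k < a.+2 * b.+2 by rewrite /k; lia.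
have k0 : 0 < k by rewrite /k; lia.
have Pk : prod (grid_asm a.+1 g k).
  by have := @grid_produced _ _ _ G k.-1; rewrite prednK //; apply; apply: leq_ltn_trans Hk; exact: leq_pred.
have Ek : (grid_cell a.+1 g k).2 = t.
  by rewrite /grid_cell /k divnMDl // divn_small // addn0 modnMDl modn_small.
have H := attach_combinable (t := t) (p := (grid_cell a.+1 g k).1) Pk (grid_cell_new _ _ _).
have C : 2 <= cross strs (grid_asm a.+1 g k) [:: ((grid_cell a.+1 g k).1, t)].
  by rewrite -Ek -(surjective_pairing (grid_cell _ _ _)); exact: (grid_cross G k0 Hk).
exists (grid_asm a.+1 g k), (grid_asm a.+1 g k ++ [:: ((grid_cell a.+1 g k).1, t)]); split=> //.
case/combinable_sym: (H C) => A' [B' [EA R]]; exists A', B'; split=> //; apply: asm_eq_trans EA.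
case: p => x y; have := @asm_eq_shift ((- x)%R, (- y)%R) [:: (x, y, t)] isT.
by rewrite /shift /= /padd /= !subrr.
Qed.

(** Every tile but the root is fed, and its kind is forced by its position relative to the root, so
    within the quadrant of the root the occupied positions are closed under going west and south.
    The rectangle between the root and [t] is therefore full. *)
Lemma rooted_grid A x0 y0 r x y t : wf_config A -> (forall e, e \in A -> e.2 \in T) ->
  rooted A x0 y0 r -> (x, y, t) \in A -> tile_kind t = KCell -> tile_kind r = KCorner -> grid_reaches t.
Proof.
move=> WA TA [rA FA _ _] tA Kt Kr.
pose occ i j := exists t, ((x0 + Posz i)%R, (y0 + Posz j)%R, t) \in A.
(* The default [t] is immaterial: facts about [g] are drawn at occupied positions only. *)
pose g i j := odflt t (lookup A ((x0 + Posz i)%R, (y0 + Posz j)%R)).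
have gP i j : occ i j -> ((x0 + Posz i)%R, (y0 + Posz j)%R, g i j) \in A.
  by case=> u uA; rewrite /g (iffRL (lookupP _ _ WA) uA).
have gU i j u : ((x0 + Posz i)%R, (y0 + Posz j)%R, u) \in A -> u = g i j.
  by move=> uA; apply: (wf_inj WA uA); apply: gP; exists u.
have nr i j u : ((x0 + Posz i)%R, (y0 + Posz j)%R, u) \in A -> 0 < i + j ->
    fed A (x0 + Posz i)%R (y0 + Posz j)%R u /\ placed x0 y0 (x0 + Posz i)%R (y0 + Posz j)%R u.
  by move=> uA ij; apply: FA => // -[]; lia.
have S1 i : (x0 + Posz i.+1 - 1 = x0 + Posz i)%R by lia.
have S2 j : (y0 + Posz j.+1 - 1 = y0 + Posz j)%R by lia.
have row i : occ i.+1 0 -> [/\ occ i 0, tile_kind (g i.+1 0) = KRow & tE (g i 0) = tW (g i.+1 0)].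
  move/gP => uA; have [] := nr _ _ _ uA isT; rewrite /fed /placed /west.
  case K: (tile_kind (g i.+1 0)); rewrite ?S1; [by []| |by lia|by lia].
  by case=> u vA E _; split=> //; [exists u|rewrite -(gU _ _ _ vA)].
have col j : occ 0 j.+1 -> [/\ occ 0 j, tile_kind (g 0 j.+1) = KCol & tN (g 0 j) = tS (g 0 j.+1)].
  move/gP => uA; have [] := nr _ _ _ uA isT; rewrite /fed /placed /south.
  case K: (tile_kind (g 0 j.+1)); rewrite ?S2; [by []|by lia| |by lia].
  by case=> u vA E _; split=> //; [exists u|rewrite -(gU _ _ _ vA)].
have cell i j : occ i.+1 j.+1 -> [/\ occ i j.+1, occ i.+1 j, tile_kind (g i.+1 j.+1) = KCell,
    tE (g i j.+1) = tW (g i.+1 j.+1) & tN (g i.+1 j) = tS (g i.+1 j.+1)].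
  move/gP => uA; have [] := nr _ _ _ uA isT; rewrite /fed /placed.
  case K: (tile_kind (g i.+1 j.+1)); rewrite /west /south ?S1 ?S2; [by []|by lia|by lia|].
  move=> [[u vA E] [u' vA' E']] _; split=> //; [by exists u|by exists u'| |].
    by rewrite -(gU _ _ _ vA).
  by rewrite -(gU _ _ _ vA').
have occW i j : occ i.+1 j -> occ i j by case: j => [/row []|j /cell []].
have occS i j : occ i j.+1 -> occ i j by case: i => [/col []|i /cell []].
have occD i j i' j' : occ i j -> i' <= i -> j' <= j -> occ i' j'.
  move=> O; elim: i O => [|i IH] O.
    rewrite leqn0 => /eqP ->; elim: j O => [|j IH] O; first by rewrite leqn0 => /eqP ->.
    rewrite leq_eqVlt => /orP [/eqP -> //|]; exact/IH/occS.
  rewrite leq_eqVlt => /orP [/eqP ->|Hi]; last exact: IH (occW _ _ O) Hi.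
  elim: j O {IH} => [|j IH] O; first by rewrite leqn0 => /eqP ->.
  rewrite leq_eqVlt => /orP [/eqP -> //|]; exact/IH/occS.
have [Px Py] : (x0 < x)%R /\ (y0 < y)%R.
  have [] := FA _ _ _ tA; last by rewrite /placed Kt.
  by case=> _ _ E; move: Kt; rewrite E Kr.
pose a := (`|x - x0|.-1)%N; pose b := (`|y - y0|.-1)%N.
have Ea : x = (x0 + Posz a.+1)%R by rewrite /a; lia.
have Eb : y = (y0 + Posz b.+1)%R by rewrite /b; lia.
exists a, b, g; rewrite Ea Eb in tA; have Eg := gU _ _ _ tA.
have {}occD i j : i <= a.+1 -> j <= b.+1 -> occ i j by apply: occD; exists t.
split=> //; split.
- by move=> i j Hi Hj; have /TA := gP _ _ (occD _ _ Hi Hj).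
- by rewrite -(gU 0 0 r) // !addr0.
- by move=> i Hi; have [] := row i; first exact: occD.
- by move=> j Hj; have [] := col j; first exact: occD.
- by move=> i j Hi Hj; have [] := cell i j; first exact: occD.
Qed.

Hypothesis alphaT : alpha \in T.
Hypothesis alpha_cell : tile_kind alpha = KCell.
Hypothesis alphaN : glue_class (tN alpha) = Null.
Hypothesis alphaE : glue_class (tE alpha) = Null.
Hypothesis row_ext : forall t, t \in T -> tile_kind t = KCorner \/ tile_kind t = KRow ->
  exists2 u, u \in T & tE t = tW u.
Hypothesis col_ext : forall t, t \in T -> tile_kind t = KCol -> exists2 u, u \in T & tN u = tS t.
Hypothesis cell_ext : forall t, t \in T -> tile_kind t = KCell -> t <> alpha -> grid_reaches t.

(** * Terminal assemblies of an L-shaped system *)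

Notation origin := (Posz 0, Posz 0).

(** The root decides where growth is possible. A cell root is a lone tile other than [alpha], which
    joins its rectangle; a column grows just below its root, where it has no tile; a row or an L
    grows at the east end of the root's row. *)
Lemma produced_extends A : prod A -> ~ asm_eq A [:: (origin, alpha)] ->
  exists B C, prod B /\ combinable strs 2 A B C.
Proof.
move=> PA nA; have [WA TA [x0 [y0 [r RA]]]] := produced_legal PA.
have [rA FA KA IA] := RA; have Tr : r \in T := TA _ rA.
case Kr: (tile_kind r).
4: {
  have EA : A = [:: (x0, y0, r)] by exact: wf_seq1 (IA Kr).
  rewrite EA; apply: grid_combinable; apply: cell_ext => // Er; apply: nA.
  rewrite EA Er; have := @asm_eq_shift ((- x0)%R, (- y0)%R) [:: (x0, y0, alpha)] isT.
  by rewrite /shift /= /padd /= !subrr.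
}
3: {
  have [u Tu Eu] := col_ext Tr Kr.
  exists [:: (origin, u)], (A ++ [:: (x0, (y0 - 1)%R, u)]).
  split; first exact: produced_tile.
  apply: (attach_combinable PA).
    apply/negP => /mem_dom [t tA]; case: (FA _ _ _ tA) => [[]|_]; first by lia.
    have /= Kt := KA _ _ tA.
    by rewrite /placed Kt ?Kr //; lia.
  apply: leq_trans (leq_cross1 strs _ rA).
  have := bondN strs x0 (y0 - 1)%R u r; rewrite subrK bond_sym => ->.
  by rewrite Eu eqxx strE; have := T_kinded Tr; rewrite /well_kinded Kr => -[-> _].
}
(* The easternmost tile at the height of the root: by maximality the position east of it is free. *)
all: have [|e eA [/eqP Ey Hmax]] := @ex_max_mem _ (fun e => e.1.2 == y0) (fun e => e.1.1) A;
  first by (apply/hasP; exists (x0, y0, r)).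
all: case: e Ey eA Hmax => [[x y] t] /= -> {y} tA Hmax.
all: have Tt : t \in T := TA _ tA.
all: have Kt : tile_kind t = KCorner \/ tile_kind t = KRow by
  case: (classic ((x, y0, t) = (x0, y0, r))) => [[_ ->]|/(FA _ _ _ tA) [_]];
  [rewrite Kr; auto|rewrite /placed; case: (tile_kind t); auto; lia].
all: have [u Tu Eu] := row_ext Tt Kt.
all: exists [:: (origin, u)], (A ++ [:: ((x + 1)%R, y0, u)]).
all: split; first exact: produced_tile.
all: apply: (attach_combinable PA);
  [by apply/negP => /mem_dom [v vA]; have := Hmax _ vA (eqxx _); rewrite /=; lia|].
all: apply: leq_trans (leq_cross1 strs _ tA).
all: have Et : glue_class (tE t) = HStrong by
  move: (T_kinded Tt); rewrite /well_kinded; case: Kt => -> [? []] //; intuition congruence.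
all: by rewrite bondE Eu eqxx -Eu strE Et.
Qed.

(** With null outputs [alpha] feeds nothing, so it is itself fed by [B]. The union then has a corner
    as root: any other root would have to be a cell like [alpha], hence the whole assembly, and
    [alpha] would overlap [B]. *)
Lemma alpha_combinable B C : prod B -> combinable strs 2 [:: (origin, alpha)] B C -> grid_reaches alpha.
Proof.
move=> PB [A' [B' [EA [EB [D [E S]]]]]].
have PA := @produced_tile strs 2 T origin alpha alphaT.
have [W C2] := combinable_cross PA PB EA EB D E S.
have LB := legal_asm_eq EB (produced_legal PB).
have LA := legal_asm_eq EA (produced_legal PA).
have [WA TA [xa [ya [ta RA]]]] := LA; have [WB TB [xb [yb [tb RB]]]] := LB.
have D' p t u : (p, t) \in B' -> (p, u) \in A' -> False.
  move=> H1 H2; move/allP: D => /(_ p); case/(_ _)/negP; first by apply/mem_dom; exists u.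
  by apply/mem_dom; exists t.
have memA e : e \in A' -> e = (xa, ya, alpha).
  move: EA => /asm_eq_perm [_ _ [v /perm_mem EA]].
  have H e' : e' \in A' -> e'.2 = alpha by rewrite -EA inE => /eqP ->.
  have [rA _ _ IA] := RA; have /= Eta := H _ rA; rewrite -Eta; apply: IA.
  by rewrite Eta.
have [rA _ _ _] := RA; have [Eta] := memA _ rA; rewrite Eta in RA rA.
case: (cross_legal LA LB W C2) => -[x [y [t [Rt Ft]]]].
  have [tB _ _ _] := Rt; have Tt := TB _ tB.
  exfalso; move: Ft; rewrite /fed; case Kt: (tile_kind t) => //.
  - by case=> u /memA [_ _ ->] Eu; case: (iffRL (kind_W Tt) (or_introl Kt)); rewrite -Eu.
  - by case=> u /memA [_ _ ->] Eu; case: (iffRL (kind_S Tt) (or_introl Kt)); rewrite -Eu.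
  - by case=> -[u /memA [_ _ ->] Eu] _; case: (iffRL (kind_W Tt) (or_intror Kt)); rewrite -Eu.
have [tA _ _ _] := Rt; have [Ex Ey Et] := memA _ tA; rewrite Ex Ey Et in Rt Ft.
have RU : rooted (B' ++ A') xb yb tb by apply: glue_rooted RB Rt Ft.
have WU : wf_config (B' ++ A') by rewrite /wf_config /dom map_cat uniq_catC -map_cat.
have aU : (xa, ya, alpha) \in B' ++ A' by rewrite mem_cat rA orbT.
have TU e : e \in B' ++ A' -> e.2 \in T by rewrite mem_cat => /orP [/TB|/TA].
apply: (rooted_grid WU TU RU aU alpha_cell).
have [bU _ KU IU] := RU; case Kb: (tile_kind tb) => //; first 2 last.
all: exfalso.
- have := IU Kb; move=> H; have [Exa Eya _] := H _ aU; have [bB _ _ _] := RB.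
  by apply: (D' _ _ _ bB); rewrite -Exa -Eya; exact: rA.
all: by suff: tile_kind alpha = tile_kind tb; [rewrite alpha_cell Kb | apply: (KU _ _ aU); rewrite Kb].
Qed.

Lemma terminal_tiles X : terminal strs 2 (single_tiles T) X <->
  asm_eq X [:: (origin, alpha)] /\ ~ grid_reaches alpha.
Proof.
split=> [[PX HX]|[EX nG]].
  have EX : asm_eq X [:: (origin, alpha)].
    by apply: NNPP => /(produced_extends PX) [B [C [PB]]]; exact: HX.
  split=> // /(grid_combinable origin) [B [C [PB [A' [B' [EA R]]]]]].
  by apply: (HX B C PB); exists A', B'; split=> //; exact: asm_eq_trans EA.
split; first by apply: Prod_eq (asm_eq_sym EX); exact: produced_tile.
move=> B C PB [A' [B' [EA R]]]; apply: nG; apply: (alpha_combinable (B := B) (C := C) PB).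
by exists A', B'; split=> //; apply: asm_eq_trans EA; exact: asm_eq_sym.
Qed.

End LTiles.

(** * Machine steps as runs of a letter-to-letter transducer *)

Section Machine.
Variables (Q Sym : finType) (delta : Q -> Sym -> Q * Sym * 'I_3) (halt acc : pred Q).

Record mconf := MConf { mc_state : Q; mc_tape : int -> Sym; mc_head : int }.

Definition mstep (c : mconf) : mconf :=
  if halt (mc_state c) then c else
  let: (q', s', m) := delta (mc_state c) (mc_tape c (mc_head c)) in
  MConf q' (fun z => if z == mc_head c then s' else mc_tape c z)
        (mc_head c + Posz (val m) - 1)%R.

(* Horizontal states of the left-to-right transducer performing one machine step:
   the head has not been met yet, the step is complete, the head is moving left
   (guessed before meeting it) or right, an accepting head has been met. *)
Inductive hstate := HInit | HDone | HLeft of Q | HRight of Q | HAcc | HFinal | HEnd.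

Definition hstate_code (h : hstate) : 'I_5 + bool * Q :=
  match h with
  | HInit => inl (inord 0) | HDone => inl (inord 1) | HAcc => inl (inord 2)
  | HFinal => inl (inord 3) | HEnd => inl (inord 4)
  | HLeft q => inr (false, q) | HRight q => inr (true, q)
  end.

Definition hstate_decode (c : 'I_5 + bool * Q) : hstate :=
  match c with
  | inl i => nth HInit [:: HInit; HDone; HAcc; HFinal; HEnd] i
  | inr (b, q) => if b then HRight q else HLeft q
  end.

Lemma hstate_codeK : cancel hstate_code hstate_decode.
Proof. by case=> //=; rewrite inordK. Qed.

HB.instance Definition _ := Finite.copy hstate (can_type hstate_codeK).

(* A cell holds a tape symbol and possibly the head; [None] closes the row. *)
Definition letter := option (Sym * option Q).

(** A left move has to write the new head before the old one is met: [TrGuess] announces it and only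
    [TrLeft] confirms it. Nothing leaves [HFinal], so among cells only [alpha] accepts it from the
    west; rows of ordinary steps are closed by [TrEnd], from [HDone]. *)
Inductive trans : hstate -> letter -> letter -> hstate -> Prop :=
| TrKeep s : trans HInit (Some (s, None)) (Some (s, None)) HInit
| TrGuess s q : trans HInit (Some (s, None)) (Some (s, Some q)) (HLeft q)
| TrStay q s q' s' m : ~~ halt q -> delta q s = (q', s', m) -> m = 1 :> nat ->
    trans HInit (Some (s, Some q)) (Some (s', Some q')) HDone
| TrRight q s q' s' m : ~~ halt q -> delta q s = (q', s', m) -> m = 2 :> nat ->
    trans HInit (Some (s, Some q)) (Some (s', None)) (HRight q')
| TrLeft q s q' s' m : ~~ halt q -> delta q s = (q', s', m) -> m = 0 :> nat ->
    trans (HLeft q') (Some (s, Some q)) (Some (s', None)) HDone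
| TrArrive s q : trans (HRight q) (Some (s, None)) (Some (s, Some q)) HDone
| TrDone s : trans HDone (Some (s, None)) (Some (s, None)) HDone
| TrEnd : trans HDone None None HEnd
| TrAcc s q h : acc q -> h = HAcc \/ h = HFinal ->
    trans HInit (Some (s, Some q)) (Some (s, Some q)) h
| TrAccKeep s h : h = HAcc \/ h = HFinal ->
    trans HAcc (Some (s, None)) (Some (s, None)) h.

(** Column [i] shows tape cell [i - o] and column [a] closes the row; column 0 is left to the column
    tiles. *)
Definition conf_row (c : mconf) (o : int) (a i : nat) : letter :=
  if i < a then Some (mc_tape c (Posz i - o)%R,
    if mc_head c == (Posz i - o)%R then Some (mc_state c) else None) else None.

Definition row_run (a : nat) (H : nat -> hstate) (R R' : nat -> letter) :=
  H 0 = HInit /\ forall i, i.+1 < a -> trans (H i) (R i.+1) (R' i.+1) (H i.+1).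

Section Row.
Variables (c : mconf) (o : int) (a h : nat).
Hypotheses (h0 : 0 < h) (ha : h < a) (Eh : mc_head c = (Posz h - o)%R).
Let R := conf_row c o a.

Lemma conf_row_head : R h = Some (mc_tape c (mc_head c), Some (mc_state c)).
Proof. by rewrite /R /conf_row ha -Eh eqxx. Qed.

Lemma conf_row_other i : i < a -> i != h -> R i = Some (mc_tape c (Posz i - o)%R, None).
Proof. by move=> ia ih; rewrite /R /conf_row ia Eh; case: eqP => //; lia. Qed.

Lemma row_run_done H R' j : row_run a H R R' -> h <= j -> H j = HDone ->
  forall i, j < i -> i < a -> H i = HDone /\ R' i = R i.
Proof.
move=> [_ HH] hj Hj; elim=> // i IH ji ia.
have Hi : H i = HDone.
  by move: ji; rewrite ltnS leq_eqVlt => /orP [/eqP <- //|ji]; case: IH => //; exact: ltnW.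
have := HH i ia; rewrite conf_row_other // ?Hi; last by lia.
by move E1: (Some _) => l; move E2: HDone => d T; case: T E1 E2 => // s [->].
Qed.

(** [HLeft] reads nothing but a head, so a guess survives only directly before the head; until then
    the row is copied. *)
Lemma row_run_init H R' : row_run a H R R' -> forall i, i < h ->
  (forall j, 0 < j <= i -> R' j = R j) /\ H i = HInit \/
  [/\ i = h.-1, 0 < i, forall j, 0 < j < i -> R' j = R j
    & exists q, H i = HLeft q /\ R' i = Some (mc_tape c (Posz i - o)%R, Some q)].
Proof.
move=> [H0 HH]; elim=> [|i IH] ih; first by left; split=> // j; lia.
have ia : i.+1 < a by lia.
have {IH} [[IH Hi]|[E _ _ _]] := IH (ltnW ih); last by lia.
have := HH i ia; rewrite Hi conf_row_other //; last by lia.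
move E1: (Some _) => l; move E2: HInit => d; move E3: (R' i.+1) => l'; move E4: (H i.+1) => d' T.
case: T E1 E2 E3 E4 => //.
- move=> s [<-] _ E3 E4; left; split=> // j Hj.
  by case: (eqVneq j i.+1) => [->|ne]; [rewrite E3 conf_row_other //; lia|apply: IH; lia].
- move=> s q [<-] _ E3 E4; right.
  case: (eqVneq i.+1 h.-1) => [E|ne]; last first.
    have ia2 : i.+2 < a by lia.
    have := HH i.+1 ia2; rewrite E4 conf_row_other //; last by lia.
    by move E1: (Some (_, None)) => l1; move E2: (HLeft q) => d1 T; case: T E1 E2.
  by split=> //; exists q.
Qed.

(** The transition at the head reveals the move. Ending in [HDone] excludes a head that leaves at
    the right end, since [HRight] would stay pending, and an accepting transition, which never gets
    back to [HDone]. A left move needs a cell in which it is guessed, so the head does not leave at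
    the left either. *)
Lemma row_run_step H R' : row_run a H R R' -> H a.-1 = HDone ->
  ~~ halt (mc_state c) /\ exists h', [/\ 0 < h' < a, mc_head (mstep c) = (Posz h' - o)%R
    & forall i, 0 < i < a -> R' i = conf_row (mstep c) o a i].
Proof.
move=> run Hend; have [_ HH] := run.
have Tlast j : h <= j -> j < a -> H j = HDone -> forall i, j < i -> i < a -> R' i = R i.
  by move=> hj ja Hj i ji ia; case: (row_run_done run hj Hj ji ia).
have Hh : h.-1 < h by lia.
have Eh1 : h.-1.+1 = h by lia.
have := HH h.-1; rewrite Eh1 => /(_ ha); rewrite conf_row_head.
case: (row_run_init run Hh) => [[RI HI]|[_ h1 RI [q' [HI RL]]]].
- rewrite HI.
  move E1: (Some _) => l; move E2: HInit => d; move E3: (R' h) => l'; move E4: (H h) => d' T.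
  case: T E1 E2 E3 E4 => //.
  + move=> q s q' s' m nh Ed Em [Es Eq] _ E3 E4; rewrite -Eq in nh Ed; rewrite -Es in Ed.
    split=> //; exists h; rewrite /mstep (negbTE nh) Ed /= Em; split; [lia|lia|].
    move=> i ia; rewrite /conf_row /=; case/andP: ia => i0 ia; rewrite ia.
    case: (ltngtP i h) => ih.
    * rewrite RI; last by lia.
      rewrite conf_row_other //; last by lia.
      by rewrite !ifN //; lia.
    * rewrite (Tlast h) // conf_row_other //; last by lia.
      by rewrite !ifN //; lia.
    * by rewrite ih E3 !ifT //; lia.
  + move=> q s q' s' m nh Ed Em [Es Eq] _ E3 E4; rewrite -Eq in nh Ed; rewrite -Es in Ed.
    split=> //; case: (ltnP h.+1 a) => ha1; last first.
      have Ea : a.-1 = h by lia.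
      by move: Hend; rewrite Ea E4 => HE; discriminate HE.
    have := HH h ha1; rewrite E4 conf_row_other //; last by lia.
    move E1: (Some (_, None)) => l1; move E2: (HRight q') => d1.
    move E5: (R' h.+1) => l1'; move E6: (H h.+1) => d1' T.
    case: T E1 E2 E5 E6 => // s1 q1 [<-] [<-] E5 E6.
    exists h.+1; rewrite /mstep (negbTE nh) Ed /= Em; split; [lia|lia|].
    move=> i ia; rewrite /conf_row /=; case/andP: ia => i0 ia; rewrite ia.
    case: (ltngtP i h) => ih.
    * rewrite RI; last by lia.
      rewrite conf_row_other //; last by lia.
      by rewrite !ifN //; lia.
    * case: (eqVneq i h.+1) => [->|ne].
        by rewrite E5 ifN ?ifT //; lia.
      rewrite (Tlast h.+1) //; try lia.
      rewrite conf_row_other //; last by lia.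
      by rewrite !ifN //; lia.
    * by rewrite ih E3 ifT ?ifN //; lia.
  + move=> s q d1 Aq Hd [Es Eq] _ E3 E4; exfalso.
    have NA i : h <= i -> i < a -> H i = HAcc \/ H i = HFinal.
      elim: i => [|i IH] hi ia; first by lia.
      case: (eqVneq h i.+1) => [<-|ne]; first by rewrite E4.
      have ia' : i < a by lia.
      have hi' : h <= i by lia.
      have := HH i ia; rewrite conf_row_other //; last by lia.
      case: (IH hi' ia') => Hi T; move: Hi; move E1: (Some (_, None)) T => l1 T E2.
        by rewrite E2 in T; move: E1; move E7: HAcc T => d2 T; case: T E7.
      by rewrite E2 in T; move: E1; move E7: HFinal T => d2 T; case: T E7.
    by case: (NA a.-1); try lia; rewrite Hend.
- rewrite HI.
  move E1: (Some _) => l; move E2: (HLeft q') => d; move E3: (R' h) => l'; move E4: (H h) => d' T.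
  case: T E1 E2 E3 E4 => // q s q1 s' m nh Ed Em [Es Eq] [Eq'] E3 E4.
  rewrite -Eq in nh Ed; rewrite -Es -Eq' in Ed.
  split=> //; exists h.-1; rewrite /mstep (negbTE nh) Ed /= Em; split; [lia|lia|].
  move=> i ia; rewrite /conf_row /=; case/andP: ia => i0 ia; rewrite ia.
  case: (ltngtP i h) => ih.
  * case: (eqVneq i h.-1) => [->|ne].
      by rewrite RL ifN ?ifT //; lia.
    rewrite RI; last by lia.
    rewrite conf_row_other //; last by lia.
    by rewrite !ifN //; lia.
  * rewrite (Tlast h) // conf_row_other //; last by lia.
    by rewrite !ifN //; lia.
  * by rewrite ih E3 ifT ?ifN //; lia.
Qed.

(** A row that performs a move never reaches [HFinal], so [TrAcc] must have been applied at the
    head. *)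
Lemma row_run_acc H R' : row_run a H R R' -> H a.-1 = HFinal -> acc (mc_state c).
Proof.
move=> run Hend; have [_ HH] := run.
have Hh : h.-1 < h by lia.
have Eh1 : h.-1.+1 = h by lia.
have dn : H h = HDone -> acc (mc_state c).
  move=> Hd; case: (ltnP h a.-1) => ha1.
    by case: (row_run_done run (leqnn h) Hd ha1 _); [lia|rewrite Hend].
  have Ea : a.-1 = h by lia.
  by move: Hend; rewrite Ea Hd => HE; discriminate HE.
have := HH h.-1; rewrite Eh1 => /(_ ha); rewrite conf_row_head.
case: (row_run_init run Hh) => [[_ HI]|[_ _ _ [q' [HI _]]]]; rewrite HI.
- move E1: (Some _) => l; move E2: HInit => d; move E4: (H h) => d' T.
  case: T E1 E2 E4 => //.
  + move=> q s q' s' m nh Ed Em [Es Eq] _ E4.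
    case: (ltnP h.+1 a) => ha1; last first.
      have Ea : a.-1 = h by lia.
      by move: Hend; rewrite Ea E4 => HE; discriminate HE.
    have := HH h ha1; rewrite E4 conf_row_other //; last by lia.
    move E1: (Some (_, None)) => l1; move E2: (HRight q') => d1.
    move E6: (H h.+1) => d1' T; case: T E1 E2 E6 => // s1 q1 _ _ E6.
    case: (ltnP h.+1 a.-1) => ha2.
      by case: (row_run_done run (leqnSn h) E6 ha2 _); [lia|rewrite Hend].
    have Ea : a.-1 = h.+1 by lia.
    by move: Hend; rewrite Ea E6 => HE; discriminate HE.
  + by move=> s q d1 Aq _ [_ ->].
- move E1: (Some _) => l; move E2: (HLeft q') => d; move E4: (H h) => d' T.
  by case: T E1 E2 E4.
Qed.

(** The margins leave a cell on either side for the head to move to; for a left move the run enters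
    [HLeft] already at [h.-1]. *)
Lemma row_run_ex : 1 < h -> h.+1 < a -> ~~ halt (mc_state c) ->
  exists H, row_run a H R (conf_row (mstep c) o a) /\ H a.-1 = HDone.
Proof.
move=> h1 ha1 nh.
case Ed: (delta (mc_state c) (mc_tape c (mc_head c))) => [[q' s'] m].
pose H i := if i < h then (if (m == 0 :> nat) && (i == h.-1) then HLeft q' else HInit)
  else if (i == h) && (m == 2 :> nat) then HRight q' else HDone.
exists H; split; last first.
  by rewrite /H ifN ?ifN //; [apply/negP=> /andP [/eqP E _]; lia|lia].
split; first by rewrite /H ifT ?ifN //; lia.
move=> i ia; have R'E : conf_row (mstep c) o a i.+1 =
  Some (if i.+1 == h then s' else mc_tape c (Posz i.+1 - o)%R,
        if h + m == i.+2 then Some q' else None).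
  rewrite /conf_row ia /mstep (negbTE nh) Ed /= Eh.
  have -> : ((Posz i.+1 - o)%R == (Posz h - o)%R) = (i.+1 == h) by lia.
  by have -> : ((Posz h - o + Posz m - 1)%R == (Posz i.+1 - o)%R) = (h + m == i.+2) by lia.
rewrite R'E /H; have m3 := ltn_ord m.
case: (ltngtP i.+1 h) => ih.
- rewrite conf_row_other //; last by lia.
  case Em: (m == 0 :> nat) => /=; last first.
    by rewrite ifN; [constructor|lia].
  rewrite ifN; last by lia.
  case: (eqVneq i.+1 h.-1) => E.
    by rewrite ifT; [constructor|lia].
  by rewrite ifN; [constructor|lia].
- rewrite conf_row_other //; last by lia.
  case: (eqVneq i h) => [E|ne] /=.
    case Em: (m == 2 :> nat); first by rewrite ifT; [constructor|lia].
    by rewrite ifN; [constructor|lia].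
  by rewrite ifN; [constructor|lia].
- rewrite ih conf_row_head.
  have -> : (i == h.-1) = true by lia.
  rewrite andbT; case Em: (m == 0 :> nat) => /=.
    rewrite !ifN; try lia.
    by apply: TrLeft nh Ed _; apply/eqP.
  case Em2: (m == 2 :> nat) => /=.
    rewrite ifN; last by lia.
    by apply: TrRight nh Ed _; apply/eqP.
  rewrite ifT; last by lia.
  by apply: TrStay nh Ed _; lia.
Qed.

Lemma row_run_acc_ex : acc (mc_state c) -> exists H, row_run a H R R /\ H a.-1 = HFinal.
Proof.
move=> Ac; exists (fun i => if i < h then HInit else if i == a.-1 then HFinal else HAcc).
split; last by rewrite ifN ?eqxx //; lia.
split; first by rewrite h0.
move=> i ia; case: (ltngtP i.+1 h) => ih.
- by rewrite conf_row_other //; [constructor|lia].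
- rewrite ifN; last by lia.
  by rewrite conf_row_other //; [constructor; case: eqP; auto|lia].
- by rewrite ih conf_row_head; constructor=> //; case: eqP; auto.
Qed.

End Row.
End Machine.

(** * The tile set of a machine and an input *)

Section TileSet.
Variables (Q Sym : finType) (delta : Q -> Sym -> Q * Sym * 'I_3) (halt acc : pred Q).
Variables (blank : Sym) (bit : bool -> Sym) (enter : Q).
Notation hst := (hstate Q).
Notation lett := (letter Q Sym).
Notation tr := (trans delta halt acc).

Definition nletters := #|{: lett}|.
Definition nstates := #|{: hst}|.
Definition gbase := 7 + nletters + nstates.

(* Letters are carried by vertical glues and transducer states by horizontal ones. *)
Definition letter_glue (l : lett) : nat := 7 + enum_rank l.
Definition state_glue (h : hst) : nat := 7 + nletters + enum_rank h.

Lemma letter_glue_lt l : letter_glue l < 7 + nletters. Proof. by rewrite /letter_glue /nletters ltn_add2l. Qed.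
Lemma state_glue_lt h : state_glue h < gbase. Proof. by rewrite /state_glue /gbase /nstates ltn_add2l. Qed.
Lemma state_glue_inj : injective state_glue. Proof. by move=> l l' /addnI /val_inj /enum_rank_inj. Qed.

Definition sym_letter (s : Sym) : lett := Some (s, None).
Definition blank_letter : lett := sym_letter blank.
Definition bit_letter (b : bool) : lett := sym_letter (bit b).
Definition start_letter : lett := Some (blank, Some enter).

(* Fixed glues: 1, 2 are the strong vertical glues of the two left columns;
   3 (padding), 4 (blanks after the input), 5 (filler), 6 (auxiliary corner)
   are strong horizontal glues; the glues from [gbase] on number the input cells. *)
Definition alpha : tile := (0, 0, letter_glue None, state_glue (HFinal Q)).

Definition trans_tile (p : hst * lett * lett * hst) : tile :=
  (letter_glue p.1.2, state_glue p.2, letter_glue p.1.1.2, state_glue p.1.1.1).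

Definition trans_bool (p : hst * lett * lett * hst) : bool :=
  if excluded_middle_informative (tr p.1.1.1 p.1.1.2 p.1.2 p.2) then true else false.

(* The tiles with glues 2 and 6 form, for every cell tile, a place where it attaches. *)
Definition fixed_tiles : seq tile :=
  [:: alpha; (1, 3, 0, 0); (1, state_glue (HInit Q), 1, 0); (letter_glue blank_letter, 3, 0, 3); (letter_glue blank_letter, 4, 0, 4);
      (letter_glue None, 5, 0, 4); (0, 5, 0, 5); (2, 6, 0, 0)] ++
  [seq (letter_glue l, 5, 0, 6) | l <- enum {: lett}] ++
  [seq (0, state_glue h, 2, 0) | h <- enum {: hst} & h != HFinal Q] ++
  [seq trans_tile p | p <- enum {: hst * lett * lett * hst} & trans_bool p].

(* Numbered glues decrease from west to east: [c.*2] sits between two encoded bits,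
   [c.*2.+1] inside the code [true; b] of a bit, and a witness may stop at any [c]. *)
Definition witness_tiles (c : nat) : seq tile :=
  [:: (letter_glue (bit_letter false), 4, 0, c.*2); (letter_glue (bit_letter false), c.*2, 0, c.*2.+1);
      (letter_glue (bit_letter true), c.*2, 0, c.*2.+1); (letter_glue (bit_letter true), c.*2.+1, 0, c.+1.*2)].

(** The stop tile for the top counter value belongs here, because [all_witness_tiles] covers only
    the [B] values below it. The second tile spells the [false] that ends the code of the input. *)
Definition middle_tiles (c : nat) : seq tile :=
  [:: (letter_glue (bit_letter false), 4, 0, c.*2); (letter_glue (bit_letter false), c.*2, 0, c.+1.*2)].

Definition input_tiles (b : bool) (c : nat) : seq tile :=
  [:: (letter_glue (bit_letter b), c.*2, 0, c.*2.+1); (letter_glue (bit_letter true), c.*2.+1, 0, c.+1.*2)].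

Definition start_tile (c : nat) : tile := (letter_glue start_letter, c.*2, 0, 3).

Fixpoint all_witness_tiles (c B : nat) : seq tile :=
  if B is B'.+1 then witness_tiles c ++ all_witness_tiles c.+1 B' else [::].

Fixpoint all_input_tiles (c : nat) (X : seq bool) : seq tile :=
  if X is b :: X' then input_tiles b c ++ all_input_tiles c.+1 X' else [::].

Variables (X : seq bool) (B : nat).
Let n := size X.
Let cmid := gbase + B.
Let cinp := cmid.+1.

(** As the numbering decreases eastwards, the bottom row spells [rev X]. Taking [X] to be the
    reversed input suits a stack machine, which pops the last bit first while its counter
    increases. *)
Definition tile_set : seq tile :=
  fixed_tiles ++ all_witness_tiles gbase B ++ middle_tiles cmid ++
  all_input_tiles cinp X ++ [:: start_tile (cinp + n)].

(** Numbered glues are doubled counters, the largest being [(cinp + n).*2], that is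
    [2 * gbase + 2 * B + 2 * n + 2]. The range of strong glues starts at [gbase] and has to include
    it. *)
Definition nstrong := gbase + 3 + B.*2 + n.*2.

Definition strengths : seq nat := [:: 0; 2; 2; 2; 2; 2; 2] ++ nseq (nletters + nstates) 1 ++ nseq nstrong 2.

Definition glue_class (g : nat) : glue_kind :=
  if g == 0 then Null else if g <= 2 then VStrong else if g <= 6 then HStrong
  else if g < 7 + nletters then Lett else if g < gbase then Stat
  else if g < gbase + nstrong then HStrong else Null.

Lemma strengthsE g : glue_str strengths g =
  match glue_class g with Null => 0 | Lett | Stat => 1 | HStrong | VStrong => 2 end.
Proof.
rewrite /glue_str /glue_class /strengths; move: nstrong => M; case: (ltnP g 7) => Hg.
  by move: Hg; do 7!(case: g => [|g] //).
rewrite nth_cat /= ltnNge Hg /= nth_cat size_nseq !nth_nseq.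
have -> : (g == 0) = false by lia.
have -> : (g <= 2) = false by lia.
have -> : (g <= 6) = false by lia.
case: (ltnP g (7 + nletters)) => H1; first by rewrite !ifT //; lia.
rewrite /gbase; case: (ltnP g (7 + nletters + nstates)) => H2; first by rewrite !ifT //; lia.
rewrite ifN; last by lia.
have -> : (g - 7 - (nletters + nstates) < M) = (g < 7 + nletters + nstates + M) by lia.
by case: ifP.
Qed.

Inductive tile_spec : tile -> Prop :=
| TSalpha : tile_spec alpha
| TScorner : tile_spec (1, 3, 0, 0)
| TScol : tile_spec (1, state_glue (HInit Q), 1, 0)
| TSpad : tile_spec (letter_glue blank_letter, 3, 0, 3)
| TSblank : tile_spec (letter_glue blank_letter, 4, 0, 4)
| TSend : tile_spec (letter_glue None, 5, 0, 4)
| TSfill : tile_spec (0, 5, 0, 5)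
| TSjcorner : tile_spec (2, 6, 0, 0)
| TSjrow l : tile_spec (letter_glue l, 5, 0, 6)
| TSjcol h : h <> HFinal Q -> tile_spec (0, state_glue h, 2, 0)
| TScell h l l' h' : tr h l l' h' -> tile_spec (letter_glue l', state_glue h', letter_glue l, state_glue h)
| TSstop j : j <= B -> tile_spec (letter_glue (bit_letter false), 4, 0, (gbase + j).*2)
| TSwbit j b : j < B -> tile_spec (letter_glue (bit_letter b), (gbase + j).*2, 0, (gbase + j).*2.+1)
| TSwone j : j < B -> tile_spec (letter_glue (bit_letter true), (gbase + j).*2.+1, 0, (gbase + j).+1.*2)
| TSmid : tile_spec (letter_glue (bit_letter false), cmid.*2, 0, cmid.+1.*2)
| TSxbit j : j < n -> tile_spec (letter_glue (bit_letter (nth false X j)), (cinp + j).*2, 0, (cinp + j).*2.+1)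
| TSxone j : j < n -> tile_spec (letter_glue (bit_letter true), (cinp + j).*2.+1, 0, (cinp + j).+1.*2)
| TSstart : tile_spec (start_tile (cinp + n)).

Lemma mem_all_witness_tiles c m t : t \in all_witness_tiles c m <->
  exists2 j, j < m & t \in witness_tiles (c + j).
Proof.
elim: m c => [|m IH] c; first by split=> // -[].
have -> : all_witness_tiles c m.+1 = witness_tiles c ++ all_witness_tiles c.+1 m by [].
rewrite mem_cat; split.
  case/orP => [H|/IH [j jm H]]; first by exists 0; rewrite ?addn0.
  by exists j.+1; rewrite // -addSnnS.
case=> -[|j] jm H; apply/orP; first by left; rewrite addn0 in H.
by right; apply/IH; exists j; rewrite // addSnnS.
Qed.

Lemma mem_all_input_tiles c Y t : t \in all_input_tiles c Y <->
  exists2 j, j < size Y & t \in input_tiles (nth false Y j) (c + j).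
Proof.
elim: Y c => [|b Y IH] c; first by split=> // -[].
have -> : all_input_tiles c (b :: Y) = input_tiles b c ++ all_input_tiles c.+1 Y by [].
rewrite mem_cat; split.
  case/orP => [H|/IH [j jm H]]; first by exists 0; rewrite ?addn0.
  by exists j.+1; rewrite // -addSnnS.
case=> -[|j] jm H; apply/orP; first by left; rewrite addn0 in H.
by right; apply/IH; exists j; rewrite // addSnnS.
Qed.

Lemma tile_setP t : t \in tile_set <-> tile_spec t.
Proof.
rewrite /tile_set; split.
  rewrite /fixed_tiles !mem_cat => /orP [/orP [|/orP [|/orP []]]|/orP [|/orP [|/orP []]]].
  - by rewrite !inE; do 7?[case/orP]; move/eqP ->; constructor.
  - by case/mapP => l _ ->; constructor.
  - by case/mapP => h; rewrite mem_filter => /andP [/eqP hF _] ->; constructor.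
  - case/mapP => -[[[h l] l'] h']; rewrite mem_filter /trans_bool.
    by case: excluded_middle_informative => //= T _ ->; exact: TScell T.
  - case/mem_all_witness_tiles => j jB; rewrite !inE; do 3?[case/orP] => /eqP ->.
    + by apply: TSstop; exact: ltnW.
    + exact: TSwbit.
    + exact: TSwbit.
    + exact: TSwone.
  - rewrite !inE => /orP [] /eqP ->; [exact: TSstop|exact: TSmid].
  - case/mem_all_input_tiles => j jn; rewrite !inE => /orP [] /eqP ->; [exact: TSxbit|exact: TSxone].
  - by rewrite inE => /eqP ->; constructor.
move=> H; suff: t \in fixed_tiles \/ t \in all_witness_tiles gbase B \/ t \in middle_tiles cmid \/
    t \in all_input_tiles cinp X \/ t = start_tile (cinp + n).
  by rewrite !mem_cat [_ \in [:: start_tile _]]inE => -[->|[->|[->|[->|->]]]]; rewrite ?eqxx ?orbT.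
case: H => [||||||||l|h hF|h l l' h' T|j jB|j b jB|j jB||j jn|j jn|];
  try by left; rewrite /fixed_tiles !inE !eqxx ?orbT.
- left; rewrite /fixed_tiles !mem_cat; apply/orP; right; apply/orP; left.
  by apply/mapP; exists l; rewrite ?mem_enum.
- left; rewrite /fixed_tiles !mem_cat; do 2!(apply/orP; right); apply/orP; left.
  by apply/mapP; exists h; rewrite // mem_filter mem_enum andbT; apply/eqP.
- left; rewrite /fixed_tiles !mem_cat; do 3!(apply/orP; right).
  apply/mapP; exists (h, l, l', h'); rewrite // mem_filter mem_enum andbT /trans_bool.
  by case: excluded_middle_informative.
- move: jB; rewrite leq_eqVlt => /orP [/eqP ->|jB].
    by do 2!right; left; rewrite !inE eqxx.
  by right; left; apply/mem_all_witness_tiles; exists j; rewrite // !inE eqxx.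
- right; left; apply/mem_all_witness_tiles; exists j; rewrite // !inE.
  by case: b; rewrite eqxx ?orbT.
- by right; left; apply/mem_all_witness_tiles; exists j; rewrite // !inE eqxx !orbT.
- by do 2!right; left; rewrite !inE eqxx orbT.
- by do 3!right; left; apply/mem_all_input_tiles; exists j; rewrite // !inE eqxx.
- by do 3!right; left; apply/mem_all_input_tiles; exists j; rewrite // !inE eqxx orbT.
- by do 4!right.
Qed.

Lemma class_letter l : glue_class (letter_glue l) = Lett.
Proof.
have := letter_glue_lt l; rewrite /glue_class => H; have H7 : 7 <= letter_glue l by rewrite /letter_glue leq_addr.
by do ?[rewrite ifN; last by lia]; rewrite ifT //; lia.
Qed.

Lemma class_state h : glue_class (state_glue h) = Stat.
Proof.
have := state_glue_lt h; rewrite /glue_class => H; have H7 : 7 + nletters <= state_glue h by rewrite /state_glue leq_addr.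
by do ?[rewrite ifN; last by lia]; rewrite ifT //; lia.
Qed.

Lemma class_number g : gbase <= g -> g < gbase + nstrong -> glue_class g = HStrong.
Proof.
rewrite /glue_class; move: nstrong => M H1 H2; have H7 : 7 + nletters <= gbase by rewrite /gbase; lia.
by do ?[rewrite ifN; last by lia]; rewrite ifT //; lia.
Qed.

Lemma gbase_ge : 7 + nletters <= gbase. Proof. by rewrite /gbase; lia. Qed.

Ltac num := rewrite ?class_number //; have ? := gbase_ge; rewrite /nstrong /cinp /cmid; lia.

Lemma tile_set_kinded t : t \in tile_set -> well_kinded glue_class t.
Proof.
have E0 : glue_class 0 = Null by []. have E1 : glue_class 1 = VStrong by []. have E2 : glue_class 2 = VStrong by [].
have E3 : glue_class 3 = HStrong by []. have E4 : glue_class 4 = HStrong by []. have E5 : glue_class 5 = HStrong by [].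
have E6 : glue_class 6 = HStrong by [].
have row N E W : glue_class E = HStrong -> glue_class W = HStrong -> glue_class N = Null \/ glue_class N = Lett -> well_kinded glue_class (N, E, 0, W).
  by move=> HE HW HN; rewrite /well_kinded /tile_kind /tS /tW /tE /tN /= -/(glue_class 0) E0 HW HE.
have cell N E S W : glue_class S = Lett -> glue_class W = Stat -> glue_class N = Null \/ glue_class N = Lett -> glue_class E = Null \/ glue_class E = Stat ->
    well_kinded glue_class (N, E, S, W).
  by move=> HS HW HN HE; rewrite /well_kinded /tile_kind /tS /tW /tE /tN /= HW HS.
have col N E S : glue_class S = VStrong -> glue_class E = Stat -> glue_class N = Null \/ glue_class N = VStrong -> well_kinded glue_class (N, E, S, 0).
  by move=> HS HE HN; rewrite /well_kinded /tile_kind /tS /tW /tE /tN /= HS HE.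
move/tile_setP; case=> [||||||||l|h hF|h l l' h' T|j jB|j b jB|j jB||j jn|j jn|];
  try by apply: row; rewrite ?class_letter; auto.
- by apply: cell; rewrite ?class_letter ?class_state; auto.
- by [].
- by apply: col; rewrite ?class_state; auto.
- by [].
- by apply: col; rewrite ?class_state; auto.
- by apply: cell; rewrite ?class_letter ?class_state; auto.
- by apply: row; rewrite ?class_letter; auto; num.
- by apply: row; rewrite ?class_letter; auto; num.
- by apply: row; rewrite ?class_letter; auto; num.
- by apply: row; rewrite ?class_letter; auto; num.
- by apply: row; rewrite ?class_letter; auto; num.
- by apply: row; rewrite ?class_letter; auto; num.
- by apply: row; rewrite ?class_letter; auto; num.
Qed.

Lemma alpha_mem : alpha \in tile_set. Proof. by apply/tile_setP; constructor. Qed.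

Lemma alpha_cell : tile_kind glue_class alpha = KCell.
Proof. by rewrite /tile_kind /alpha /tS /tW /= class_letter class_state. Qed.

Lemma kind_row N E S W : tile_kind glue_class (N, E, S, W) = KRow -> glue_class S = Null /\ glue_class W <> Null.
Proof. by rewrite /tile_kind /tS /tW /=; case: (glue_class S); case: (glue_class W). Qed.

Lemma kind_corner N E S W : tile_kind glue_class (N, E, S, W) = KCorner -> glue_class S = Null /\ glue_class W = Null.
Proof. by rewrite /tile_kind /tS /tW /=; case: (glue_class S); case: (glue_class W). Qed.

Lemma kind_col N E S W : tile_kind glue_class (N, E, S, W) = KCol -> glue_class S <> Null /\ glue_class W = Null.
Proof. by rewrite /tile_kind /tS /tW /=; case: (glue_class S); case: (glue_class W). Qed.

Lemma kind_cell N E S W : tile_kind glue_class (N, E, S, W) = KCell -> glue_class S <> Null /\ glue_class W <> Null.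
Proof. by rewrite /tile_kind /tS /tW /=; case: (glue_class S); case: (glue_class W). Qed.

Lemma tile_set_row_ext t : t \in tile_set -> tile_kind glue_class t = KCorner \/ tile_kind glue_class t = KRow ->
  exists2 u, u \in tile_set & tE t = tW u.
Proof.
move=> tT K; suff: exists2 u, tile_spec u & tE t = tW u by case=> u /tile_setP; exists u.
have {K} : glue_class (tS t) = Null.
  case: t tT K => [[[N E] S] W] _ [/kind_corner|/kind_row] [-> //].
move/tile_setP: tT; case=> [||||||||l|h hF|h l l' h' T|j jB|j b jB|j jB||j jn|j jn|];
  rewrite /tS /tE /= ?class_letter //.
- by move=> _; exists (letter_glue blank_letter, 3, 0, 3); first exact: TSpad.
- by move=> _; exists (letter_glue blank_letter, 3, 0, 3); first exact: TSpad.
- by move=> _; exists (letter_glue blank_letter, 4, 0, 4); first exact: TSblank.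
- by move=> _; exists (0, 5, 0, 5); first exact: TSfill.
- by move=> _; exists (0, 5, 0, 5); first exact: TSfill.
- by move=> _; exists (letter_glue None, 5, 0, 6); first exact: TSjrow.
- by move=> _; exists (0, 5, 0, 5); first exact: TSfill.
- by move=> _; exists (letter_glue blank_letter, 4, 0, 4); first exact: TSblank.
- by move=> _; eexists; first exact: (TSstop (ltnW jB)).
- by move=> _; eexists; first exact: (TSwbit true jB).
- by move=> _; eexists; first exact: (TSstop (leqnn B)).
- move=> _; case: j jn => [|j] jn; first by rewrite addn0; eexists; first exact: TSmid.
  by eexists; first exact: (TSxone (ltnW jn)); rewrite addnS.
- by move=> _; eexists; first exact: (TSxbit jn).
- move=> _; case E: n => [|m]; first by rewrite addn0; eexists; first exact: TSmid.
  by eexists; first (apply: (@TSxone m); rewrite E); rewrite // addnS.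
Qed.

Lemma tile_set_col_ext t : t \in tile_set -> tile_kind glue_class t = KCol -> exists2 u, u \in tile_set & tN u = tS t.
Proof.
move=> tT K; suff: exists2 u, tile_spec u & tN u = tS t by case=> u /tile_setP; exists u.
have {K} : glue_class (tS t) <> Null /\ glue_class (tW t) = Null.
  by case: t tT K => [[[N E] S] W] _ /kind_col.
move/tile_setP: tT; case=> [||||||||l|h hF|h l l' h' T|j jB|j b jB|j jB||j jn|j jn|];
  rewrite /tS /tW /= ?class_state; try by case.
- by move=> _; exists (1, 3, 0, 0); first exact: TScorner.
- by move=> _; exists (2, 6, 0, 0); first exact: TSjcorner.
Qed.

(** A 2 by 2 square on the auxiliary corner offers any letter from the south and any state but
    [HFinal] from the west, and no transition starts in [HFinal]. *)
Lemma tile_set_cell_ext t : t \in tile_set -> tile_kind glue_class t = KCell -> t <> alpha -> grid_reaches glue_class tile_set t.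
Proof.
move=> tT K nA; have [h [l [l' [h' [T Et]]]]] : exists h l l' h', tr h l l' h' /\ t = (letter_glue l', state_glue h', letter_glue l, state_glue h).
  have {K} : glue_class (tS t) <> Null /\ glue_class (tW t) <> Null.
    by case: t tT K nA => [[[N E] S] W] _ /kind_cell.
  move/tile_setP: tT nA; case=> [||||||||l|h hF|h l l' h' T|j jB|j b jB|j jB||j jn|j jn|];
  rewrite /tS /tW /= => nA; try by case.
  by move=> _; exists h, l, l', h'.
pose g i j := match i, j with 0, 0 => (2, 6, 0, 0) | S _, 0 => (letter_glue l, 5, 0, 6)
  | 0, S _ => (0, state_glue h, 2, 0) | _, _ => t end : tile.
have hF : h <> HFinal Q by case: T.
exists 0, 0, g; split=> //; split=> //.
- move=> i j _ _; apply/tile_setP.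
  case: i => [|i]; case: j => [|j] /=; [exact: TSjcorner|exact: TSjcol|exact: TSjrow|].
  by rewrite Et; exact: TScell.
- by case.
- by case.
- by case=> [|i] [|j] // _ _; split; [exact: K|rewrite /= Et|rewrite /= Et].
Qed.


Hypothesis acc_halt : forall q, acc q -> halt q.

(* The extra state [enter] stands on the cell before the input, so that the first letter of
   the input is not special. *)
Definition init_mconf (y : seq bool) : mconf Q Sym :=
  MConf enter (fun z => if z is Posz k then (if k < size y then bit (nth false y k) else blank) else blank)
    (-1)%R.

Notation step := (mstep delta halt).

Definition accepts (y : seq bool) : Prop := exists k, acc (mc_state (iter k step (init_mconf y))).

(** * The words spelled by the bottom row *)

Definition rstep (g : nat) (l : lett) (e : nat) : Prop := tile_spec (letter_glue l, e, 0, g) /\ g <> 0.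

Inductive rstep_spec : nat -> lett -> nat -> Prop :=
| RSpad : rstep_spec 3 blank_letter 3
| RSstart : rstep_spec 3 start_letter (cinp + n).*2
| RSblank : rstep_spec 4 blank_letter 4
| RSend : rstep_spec 4 None 5
| RSjrow l : rstep_spec 6 l 5
| RSstop j : j <= B -> rstep_spec (gbase + j).*2 (bit_letter false) 4
| RSwbit j b : j < B -> rstep_spec (gbase + j).*2.+1 (bit_letter b) (gbase + j).*2
| RSwone j : j < B -> rstep_spec (gbase + j).+1.*2 (bit_letter true) (gbase + j).*2.+1
| RSmid : rstep_spec cinp.*2 (bit_letter false) cmid.*2
| RSxbit j : j < n -> rstep_spec (cinp + j).*2.+1 (bit_letter (nth false X j)) (cinp + j).*2
| RSxone j : j < n -> rstep_spec (cinp + j).+1.*2 (bit_letter true) (cinp + j).*2.+1.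

Ltac glue_lia := have := gbase_ge; rewrite /cinp /cmid; lia.

Lemma rstepP g l e : rstep g l e <-> rstep_spec g l e.
Proof.
split; last first.
  by case=> [||||l'|j jB|j b jB|j jB||j jn|j jn]; split; try (by constructor); glue_lia.
case=> T g0; move: T g0; move E: (letter_glue l, e, 0, g) => t T.
case: T E => [||||||||l1|h hF|h l1 l' h' T|j jB|j b jB|j jB||j jn|j jn|] //;
  by case; move=> /val_inj /enum_rank_inj -> -> -> _; constructor.
Qed.

(** The horizontal glues act as states of an automaton, and the letters shown to the north form its
    word. The final [None] is the foot of the closing column, on top of which [alpha] sits. *)
Fixpoint rword (g : nat) (ls : seq lett) : Prop :=
  if ls is l :: ls' then exists2 e, rstep_spec g l e & if ls' is [::] then l = None else rword e ls'
  else False.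

Lemma rstep4 l e : rstep_spec 4 l e -> l = blank_letter /\ e = 4 \/ l = None /\ e = 5.
Proof. by move E: 4 => g T; case: T E => *; auto; exfalso; glue_lia. Qed.

Lemma rstep5 l e : ~ rstep_spec 5 l e.
Proof. by move E: 5 => g T; case: T E => *; glue_lia. Qed.

Lemma rstep3 l e : rstep_spec 3 l e -> l = blank_letter /\ e = 3 \/ l = start_letter /\ e = (cinp + n).*2.
Proof. by move E: 3 => g T; case: T E => *; auto; exfalso; glue_lia. Qed.

Lemma rstep_wit j l e : j <= B -> rstep_spec (gbase + j).*2 l e ->
  l = bit_letter false /\ e = 4 \/ exists2 j', j = j'.+1 & l = bit_letter true /\ e = (gbase + j').*2.+1.
Proof.
move=> jB; move E: (gbase + j).*2 => g T; case: T E => [||||l'|j' jB'|j' b jB'|j' jB'||j' jn'|j' jn'] E; auto; try by exfalso; glue_lia.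
by right; exists j' => //; lia.
Qed.

Lemma rstep_wbit j l e : j < B -> rstep_spec (gbase + j).*2.+1 l e ->
  exists2 b, l = bit_letter b & e = (gbase + j).*2.
Proof.
move=> jB; move E: (gbase + j).*2.+1 => g T; case: T E => [||||l'|j' jB'|j' b jB'|j' jB'||j' jn'|j' jn'] E; auto; try by exfalso; glue_lia.
by exists b => //; lia.
Qed.

Lemma rstep_mid l e : rstep_spec cinp.*2 l e -> l = bit_letter false /\ e = cmid.*2.
Proof. by move E: cinp.*2 => g T; case: T E => *; auto; exfalso; glue_lia. Qed.

Lemma rstep_xone j l e : j < n -> rstep_spec (cinp + j).+1.*2 l e ->
  l = bit_letter true /\ e = (cinp + j).*2.+1.
Proof.
move=> jB; move E: (cinp + j).+1.*2 => g T; case: T E => [||||l'|j' jB'|j' b jB'|j' jB'||j' jn'|j' jn'] E; auto; try by exfalso; glue_lia.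
by split=> //; lia.
Qed.

Lemma rstep_xbit j l e : j < n -> rstep_spec (cinp + j).*2.+1 l e ->
  l = bit_letter (nth false X j) /\ e = (cinp + j).*2.
Proof.
move=> jB; move E: (cinp + j).*2.+1 => g T; case: T E => [||||l'|j' jB'|j' b jB'|j' jB'||j' jn'|j' jn'] E; auto; try by exfalso; glue_lia.
by have -> : j = j' by lia.
Qed.

Notation encb := (enc_seq (fun b : bool => [:: b])).
Definition tail_word (w : seq bool) (m : nat) : seq lett := map bit_letter (encb w) ++ nseq m blank_letter ++ [:: None].

Lemma rword_blank ls : rword 4 ls <-> exists m, ls = nseq m blank_letter ++ [:: None].
Proof.
split=> [|[m ->]].
  elim: ls => [|l ls IH] //= [e /rstep4 [[-> ->]|[-> ->]]].
    by case: ls IH => // l' ls IH /IH [m ->]; exists m.+1.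
  by case: ls {IH} => [_|l' ls [e' /rstep5]] //; exists 0.
elim: m => [|m IH] /=; first by exists 5 => //; constructor.
by exists 4; [constructor|case: m IH].
Qed.

(** Every counter value allows stopping, and every positive one also allows spelling one more bit at
    the price of one unit, so [j] caps the length of the witness and nothing else restricts it. *)
Lemma rword_wit j ls : j <= B -> rword (gbase + j).*2 ls <->
  exists w m, size w <= j /\ ls = tail_word w m.
Proof.
have HB m : rword 4 (nseq m blank_letter ++ [:: None]) by apply/rword_blank; exists m.
elim: j ls => [|j IH] ls jB.
  split.
    case: ls => // l ls [e /(rstep_wit jB) [[-> ->]|[] //]].
    by case: ls => // l' ls H; have /rword_blank [m ->] : rword 4 (l' :: ls) := H; exists [::], m.
  case=> -[|b w] [m [//= _ ->]]; rewrite /tail_word /=.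
  exists 4; first exact: RSstop.
  by have := HB m; case: m.
split.
  case: ls => // l ls [e /(rstep_wit jB) [[-> ->]|[j' [<-] [-> ->]]]].
    by case: ls => // l' ls H; have /rword_blank [m ->] : rword 4 (l' :: ls) := H; exists [::], m.
  case: ls => // l' ls [e' /(rstep_wbit jB) [b -> ->]].
  case: ls => // l'' ls H; have /(IH _ (ltnW jB)) [w [m [sw ->]]] : rword _ (l'' :: ls) := H.
  by exists (b :: w), m.
case=> -[|b w] [m [sw ->]].
  rewrite /tail_word /=; exists 4; first exact: RSstop.
  by have := HB m; case: m.
have H : rword (gbase + j).*2 (tail_word w m) by apply/(IH _ (ltnW jB)); exists w, m.
rewrite /tail_word /=; exists (gbase + j).*2.+1; first by rewrite addnS; exact: RSwone.
exists (gbase + j).*2; first exact: RSwbit.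
by move: H; rewrite /tail_word; case: w {sw} => [|? ?].
Qed.

Lemma rword_input j ls : j <= n -> rword (cinp + j).*2 ls <->
  exists w m, size w <= B /\ ls = map bit_letter (encb (rev (take j X))) ++ tail_word w m.
Proof.
elim: j ls => [|j IH] ls jn.
  rewrite take0 addn0; split.
    case: ls => // l ls [e /rstep_mid [-> ->]].
    case: ls => // l' ls H; have /(rword_wit _ (leqnn B)) [w [m [sw ->]]] : rword _ (l' :: ls) := H.
    by exists w, m.
  case=> w [m [sw ->]]; have : rword cmid.*2 (tail_word w m).
    by apply/(rword_wit _ (leqnn B)); exists w, m.
  rewrite [map bit_letter _]/= => H; exists cmid.*2; first exact: RSmid.
  by move: H; case: (tail_word w m).
rewrite (take_nth false jn) rev_rcons; split.
  case: ls => // l ls [e]; rewrite addnS => /(rstep_xone jn) [-> ->].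
  case: ls => // l' ls [e' /(rstep_xbit jn) [-> ->]].
  case: ls => // l'' ls H; have /(IH _ (ltnW jn)) [w [m [sw ->]]] : rword _ (l'' :: ls) := H.
  by exists w, m.
case=> w [m [sw ->]].
have : rword (cinp + j).*2 (map bit_letter (encb (rev (take j X))) ++ tail_word w m).
  by apply/(IH _ (ltnW jn)); exists w, m.
rewrite addnS => H; exists (cinp + j).*2.+1; first exact: RSxone.
exists (cinp + j).*2; first exact: RSxbit.
by move: H; case: (rev (take j X)).
Qed.

(** [k] and [m] count the freely chosen blanks on the two sides, which serve as work space for the
    head. *)
Definition row_word k w m : seq lett :=
  nseq k blank_letter ++ start_letter :: map bit_letter (enc_pair (rev X) w) ++ nseq m blank_letter ++ [:: None].

Lemma rwordP ls : rword 3 ls <-> exists k w m, size w <= B /\ ls = row_word k w m.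
Proof.
have Hin := rword_input _ (leqnn n); rewrite take_size in Hin.
split=> [|[k [w [m [sw ->]]]]].
  elim: ls => [|l ls IH] //= [e /rstep3 [[-> ->]|[-> ->]]].
    by case: ls IH => // l' ls IH /IH [k [w [m [sw ->]]]]; exists k.+1, w, m.
  case: ls {IH} => // l' ls H; have /Hin [w [m [sw ->]]] : rword _ (l' :: ls) := H; exists 0, w, m; split=> //.
  by rewrite /row_word /enc_pair map_cat -catA.
elim: k => [|k IH].
  have : rword (cinp + n).*2 (map bit_letter (encb (rev X)) ++ tail_word w m) by apply/Hin; exists w, m.
  rewrite /row_word /enc_pair map_cat -catA /tail_word => H.
  exists (cinp + n).*2; first exact: RSstart.
  by move: H; case: (rev X).
exists 3; first exact: RSpad.
by move: IH; rewrite /row_word; case: k.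
Qed.

Lemma rword_glues g ls : rword g ls -> exists2 e : nat -> nat, e 0 = g &
  forall i, i < size ls -> rstep_spec (e i) (nth None ls i) (e i.+1).
Proof.
elim: ls g => [|l ls IH] g //= [e T]; case: ls IH => [|l' ls] IH.
  by move=> _; exists (fun i => if i is 0 then g else e) => // -[].
move=> /IH [f f0 Hf]; exists (fun i => if i is i'.+1 then f i' else g) => //.
by case=> [|i] Hi /=; [rewrite f0|exact: Hf].
Qed.

(** The start letter stands in column [k.+1] and represents tape cell -1, whence the offset
    [k.+2]. *)
Lemma row_word_conf k w m i (ls := row_word k w m) : i < size ls ->
  nth None ls i = conf_row (init_mconf (enc_pair (rev X) w)) (Posz k.+2) (size ls) i.+1.
Proof.
rewrite /conf_row /ls /row_word; move: (enc_pair _ _) => y.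
rewrite size_cat size_nseq /= !size_cat size_map size_nseq /= => Hi.
rewrite nth_cat size_nseq nth_nseq.
case: (ltnP i k) => ik.
  rewrite ifT /=; last by lia.
  rewrite ifN; last by lia.
  by case E: (Posz i.+1 - Posz k.+2)%R => //; exfalso; lia.
case: (eqVneq i k) => [->|ne].
  rewrite subnn /= ifT; last by lia.
  rewrite ifT; last by lia.
  by case E: (Posz k.+1 - Posz k.+2)%R => //; exfalso; lia.
have [d Ed] : exists d, i = k + d.+1 by exists (i - k).-1; lia.
rewrite Ed addKn /= nth_cat size_map.
have -> : (Posz (k + d.+1).+1 - Posz k.+2)%R = Posz d by lia.
case: (ltnP d (size y)) => dy.
  rewrite (nth_map false) // ifT //; lia.
rewrite nth_cat size_nseq nth_nseq.
case: (ltnP (d - size y) m) => dm; first by rewrite ifT //; lia.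
rewrite ifN; last by lia.
by case: (d - size y - m) => [|[|?]].
Qed.

Lemma size_row_word k w m : size (row_word k w m) = k + (size (enc_pair (rev X) w) + m).+2.
Proof.
rewrite /row_word; move: (enc_pair _ _) => y.
by rewrite size_cat size_nseq /= !size_cat size_map size_nseq /=; lia.
Qed.


(** * From a rectangle ending in [alpha] to an accepting run *)

Definition glue_letter (g : nat) : lett := nth None (enum {: lett}) (g - 7).
Definition glue_state (g : nat) : hst := nth (HInit Q) (enum {: hst}) (g - (7 + nletters)).

Lemma letter_glueK : cancel letter_glue glue_letter. Proof. by move=> l; rewrite /glue_letter /letter_glue addKn nth_enum_rank. Qed.
Lemma state_glueK : cancel state_glue glue_state. Proof. by move=> h; rewrite /glue_state /state_glue addKn nth_enum_rank. Qed.

Lemma class_numbered v : gbase <= v <= (cinp + n).*2 -> glue_class v = HStrong.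
Proof. by case/andP=> ? ?; apply: class_number => //; rewrite /nstrong /cinp /cmid; lia. Qed.

Ltac num_contra := by rewrite ?class_numbered ?class_letter ?class_state //; have := gbase_ge; rewrite /cinp /cmid; lia.

Lemma corner_spec t : tile_spec t -> tile_kind glue_class t = KCorner -> t = (1, 3, 0, 0) \/ t = (2, 6, 0, 0).
Proof.
move=> T K; have {K} : glue_class (tS t) = Null /\ glue_class (tW t) = Null.
  by case: t T K => [[[N E] S] W] _ /kind_corner.
case: T => [||||||||l|h hF|h l l' h' T|j jB|j b jB|j jB||j jn|j jn|];
  rewrite /tS /tW /= ?class_letter; auto; case=> // _; num_contra.
Qed.

Lemma row_rstep t l : tile_spec t -> tile_kind glue_class t = KRow -> tN t = letter_glue l -> rstep_spec (tW t) l (tE t).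
Proof.
move=> T K E; have {K} [KS KW] : glue_class (tS t) = Null /\ glue_class (tW t) <> Null.
  by case: t T E K => [[[N E] S] W] _ _ /kind_row.
apply/rstepP; split; last by move=> W0; rewrite W0 in KW.
rewrite -E; have <- : tS t = 0; last by case: t {KS KW E} T => [[[N E] S] W].
by case: T KS => [||||||||l1|h hF|h l1 l' h' T|j jB|j b jB|j jB||j jn|j jn|]; rewrite /tS /= ?class_letter.
Qed.

Lemma col_spec t : tile_spec t -> tile_kind glue_class t = KCol ->
  t = (1, state_glue (HInit Q), 1, 0) \/ exists2 h, h <> HFinal Q & t = (0, state_glue h, 2, 0).
Proof.
move=> T K; have {K} : glue_class (tS t) <> Null /\ glue_class (tW t) = Null.
  by case: t T K => [[[N E] S] W] _ /kind_col.
case: T => [||||||||l|h hF|h l l' h' T|j jB|j b jB|j jB||j jn|j jn|];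
  rewrite /tS /tW /= ?class_state; auto; try by case.
by right; exists h.
Qed.

Lemma cell_spec t : tile_spec t -> tile_kind glue_class t = KCell -> t = alpha \/
  exists h l l' h', tr h l l' h' /\ t = (letter_glue l', state_glue h', letter_glue l, state_glue h).
Proof.
move=> T K; have {K} : glue_class (tS t) <> Null /\ glue_class (tW t) <> Null.
  by case: t T K => [[[N E] S] W] _ /kind_cell.
case: T => [||||||||l|h hF|h l l' h' T|j jB|j b jB|j jB||j jn|j jn|];
  rewrite /tS /tW /= ?class_state; auto; try by case.
by right; exists h, l, l', h'.
Qed.

Lemma trans_end h l h' : tr h l None h' -> l = None /\ h = HDone Q.
Proof. by move E: None => l' T; case: T E. Qed.

Section FromGrid.
Variables (a b : nat) (g : nat -> nat -> tile).
Hypothesis G : on_grid glue_class tile_set a.+1 b.+1 g.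
Hypothesis Galpha : g a.+1 b.+1 = alpha.

Lemma grid_tspec i j : i <= a.+1 -> j <= b.+1 -> tile_spec (g i j).
Proof. by case: G => GT _ _ _ _ Hi Hj; apply/tile_setP; exact: GT. Qed.

Lemma grid_cell_spec i j : i < a.+1 -> j < b.+1 -> g i.+1 j.+1 = alpha \/
  exists h l l' h', tr h l l' h' /\ g i.+1 j.+1 = (letter_glue l', state_glue h', letter_glue l, state_glue h).
Proof.
by move=> Hi Hj; case: G => _ _ _ _ GI; apply: cell_spec; [exact: grid_tspec|case: (GI i j Hi Hj)].
Qed.

Lemma grid_letter i j : i < a.+1 -> j < b.+1 -> exists l, tN (g i.+1 j) = letter_glue l.
Proof.
move=> Hi Hj; case: G => _ _ _ _ GI; have [_ _ ->] := GI i j Hi Hj.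
case: (grid_cell_spec Hi Hj) => [->|[h [l [l' [h' [_ ->]]]]]]; first by exists None.
by exists l.
Qed.

(** The null outputs of [alpha] feed no cell, so it can only be the top right one. *)
Lemma grid_trans i j : i < a.+1 -> j < b.+1 -> i < a \/ j < b ->
  exists h l l' h', tr h l l' h' /\ g i.+1 j.+1 = (letter_glue l', state_glue h', letter_glue l, state_glue h).
Proof.
move=> Hi Hj ne; case: (grid_cell_spec Hi Hj) => // E; exfalso.
case: G => _ _ _ _ GI; case: ne => H.
  have [_ + _] := GI i.+1 j H Hj; rewrite E.
  by case: (@grid_cell_spec i.+1 j H Hj) => [->|[h [l [l' [h' [_ ->]]]]]].
have [_ _ +] := GI i j.+1 Hi H; rewrite E.
by case: (@grid_cell_spec i j.+1 Hi H) => [->|[h [l [l' [h' [_ ->]]]]]].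
Qed.

(* The auxiliary corner supports a single cell, so [alpha] is not reached from it. *)
Lemma grid_corner : g 0 0 = (1, 3, 0, 0).
Proof.
have [GT G0 GB GV GI] := G.
case: (corner_spec (@grid_tspec 0 0 isT isT) G0) => // E0; exfalso.
have [K1 E1] := GB 0 isT; have [l1 L1] := @grid_letter 0 0 isT isT.
have := row_rstep (@grid_tspec 1 0 isT isT) K1 L1; rewrite -E1 E0 => R1.
have E15 : tE (g 1 0) = 5.
  by move: R1; rewrite /tE /=; move E6: 6 => c; move E: (_.2) => e T; case: T E6 => *; auto; exfalso; glue_lia.
have a0 : a = 0.
  case: (posnP a) => // ha; have [K2 E2] := GB 1 ha; have [l2 L2] := @grid_letter 1 0 ha isT.
  have := row_rstep (@grid_tspec 2 0 ha isT) K2 L2.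
  by rewrite -E2 E15 => /rstep5.
have [K3 E3] := GV 0 isT; have := col_spec (@grid_tspec 0 1 isT isT) K3.
rewrite E0 in E3; case=> [E|[h hF E]]; first by rewrite E in E3.
have b0 : b = 0.
  case: (posnP b) => // hb; have [K4 E4] := GV 1 hb; have := col_spec (@grid_tspec 0 2 isT hb) K4.
  by rewrite E in E4; case=> [E'|[h' _ E']]; rewrite E' in E4.
have Ga : g 1 1 = alpha by rewrite -Galpha a0 b0.
by have [_ + _] := GI 0 0 isT isT; rewrite E Ga => /state_glue_inj.
Qed.

Lemma grid_col j : j < b.+1 -> g 0 j.+1 = (1, state_glue (HInit Q), 1, 0).
Proof.
have [GT G0 GB GV GI] := G.
elim: j => [|j IH] Hj; have [K E] := GV _ Hj;
  case: (col_spec (@grid_tspec 0 _ isT Hj) K) => // -[h _ E2]; rewrite E2 in E.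
  by rewrite grid_corner in E.
by rewrite IH // in E; exact: ltnW.
Qed.

Let R j i := glue_letter (tN (g i j)).
Let H j i := glue_state (tE (g i j)).

Lemma grid_N i j : i < a.+1 -> j < b.+1 -> tN (g i.+1 j) = letter_glue (R j i.+1).
Proof. by move=> Hi Hj; rewrite /R; case: (grid_letter Hi Hj) => l ->; rewrite letter_glueK. Qed.

Lemma grid_step i j : i < a.+1 -> j < b.+1 -> i < a \/ j < b ->
  tr (H j.+1 i) (R j i.+1) (R j.+1 i.+1) (H j.+1 i.+1).
Proof.
move=> Hi Hj ne; have [_ _ _ _ GI] := G; have [_ EW ES] := GI i j Hi Hj.
have [h [l [l' [h' [T E]]]]] := grid_trans Hi Hj ne.
by rewrite /H /R EW ES E /tE /tW /tN /tS /= !letter_glueK !state_glueK.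
Qed.

(** Induction downwards from [alpha], which reads [None]: a transition writes [None] only when it
    reads [None]. *)
Lemma grid_last j : j <= b -> R j a.+1 = None.
Proof.
move=> Hj; rewrite -(subKn Hj); move: (b - j) (leq_subr j b) => d {j Hj}.
have [_ _ _ _ GI] := G.
elim: d => [|d IH] Hd.
  rewrite subn0 /R; have [_ _ ->] := GI a b (ltnSn a) (ltnSn b).
  by rewrite Galpha /tS /= letter_glueK.
have Hd' : b - d.+1 < b by lia.
have := @grid_step a (b - d.+1) (ltnSn a) (ltnW Hd') (or_intror Hd').
by rewrite -subSn // subSS IH ?(ltnW Hd) // => /trans_end [].
Qed.

(** The bottom row yields the witness and the initial configuration. Each row of cells below the top
    one closes with [TrEnd], hence performs a machine step; the top row ends at [alpha], hence in
    [HFinal], which certifies an accepting state. *)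
Lemma grid_accepts_aux : exists w, size w <= B /\ accepts (enc_pair (rev X) w).
Proof.
have [GT G0 GB GV GI] := G.
have RW p i : i + p = a -> rword (tE (g i 0)) [seq R 0 k.+1 | k <- iota i p.+1].
  elim: p i => [|p IH] i Hi; have Hia : i < a.+1 by lia.
    have [K E] := GB i Hia; exists (tE (g i.+1 0)).
      by rewrite E; apply: row_rstep => //; [exact: grid_tspec|exact: grid_N].
    by rewrite addn0 in Hi; rewrite /= Hi; exact: grid_last.
  have [K E] := GB i Hia; exists (tE (g i.+1 0)).
    by rewrite E; apply: row_rstep => //; [exact: grid_tspec|exact: grid_N].
  by have := IH i.+1; apply; lia.
have /rwordP [k [w [m [sw Els]]]] : rword 3 [seq R 0 k.+1 | k <- iota 0 a.+1].
  by have := RW a 0 erefl; rewrite grid_corner.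
exists w; split=> //; set c0 := init_mconf (enc_pair (rev X) w); pose o := Posz k.+2.
have sa : size (row_word k w m) = a.+1 by rewrite -Els size_map size_iota.
have R0 i : i < a.+1 -> R 0 i.+1 = conf_row c0 o a.+1 i.+1.
  move=> Hi; rewrite /c0 /o -sa -row_word_conf; last by rewrite sa.
  by rewrite -Els (nth_map 0) ?size_iota // nth_iota.
have Hinit j : j < b.+1 -> H j.+1 0 = HInit Q.
  by move=> Hj; rewrite /H grid_col // state_glueK.
have run j : j <= b -> (forall i, 0 < i < a.+1 -> R j i = conf_row (iter j step c0) o a.+1 i) ->
    row_run delta halt acc a.+1 (H j.+1) (conf_row (iter j step c0) o a.+1) (R j.+1).
  move=> Hj HR; split; first exact: Hinit.
  by move=> i Hi; rewrite -HR //; apply: grid_step => //; [exact: ltnW|left].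
have inv j : j <= b -> (forall i, 0 < i < a.+1 -> R j i = conf_row (iter j step c0) o a.+1 i) /\
    exists h, 0 < h < a.+1 /\ mc_head (iter j step c0) = (Posz h - o)%R.
  elim: j => [|j IH] Hj.
    split; first by move=> [|i] // Hi; apply: R0; lia.
    by exists k.+1; split; [rewrite -sa size_row_word; lia|rewrite /o /=; lia].
  have [HR [h [/andP [h0 ha] Eh]]] := IH (ltnW Hj).
  have Hd : H j.+1 a.+1.-1 = HDone Q.
    have := @grid_step a j (ltnSn a) (ltnW Hj) (or_intror Hj).
    by rewrite (grid_last Hj) => /trans_end [].
  have [_ [h' [Hh' Eh' HR']]] := row_run_step h0 ha Eh (run j (ltnW Hj) HR) Hd.
  by split=> //; exists h'.
have [HR [h [/andP [h0 ha] Eh]]] := inv b (leqnn b).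
exists b; apply: (row_run_acc h0 ha Eh (run b (leqnn b) HR)).
have [_ EW _] := GI a b (ltnSn a) (ltnSn b).
by rewrite /H /= EW Galpha state_glueK.
Qed.

End FromGrid.

(** * From an accepting run to a rectangle *)

Lemma mstep_head c : absz (mc_head (step c) - mc_head c)%R <= 1.
Proof.
rewrite /mstep; case: ifP => _; first by lia.
case: (delta _ _) => [[q s] m] /=; have := ltn_ord m; lia.
Qed.

Lemma iter_mstep_head y j : absz (mc_head (iter j step (init_mconf y)) + 1)%R <= j.
Proof.
elim: j => [|j IH] /=; first by lia.
by have := mstep_head (iter j step (init_mconf y)); lia.
Qed.

Lemma accepts_grid w : size w <= B -> accepts (enc_pair (rev X) w) -> grid_reaches glue_class tile_set alpha.
Proof.
move=> sw Acc; set c0 := init_mconf (enc_pair (rev X) w) in Acc *.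
(* Before the first accepting time [t] the machine has not halted, since a halted configuration
   would stay unchanged until [t] and be accepting already. *)
have [t At Amin] := ex_minnP Acc.
have nh j : j < t -> ~~ halt (mc_state (iter j step c0)).
  move=> jt; apply/negP => Hj; have E d : iter (j + d) step c0 = iter j step c0.
    elim: d => [|d IH]; first by rewrite addn0.
    by rewrite addnS /= IH /mstep Hj.
  move: At; have -> : t = j + (t - j) by lia.
  by rewrite E => /Amin; lia.
(* The head starts on cell -1 and moves by at most one cell per step, so [t.+1] blanks on each side
   keep it off the margins up to time [t]. *)
pose k := t.+1; pose m := t.+1; pose ls := row_word k w m; pose a := size ls; pose o := Posz k.+2.
have Ea : a = k + (size (enc_pair (rev X) w) + m).+2 by exact: size_row_word.
have [e e0 He] : exists2 e : nat -> nat, e 0 = 3 & forall i, i < size ls -> rstep_spec (e i) (nth None ls i) (e i.+1).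
  by apply: rword_glues; apply/rwordP; exists k, w, m.
have head j : j <= t -> exists h, [/\ 1 < h, h.+1 < a & mc_head (iter j step c0) = (Posz h - o)%R].
  move=> jt; have := iter_mstep_head (enc_pair (rev X) w) j; rewrite -/c0 => Hh.
  by exists (absz (mc_head (iter j step c0) + o)%R); rewrite /o /k Ea /k /m; split; lia.
pose R j i := conf_row (iter j step c0) o a i.
(* The condition [j <= t] stands under the existential so that a run can be chosen for every [j]. *)
have HEx j : exists H, j <= t -> row_run delta halt acc a H (R j) (R j.+1) /\
    H a.-1 = (if j == t then HFinal Q else HDone Q).
  case: (leqP j t) => jt; last by exists (fun=> HInit Q).
  have [h [h1 ha Eh]] := head j jt.
  have h0 : 0 < h by exact: ltnW.
  have ha' : h < a by exact: ltnW.
  case: (eqVneq j t) => [Ej|ne].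
    rewrite Ej in Eh; have [H [run EH]] := row_run_acc_ex delta halt h0 ha' Eh At.
    have Et : iter t.+1 step c0 = iter t step c0 by rewrite iterS {1}/mstep (acc_halt At).
    by exists H; rewrite /R Ej Et.
  have nj : ~~ halt (mc_state (iter j step c0)) by apply: nh; lia.
  have [H HH] := row_run_ex delta acc h0 ha' Eh h1 ha nj.
  by exists H.
pose F j := proj1_sig (constructive_indefinite_description _ (HEx j)).
have FP j : j <= t -> row_run delta halt acc a (F j) (R j) (R j.+1) /\
    F j a.-1 = (if j == t then HFinal Q else HDone Q).
  exact: proj2_sig (constructive_indefinite_description _ (HEx j)).
have Ra j : R j a = None by rewrite /R /conf_row ltnn.
(* [F] describes the columns before [a] only; the closing column outputs [HEnd]. *)
pose H j i := if i == a then HEnd Q else F j i.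
have H0 j : j <= t -> H j 0 = HInit Q.
  by move=> jt; rewrite /H; case: eqP => [E|_]; [lia|case: (FP j jt) => -[]].
have HT j i : j <= t -> i < a -> i.+1 < a \/ j < t -> tr (H j i) (R j i.+1) (R j.+1 i.+1) (H j i.+1).
  move=> jt ia ne; have [[_ run] last] := FP j jt; rewrite /H ifN; last by lia.
  case: (eqVneq i.+1 a) => [E|ne1]; last by apply: run; lia.
  have jt' : j < t by lia.
  rewrite E !Ra; have -> : F j i = HDone Q; last by constructor.
  by move: last; rewrite -E /= => ->; rewrite ifN //; lia.
pose g i j : tile := match i, j with
  | 0, 0 => (1, 3, 0, 0)
  | 0, _ => (1, state_glue (HInit Q), 1, 0)
  | S i', 0 => (letter_glue (R 0 i), e i, 0, e i')
  | S i', S j' => if (i == a) && (j' == t) then alpha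
                  else (letter_glue (R j i), state_glue (H j' i), letter_glue (R j' i), state_glue (H j' i'))
  end.
have gN i j : i < a -> j <= t -> tN (g i.+1 j) = letter_glue (R j i.+1).
  by case: j => [|j] //= ia jt; rewrite ifN //; lia.
have gE i j : i < a -> j <= t -> tE (g i j.+1) = state_glue (H j i).
  by case: i => [|i] //= ia jt; [rewrite H0|rewrite ifN //; lia].
have gS i j : i < a -> j <= t -> tS (g i.+1 j.+1) = letter_glue (R j i.+1).
  by move=> ia jt /=; case: ifP => // /andP [/eqP -> _]; rewrite Ra.
have gW i j : i < a -> j <= t -> tW (g i.+1 j.+1) = state_glue (H j i).
  move=> ia jt /=; case: ifP => // /andP [/eqP E /eqP Ej].
  rewrite /alpha /tW /= /H ifN; last by lia.
  by have [_] := FP j jt; rewrite -E /= => ->; rewrite Ej eqxx.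
have gB i : i < a -> rstep (e i) (R 0 i.+1) (e i.+1).
  by move=> ia; apply/rstepP; rewrite /R -row_word_conf //; exact: He.
have gT i j : i <= a -> j <= t.+1 -> tile_spec (g i j).
  case: i => [|i]; case: j => [|j] ia jt /=; try by constructor.
    by case: (gB i ia).
  case: ifP => [_|ne]; first by constructor.
  by apply: TScell; apply: HT => //; lia.
have a1 : a.-1.+1 = a by lia.
have g00 : g 0 0 = (1, 3, 0, 0) by [].
have g0S j : g 0 j.+1 = (1, state_glue (HInit Q), 1, 0) by [].
have gS0 i : g i.+1 0 = (letter_glue (R 0 i.+1), e i.+1, 0, e i) by [].
have gat : g a t.+1 = alpha by rewrite -a1 /= a1 !eqxx.
clearbody g; exists a.-1, t, g; rewrite a1; split=> //; split.
- by move=> i j Hi Hj; apply/tile_setP; exact: gT.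
- by rewrite g00.
- move=> i Hi; split; last by case: i {Hi} => [|i]; rewrite ?g00 ?gS0 // /tE /tW /= e0.
  have [T _] := gB i Hi; have := tile_set_kinded (iffRL (tile_setP _) T).
  rewrite gS0 /well_kinded /tile_kind /tS /tW /=.
  by case Ek: (glue_class (e i)) => //; rewrite /tN /= class_letter => -[].
- move=> j Hj; split; last by case: j {Hj} => [|j]; rewrite ?g00 !g0S.
  by rewrite /tile_kind g0S.
- move=> i j Hi Hj; split.
  + by rewrite /tile_kind gS // gW // class_letter class_state.
  + by rewrite gE // gW.
  + by rewrite gN // gS.
Qed.

Theorem alpha_grid : grid_reaches glue_class tile_set alpha <->
  exists w, size w <= B /\ accepts (enc_pair (rev X) w).
Proof.
split; first by move=> [a [b [g [G E]]]]; exact: grid_accepts_aux G E.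
by case=> w [sw Hw]; exact: accepts_grid Hw.
Qed.

End TileSet.

(** * Four stages with one bin *)

Section OneBin.
Variables (strs : seq nat) (T : seq tile) (A : config) (P : Prop).
Hypothesis wfA : wf_config A.
Hypothesis terminalE : forall X, terminal strs 2 (single_tiles T) X <-> asm_eq X A /\ P.

(** If [P] fails the bin starts empty. If it holds, the bin contains copies of [A] only, and these
    do not combine because [A] is terminal in the bin of tiles, where all its copies are produced as
    well. *)
Lemma terminal_restart (S0 : config -> Prop) : (forall X, S0 X <-> asm_eq X A /\ P) ->
  forall X, terminal strs 2 S0 X <-> asm_eq X A /\ P.
Proof.
move=> S0E X; have prodE Y : produced strs 2 S0 Y <-> asm_eq Y A /\ P.
  split=> [|[E p]]; last by apply: Prod_init; [apply/S0E | case: E].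
  elim=> [{}Y /S0E [] //|{}Y Z _ [E p] EZ|{}Y Z W _ [EY p] _ [EZ _] C].
    by split=> //; apply: asm_eq_trans E; exact: asm_eq_sym.
  have /terminalE [PZ _] := conj EZ p; have /terminalE [_ HY] := conj EY p.
  by case: (HY Z W PZ C).
split=> [[/prodE //]|[E p]]; split; first exact/prodE.
move=> Y C /prodE [EY _]; have /terminalE [PY _] := conj EY p.
by have /terminalE [_ HX] := conj E p; exact: HX.
Qed.

Definition one_bin : staged :=
  Staged 4 1 [:: (0, 0, 0); (1, 0, 0); (2, 0, 0)] [:: T] strs 2.

Lemma one_bin_terminal i X : i < 4 -> bin_terminal one_bin i 0 X <-> asm_eq X A /\ P.
Proof.
elim: i X => [|i IH] X Hi; first exact: terminalE.
apply: terminal_restart => Y; split=> [[k [+ H]]|H].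
  rewrite !inE => Hk; have Ek : k = 0 by move: Hk; case: k {H} => // k; rewrite !xpair_eqE !andbF.
  by rewrite Ek in H; apply/(IH _ (ltnW Hi)).
exists 0; split; last by apply/(IH _ (ltnW Hi)).
by move: i Hi {IH} => [|[|[|]]].
Qed.

Lemma one_bin_unique : uniquely_assembles one_bin A <-> P.
Proof.
have outE X : output one_bin X <-> asm_eq X A /\ P.
  split=> [[_ [j [+ H]]]|H].
    by case: j H => // H _; apply/(@one_bin_terminal 3).
  by split=> //; exists 0; split=> //; apply/(@one_bin_terminal 3).
split=> [[_ H]|p]; first by have /outE [] := iffRL (H A) (asm_eq_refl wfA).
by split=> // X; split=> [/outE []|E]; last exact/outE.
Qed.

End OneBin.

(** * Stack machines on a Turing tape *)

Definition o0 : 'I_3 := @Ordinal 3 0 isT.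
Definition o1 : 'I_3 := @Ordinal 3 1 isT.
Definition o2 : 'I_3 := @Ordinal 3 2 isT.

Definition set_cell (S : Type) (T : int -> S) (h : int) (s : S) : int -> S :=
  fun z => if z == h then s else T z.

Lemma set_cell_id (S : Type) (T : int -> S) h : set_cell T h (T h) = T.
Proof. by apply: functional_extensionality => z; rewrite /set_cell; case: eqP => [->|]. Qed.

(** * Finite types as states and symbols of a Turing machine *)

Section Encoding.

(** The left summand carries the three reserved codes of a [TM]: start, accept and reject among the
    states, blank and the two bits among the symbols. *)
Definition ord_of_sum (T : finType) (s : 'I_3 + T) : 'I_(#|T|).+3 :=
  unsplit (match s with inl i => inl i | inr t => inr (enum_rank t) end : 'I_3 + 'I_(#|T|)).

Definition sum_of_ord (T : finType) (i : 'I_(#|T|).+3) : 'I_3 + T :=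
  match split (i : 'I_(3 + #|T|)) with inl i => inl i | inr r => inr (enum_val r) end.

Lemma ord_of_sumK (T : finType) : cancel (@ord_of_sum T) (@sum_of_ord T).
Proof. by move=> [i|t]; rewrite /sum_of_ord /ord_of_sum unsplitK // enum_rankK. Qed.

Lemma inord_sum (T : finType) (i : 'I_3) : inord i = ord_of_sum (inl i : 'I_3 + T).
Proof. by apply: val_inj; rewrite /= inordK //; exact: leq_trans (ltn_ord i) _. Qed.

Variables (P G : finType) (d : 'I_3 + P -> 'I_3 + G -> ('I_3 + P) * ('I_3 + G) * 'I_3).

Definition TM_of : TM := @MkTM #|P| #|G| (fun q s =>
  let: (q', s', m) := d (sum_of_ord q) (sum_of_ord s) in (ord_of_sum q', ord_of_sum s', m)).

Definition sum_halt (q : 'I_3 + P) : bool :=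
  match q with inl i => (val i == 1) || (val i == 2) | inr _ => false end.

Definition enc_conf (c : mconf ('I_3 + P)%type ('I_3 + G)%type) : tm_conf TM_of :=
  @TMConf TM_of (ord_of_sum (mc_state c)) (fun z => ord_of_sum (mc_tape c z)) (mc_head c).

Lemma halting_enc c : halting (tc_state (enc_conf c)) = sum_halt (mc_state c).
Proof.
by case: c => [[i|p] T h].
Qed.

Lemma tm_step_enc c : tm_step (enc_conf c) = enc_conf (mstep d sum_halt c).
Proof.
rewrite /tm_step halting_enc /mstep; case: ifP => // _.
rewrite /= !ord_of_sumK; case: (d _ _) => [[q s] m].
congr TMConf; apply: functional_extensionality => z /=.
by case: (z == _).
Qed.

Definition raw (b : bool) : 'I_3 + G := inl (if b then o2 else o1).

Definition input_tape (x : seq bool) (z : int) : 'I_3 + G :=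
  match z with
  | Posz k => if k < size x then raw (nth false x k) else inl o0
  | Negz _ => inl o0 end.

Lemma init_conf_enc x : init_conf TM_of x = enc_conf (MConf (inl o0) (input_tape x) 0%R).
Proof.
congr TMConf; first exact: (inord_sum P o0).
apply: functional_extensionality => -[k|k] /=; last exact: (inord_sum G o0).
case: ifP => _; last exact: (inord_sum G o0).
by rewrite /sym_of_bit /raw; case: nth; [exact: (inord_sum G o2)|exact: (inord_sum G o1)].
Qed.

Lemma tm_run_enc x t : tm_run TM_of x t =
  enc_conf (iter t (mstep d sum_halt) (MConf (inl o0) (input_tape x) 0%R)).
Proof.
rewrite /tm_run init_conf_enc; elim: t => [|t IH] //=.
by rewrite IH tm_step_enc.
Qed.

Lemma read_bits_enc (T : int -> 'I_3 + G) (s : seq bool) fuel k :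
  (forall i, i < size s -> T (Posz (k + i)) = raw (nth false s i)) ->
  T (Posz (k + size s)) = inl o0 -> size s <= fuel ->
  @read_bits TM_of fuel (fun z => ord_of_sum (T z)) k = s.
Proof.
elim: s fuel k => [|b s IH] [|f] k Hs He Hf //=.
  by rewrite addn0 in He; rewrite He.
have := Hs 0 isT; rewrite addn0 => -> /=.
have E : @read_bits TM_of f (fun z => ord_of_sum (T z)) k.+1 = s.
  by apply: IH => // [i Hi|]; rewrite addSnnS; [exact: (Hs i.+1)|exact: He].
by case: b {Hs He Hf} => /=; rewrite E.
Qed.

End Encoding.

(** * Stack machines and their simulation *)

Section StackMachine.
Variable nk : nat.
Notation stacks := (seq (seq bool)).

Inductive instr :=
| IPush of 'I_nk & bool & nat
| IPop of 'I_nk & nat & nat & nat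
| IJmp of nat.

Definition get (st : stacks) (k : nat) : seq bool := nth [::] st k.
Definition put (st : stacks) (k : nat) (s : seq bool) : stacks := set_nth [::] st k s.

Lemma get_put st k s j : get (put st k s) j = if j == k then s else get st j.
Proof. by rewrite /get /put nth_set_nth /=. Qed.

Inductive istep (C : seq instr) : nat -> stacks -> nat -> stacks -> Prop :=
| SPush l st k b l' : onth C l = Some (IPush k b l') -> istep C l st l' (put st k (rcons (get st k) b))
| SPopE l st k le l0 l1 : onth C l = Some (IPop k le l0 l1) -> get st k = [::] -> istep C l st le st
| SPop l st k le l0 l1 s b : onth C l = Some (IPop k le l0 l1) -> get st k = rcons s b ->
    istep C l st (if b then l1 else l0) (put st k s)
| SJmp l st l' : onth C l = Some (IJmp l') -> istep C l st l' st.

Inductive isteps (C : seq instr) : nat -> nat -> stacks -> nat -> stacks -> Prop :=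
| IDone l st : isteps C 0 l st l st
| IStep t l st l1 st1 l2 st2 : istep C l st l1 st1 -> isteps C t l1 st1 l2 st2 -> isteps C t.+1 l st l2 st2.

Lemma isteps_trans C t1 t2 l st l1 st1 l2 st2 :
  isteps C t1 l st l1 st1 -> isteps C t2 l1 st1 l2 st2 -> isteps C (t1 + t2) l st l2 st2.
Proof. by elim=> // {}t1 {}l {}st l3 st3 l4 st4 S _ IH /IH; exact: IStep S. Qed.

Lemma isteps1 C l st l1 st1 : istep C l st l1 st1 -> isteps C 1 l st l1 st1.
Proof. by move=> S; apply: IStep S _; constructor. Qed.

Section Sim.
Variables (C : seq instr) (kin kout : 'I_nk).

(* Cell [-1] holds a marker, on which the head rests between instructions; track [k] of the
   cells [0, 1, ...] holds stack [k], with its top at the right end. *)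
Inductive phase := At | Seek | Look | Ret | Fin | Mark.
Definition phase_code (p : phase) : 'I_6 :=
  match p with At => inord 0 | Seek => inord 1 | Look => inord 2 | Ret => inord 3 | Fin => inord 4 | Mark => inord 5 end.
Definition phase_decode (i : 'I_6) : phase := nth At [:: At; Seek; Look; Ret; Fin; Mark] i.
Lemma phase_codeK : cancel phase_code phase_decode.
Proof. by case; rewrite /phase_code /phase_decode inordK. Qed.
HB.instance Definition _ := Finite.copy phase (can_type phase_codeK).

Definition label := 'I_(size C).+1.
Definition pstate := (phase * label)%type.
Definition cell := option {ffun 'I_nk -> option bool}.

Definition is_mark (s : 'I_3 + cell) : bool := if s is inr None then true else false.

(** A raw input bit is seen as a cell holding that bit on track [kin], so the input tape already
    represents the initial stacks and needs no conversion. *)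
Definition view (s : 'I_3 + cell) : {ffun 'I_nk -> option bool} :=
  match s with
  | inl i => [ffun k => if k == kin then (if val i == 1 then Some false else if val i == 2 then Some true
                else None) else None]
  | inr (Some v) => v
  | inr None => [ffun => None]
  end.

Definition write (s : 'I_3 + cell) (k : 'I_nk) (b : option bool) : 'I_3 + cell :=
  inr (Some [ffun j => if j == k then b else view s j]).

(** The start state moves left and [Mark] places the marker there. Reaching a label outside the code
    starts [Fin], which overwrites the tape by track [kout] in raw bits and closes it with a blank,
    where [read_bits] stops. *)
Definition sm_delta (q : 'I_3 + pstate) (s : 'I_3 + cell) : ('I_3 + pstate) * ('I_3 + cell) * 'I_3 :=
  match q with
  | inl _ => (inr (Mark, ord0), s, o0)
  | inr (ph, l) =>
    match ph with
    | Mark => (inr (At, ord0), inr None, o1)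
    | At => match onth C l with
        | Some (IJmp l') => (inr (At, inord l'), s, o1)
        | Some _ => (inr (Seek, l), s, o2)
        | None => (inr (Fin, l), s, o2) end
    | Seek => match onth C l with
        | Some (IPush k b l') => if view s k is Some _ then (inr (Seek, l), s, o2)
                                 else (inr (Ret, inord l'), write s k (Some b), o0)
        | Some (IPop k _ _ _) => if view s k is Some _ then (inr (Seek, l), s, o2)
                                 else (inr (Look, l), s, o0)
        | _ => (q, s, o1) end
    | Look => match onth C l with
        | Some (IPop k le l0 l1) => if is_mark s then (inr (At, inord le), s, o1) else
            if view s k is Some b then (inr (Ret, inord (if b then l1 else l0)), write s k None, o0)
            else (q, s, o1)
        | _ => (q, s, o1) end
    | Ret => if is_mark s then (inr (At, l), s, o1) else (q, s, o0)
    | Fin => if view s kout is Some b then (q, raw cell b, o2) else (inl o1, inl o0, o1)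
    end
  end.

Notation step := (mstep sm_delta (@sum_halt _)).

Lemma step_move q T h q' m : sm_delta (inr q) (T h) = (q', T h, m) ->
  step (MConf (inr q) T h) = MConf q' T (h + Posz (val m) - 1)%R.
Proof.
by rewrite /mstep [mc_state _]/= [mc_tape _]/= [mc_head _]/= => ->; congr MConf; exact: set_cell_id.
Qed.

Lemma step_write q T h q' s m : sm_delta (inr q) (T h) = (q', s, m) ->
  step (MConf (inr q) T h) = MConf q' (set_cell T h s) (h + Posz (val m) - 1)%R.
Proof. by rewrite /mstep [mc_state _]/= [mc_tape _]/= [mc_head _]/= => ->. Qed.

Definition repr (st : stacks) (T : int -> 'I_3 + cell) : Prop :=
  T (-1)%R = inr None /\ forall i, is_mark (T (Posz i)) = false /\
    forall k : 'I_nk, view (T (Posz i)) k = onth (get st k) i.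

Lemma seek_run T (l : label) (k : 'I_nk) n :
  (exists b l', onth C l = Some (IPush k b l')) \/ (exists le l0 l1, onth C l = Some (IPop k le l0 l1)) ->
  (forall i, i < n -> view (T (Posz i)) k <> None) ->
  iter n step (MConf (inr (Seek, l)) T 0%R) = MConf (inr (Seek, l)) T (Posz n).
Proof.
move=> Hl; elim: n => [|n IH] // H; rewrite iterS IH; last by move=> i Hi; apply: H; exact: ltnW.
rewrite (@step_move _ _ _ (inr (Seek, l)) o2); first by congr MConf; rewrite /=; lia.
have := H n (ltnSn n); case: Hl => [[b [l' E]]|[le [l0 [l1 E]]]]; rewrite /= E;
  by case: (view _ _).
Qed.

Lemma ret_run T (l : label) n : (forall i, i < n -> is_mark (T (Posz i)) = false) -> T (-1)%R = inr None ->
  iter n.+1 step (MConf (inr (Ret, l)) T (Posz n - 1)%R) = MConf (inr (At, l)) T (-1)%R.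
Proof.
elim: n => [|n IH] H T1.
  by rewrite /= (@step_move _ _ _ (inr (At, l)) o1) //= T1.
rewrite iterSr (@step_move _ _ _ (inr (Ret, l)) o0); last first.
  have -> : (Posz n.+1 - 1)%R = Posz n by lia.
  by rewrite /= (H n).
have -> : (Posz n.+1 - 1 + Posz (val o0) - 1)%R = (Posz n - 1)%R by rewrite /=; lia.
by apply: IH => // i Hi; apply: H; exact: ltnW.
Qed.

Lemma view_write s k b j : view (write s k b) j = if j == k then b else view s j.
Proof. by rewrite /write /= ffunE. Qed.

Lemma repr_set st T (k : 'I_nk) i b s : repr st T ->
  (forall j, onth s j = if j == i then b else onth (get st k) j) ->
  repr (put st k s) (set_cell T (Posz i) (write (T (Posz i)) k b)).
Proof.
move=> [T1 H] Hs; split=> [|j]; first by rewrite /set_cell /= T1.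
rewrite /set_cell; case: eqP => [[->]|ne].
  split=> // j'; rewrite view_write get_put; case: eqP => [->|ne].
    by rewrite eqxx Hs eqxx.
  by rewrite ifN; [case: (H i)|apply/eqP => E; apply: ne; apply: val_inj].
have [H1 H2] := H j; split=> // j'; rewrite get_put H2; case: eqP => // ->.
by rewrite Hs ifN //; apply/eqP => E; apply: ne; rewrite E.
Qed.

Lemma onth_rcons (s : seq bool) b j : onth (rcons s b) j = if j == size s then Some b else onth s j.
Proof. by elim: s j => [|a s IH] [|j] //=; case: j. Qed.

Lemma onth_ge (A : Type) (s : seq A) j : size s <= j -> onth s j = None.
Proof. by elim: s j => [|a s IH] [|j] //= /IH. Qed.

Lemma onth_nth (s : seq bool) j : j < size s -> onth s j = Some (nth false s j).
Proof. by elim: s j => [|a s IH] [|j] //= /IH. Qed.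

Lemma onth_lt (s : seq bool) j : j < size s -> onth s j <> None.
Proof. by elim: s j => [|a s IH] [|j] //= /IH. Qed.

Lemma istep_sim l st l' st' T : l <= size C -> l' <= size C -> istep C l st l' st' -> repr st T ->
  exists t T', [/\ forall m, (forall k : 'I_nk, size (get st k) <= m) -> t <= 2 * m + 5, repr st' T' &
    iter t step (MConf (inr (At, inord l)) T (-1)%R) = MConf (inr (At, inord l')) T' (-1)%R].
Proof.
move=> Hl Hl' S RT; have [T1 H] := RT; case: S Hl Hl' RT H => {l st l' st'}.
- move=> l st k b l' E Hl Hl' RT H; set n := size (get st k).
  have E' : onth C (inord l : label) = Some (IPush k b l') by rewrite inordK.
  (* From right to left: leave the marker, seek the first free cell, write, return. *)
  exists (n.+1 + (1 + (n + 1))), (set_cell T (Posz n) (write (T (Posz n)) k (Some b))).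
  have RT' : repr (put st k (rcons (get st k) b)) (set_cell T (Posz n) (write (T (Posz n)) k (Some b))).
    by apply: repr_set => // j; exact: onth_rcons.
  split=> //; first by move=> m /(_ k); rewrite -/n; lia.
  rewrite 3!iterD [iter 1 _ (MConf (inr (At, _)) _ _)]/iter.
  rewrite (@step_move _ _ _ (inr (Seek, inord l)) o2); last by rewrite /= E'.
  have -> : (-1 + Posz (val o2) - 1)%R = 0%R by [].
  rewrite (seek_run (k := k)); [|by left; exists b, l'|]; last first.
    by move=> i Hi; case: (H i) => _ ->; exact: onth_lt.
  rewrite [iter 1 _ _]/iter (@step_write _ _ _ (inr (Ret, inord l')) (write (T (Posz n)) k (Some b)) o0); last first.
    by rewrite /= E'; case: (H n) => _ ->; rewrite onth_ge.
  have -> : (Posz n + Posz (val o0) - 1)%R = (Posz n - 1)%R by rewrite /=; lia.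
  by apply: ret_run; case: RT' => // _ H' i _; case: (H' i).
- move=> l st k le l0 l1 E E0 Hl Hl' RT H.
  have E' : onth C (inord l : label) = Some (IPop k le l0 l1) by rewrite inordK.
  exists 3, T; split=> //; first by lia.
  rewrite !iterS (@step_move _ _ _ (inr (Seek, inord l)) o2); last by rewrite /= E'.
  rewrite (@step_move _ _ _ (inr (Look, inord l)) o0); last first.
    by rewrite /= E'; case: (H 0) => _ ->; rewrite E0.
  by rewrite (@step_move _ _ _ (inr (At, inord le)) o1) //= E' T1.
- move=> l st k le l0 l1 s b E E0 Hl Hl' RT H; set n := size s.
  have E' : onth C (inord l : label) = Some (IPop k le l0 l1) by rewrite inordK.
  set lb := (if b then l1 else l0) in Hl' *.
  (* From right to left: leave the marker, seek past the top, step back onto it, erase, return. *)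
  exists (n.+1 + (1 + (1 + (n.+1 + 1)))), (set_cell T (Posz n) (write (T (Posz n)) k None)).
  have RT' : repr (put st k s) (set_cell T (Posz n) (write (T (Posz n)) k None)).
    apply: repr_set => // j; rewrite E0 onth_rcons -/n; case: eqP => // ->.
    by rewrite onth_ge.
  split=> //; first by move=> m /(_ k); rewrite E0 size_rcons -/n; lia.
  rewrite 4!iterD [iter 1 _ (MConf (inr (At, _)) _ _)]/iter.
  rewrite (@step_move _ _ _ (inr (Seek, inord l)) o2); last by rewrite /= E'.
  have -> : (-1 + Posz (val o2) - 1)%R = 0%R by [].
  rewrite (seek_run (k := k)); [|by right; exists le, l0, l1|]; last first.
    by move=> i Hi; case: (H i) => _ ->; apply: onth_lt; rewrite E0 size_rcons.
  rewrite [iter 1 _ (MConf (inr (Seek, _)) _ _)]/iter.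
  rewrite (@step_move _ _ _ (inr (Look, inord l)) o0); last first.
    by rewrite /= E'; case: (H n.+1) => _ ->; rewrite onth_ge // E0 size_rcons.
  have -> : (Posz n.+1 + Posz (val o0) - 1)%R = Posz n by rewrite /=; lia.
  rewrite [iter 1 _ _]/iter (@step_write _ _ _ (inr (Ret, inord lb)) (write (T (Posz n)) k None) o0); last first.
    by rewrite /= E'; case: (H n) => -> ->; rewrite E0 onth_rcons eqxx.
  have -> : (Posz n + Posz (val o0) - 1)%R = (Posz n - 1)%R by rewrite /=; lia.
  by apply: ret_run; case: RT' => // _ H' i _; case: (H' i).
- move=> l st l' E Hl Hl' RT H.
  have E' : onth C (inord l : label) = Some (IJmp l') by rewrite inordK.
  exists 1, T; split=> //; first by lia.
  by rewrite /= (@step_move _ _ _ (inr (At, inord l')) o1) //= E'.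
Qed.

(** Labels enter the finite control through [inord], which is faithful only up to [size C]. *)
Definition labels_ok := forall l i, onth C l = Some i ->
  match i with
  | IPush _ _ l' => l' <= size C
  | IPop _ le l0 l1 => [&& le <= size C, l0 <= size C & l1 <= size C]
  | IJmp l' => l' <= size C
  end.

Lemma istep_bounds l st l' st' m : labels_ok -> istep C l st l' st' ->
  (forall k, size (get st k) <= m) -> l' <= size C /\ forall k, size (get st' k) <= m.+1.
Proof.
move=> ok; case=> {l st l' st'}.
- move=> l st k b l' /ok Hl H; split=> // j; rewrite get_put; case: eqP => _; last exact: leqW.
  by rewrite size_rcons ltnS.
- by move=> l st k le l0 l1 /ok /and3P [Hl _ _] _ H; split=> // j; exact: leqW.
- move=> l st k le l0 l1 s b /ok /and3P [_ H0 H1] E H; split; first by case: b {E}.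
  move=> j; rewrite get_put; case: eqP => _; last exact: leqW.
  by have := H k; rewrite E size_rcons; lia.
- by move=> l st l' /ok Hl H; split=> // j; exact: leqW.
Qed.

(** A stack grows by at most one symbol per instruction, so [m + n] bounds all stacks throughout,
    and each instruction costs at most two sweeps of that length. *)
Lemma isteps_sim n l st l' st' T m : labels_ok -> l <= size C -> isteps C n l st l' st' -> repr st T ->
  (forall k, size (get st k) <= m) ->
  exists t T', [/\ t <= n * (2 * (m + n) + 5), repr st' T',
    iter t step (MConf (inr (At, inord l)) T (-1)%R) = MConf (inr (At, inord l')) T' (-1)%R &
    forall k, size (get st' k) <= m + n].
Proof.
move=> ok Hl S; elim: S T m Hl => {n l st l' st'} [l st|n l st l1 st1 l2 st2 S1 _ IH] T m Hl RT Hm.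
  by exists 0, T; split=> // k; rewrite addn0.
have [Hl1 Hm1] := istep_bounds ok S1 Hm.
have [t1 [T1 [Ht1 R1 E1]]] := istep_sim Hl Hl1 S1 RT.
have [t2 [T2 [Ht2 R2 E2 Hm2]]] := IH T1 m.+1 Hl1 R1 Hm1.
exists (t2 + t1), T2; split=> //.
- have /= Hm' := Ht1 m (fun k => Hm k).
  move: Ht2; rewrite addSnnS; move: (m + n.+1) (leq_addr n.+1 m) => M; nia.
- by rewrite iterD E1.
- by move=> k; rewrite addnS -addSn.
Qed.

Lemma fin_run T s (l : label) : (forall i, i < size s -> view (T (Posz i)) kout = Some (nth false s i)) ->
  view (T (Posz (size s))) kout = None ->
  exists T', [/\ iter (size s).+1 step (MConf (inr (Fin, l)) T 0%R) = MConf (inl o1) T' (Posz (size s)),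
    forall i, i < size s -> T' (Posz i) = raw cell (nth false s i) & T' (Posz (size s)) = inl o0].
Proof.
move=> Hs He.
have run n : n <= size s -> exists T', [/\ iter n step (MConf (inr (Fin, l)) T 0%R) = MConf (inr (Fin, l)) T' (Posz n),
    forall i, i < n -> T' (Posz i) = raw cell (nth false s i) & forall i, n <= i -> T' (Posz i) = T (Posz i)].
  elim: n => [|n IH] Hn; first by exists T.
  have [T' [E H1 H2]] := IH (ltnW Hn).
  exists (set_cell T' (Posz n) (raw cell (nth false s n))); split.
  - rewrite iterS E (@step_write _ _ _ (inr (Fin, l)) (raw cell (nth false s n)) o2).
      by congr MConf; rewrite /=; lia.
    by rewrite /= H2 // Hs.
  - move=> i Hi; rewrite /set_cell; case: eqP => [[->]|ne] //.
    by apply: H1; move: Hi ne; rewrite ltnS leq_eqVlt => /orP [/eqP ->|].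
  - move=> i Hi; rewrite /set_cell; case: eqP => [[E']|_]; first by lia.
    exact/H2/ltnW.
have [T' [E H1 H2]] := run _ (leqnn _).
exists (set_cell T' (Posz (size s)) (inl o0)); split.
- rewrite iterS E (@step_write _ _ _ (inl o1) (inl o0) o1).
    by congr MConf; rewrite /=; lia.
  by rewrite /= H2 // He.
- move=> i Hi; rewrite /set_cell; case: eqP => [[E']|_]; first by lia.
  exact: H1.
- by rewrite /set_cell eqxx.
Qed.

Lemma stack_machine_run x st n :
  labels_ok -> (forall k : nat, get st k = if k == kin then x else [::]) ->
  forall st', isteps C n 0 st (size C) st' ->
  exists t, [/\ t <= n * (2 * (size x + n) + 5) + (size x + n) + 5,
     halting (tc_state (tm_run (TM_of sm_delta) x t)) &
     tm_output (TM_of sm_delta) x t = get st' kout].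
Proof.
move=> ok Hst st' S.
pose T0 : int -> 'I_3 + cell := set_cell (input_tape cell x) (-1)%R (inr None).
have R0 : repr st T0.
  split; first by rewrite /T0 /set_cell eqxx.
  move=> i; rewrite /T0 /set_cell /=; split; first by case: ifP.
  move=> k; rewrite Hst; case: (ltnP i (size x)) => Hi.
    rewrite /raw; case Eb: (nth false x i); rewrite /= ffunE (inj_eq val_inj) /=;
      (case: eqP => _; last by rewrite onth_ge); by rewrite onth_nth // Eb.
  by rewrite /= ffunE (inj_eq val_inj) /=; case: ifP => // _; rewrite onth_ge.
have Hm k : size (get st k) <= size x by rewrite Hst; case: eqP.
have [t [T [Ht [RT1 RT2] E Hsz]]] := isteps_sim ok (leq0n _) S R0 Hm.
set out := get st' kout in Hsz *.
have [|| T' [E' Hout Hend]] := @fin_run T out (inord (size C)).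
- by move=> i Hi; case: (RT2 i) => _ ->; exact: onth_nth.
- by case: (RT2 (size out)) => _ ->; rewrite onth_ge.
(* From right to left: place the marker, simulate, enter [Fin], write the output and its final
   blank. *)
pose tt := (size out).+1 + (1 + (t + 2)).
have run : iter tt step (MConf (inl o0) (input_tape cell x) 0%R) = MConf (inl o1) T' (Posz (size out)).
  rewrite 3!iterD.
  have -> : iter 2 step (MConf (inl o0) (input_tape cell x) 0%R) = MConf (inr (At, inord 0)) T0 (-1)%R.
    have S0 : step (MConf (inl o0) (input_tape cell x) 0%R) = MConf (inr (Mark, ord0)) (input_tape cell x) (-1)%R.
      by rewrite /mstep; congr MConf; exact: (set_cell_id _ 0%R).
    rewrite iterS [iter 1 _ _]/iter S0 (@step_write _ _ _ (inr (At, ord0)) (inr None) o1) //.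
    by congr (MConf (inr (At, _)) _ _); apply: val_inj; rewrite /= inordK.
  rewrite E [iter 1 _ _]/iter (@step_move _ _ _ (inr (Fin, inord (size C))) o2); last first.
    by rewrite /= inordK // onth_ge.
  exact: E'.
exists tt; split.
- by have := Hsz kout; rewrite -/out /tt; lia.
- by rewrite tm_run_enc run.
- rewrite /tm_output tm_run_enc run; apply: read_bits_enc => //.
  by rewrite /tt; lia.
Qed.

End Sim.
End StackMachine.

(** * Structured stack programs *)

Section Language.
Variable nk : nat.
Notation stacks := (seq (seq bool)).

Inductive prog :=
| Push of 'I_nk & bool
| Skip
| Seq of prog & prog
| Case of 'I_nk & prog & prog & prog
| Loop of 'I_nk & prog & prog.

Fixpoint psize (p : prog) : nat :=
  match p with
  | Push _ _ | Skip => 1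
  | Seq p q => psize p + psize q
  | Case _ p q r => (psize p + (psize q + psize r)).+1
  | Loop _ p q => (psize p + psize q).+1
  end.

(** [a] is the address of the code and [e] the label at which execution continues afterwards; the
    bodies of a loop continue at the address of the loop itself. *)
Fixpoint compile (p : prog) (a e : nat) : seq (instr nk) :=
  match p with
  | Push k b => [:: IPush k b e]
  | Skip => [:: IJmp nk e]
  | Seq p q => compile p a (a + psize p) ++ compile q (a + psize p) e
  | Case k pe p0 p1 =>
      IPop k a.+1 (a.+1 + psize pe) (a.+1 + psize pe + psize p0) ::
      compile pe a.+1 e ++ compile p0 (a.+1 + psize pe) e ++ compile p1 (a.+1 + psize pe + psize p0) e
  | Loop k p0 p1 =>
      IPop k e a.+1 (a.+1 + psize p0) :: compile p0 a.+1 a ++ compile p1 (a.+1 + psize p0) a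
  end.

Lemma size_compile p a e : size (compile p a e) = psize p.
Proof.
elim: p a e => //= [p IHp q IHq|k p IHp q IHq r IHr|k p IHp q IHq] a e; by rewrite !size_cat ?IHp ?IHq ?IHr.
Qed.

Definition label_le (M : nat) (i : instr nk) : bool :=
  match i with
  | IPush _ _ l => l <= M
  | IPop _ le l0 l1 => [&& le <= M, l0 <= M & l1 <= M]
  | IJmp l => l <= M
  end.

Lemma compile_labels p a e M : a + psize p <= M -> e <= M -> all (label_le M) (compile p a e).
Proof.
elim: p a e => [k b||p IHp q IHq|k p IHp q IHq r IHr|k p IHp q IHq] a e /= Ha He; rewrite ?andbT ?all_cat //.
- by rewrite IHp ?IHq //; lia.
- by rewrite IHp ?IHq ?IHr //=; lia.
- by rewrite IHp ?IHq //=; lia.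
Qed.

Inductive run : prog -> stacks -> stacks -> nat -> Prop :=
| RPush k b st : run (Push k b) st (put st k (rcons (get st k) b)) 1
| RSkip st : run Skip st st 1
| RSeq p q st st1 st2 n m : run p st st1 n -> run q st1 st2 m -> run (Seq p q) st st2 (n + m)
| RCaseE (k : 'I_nk) pe p0 p1 st st1 n : get st k = [::] -> run pe st st1 n -> run (Case k pe p0 p1) st st1 n.+1
| RCase (k : 'I_nk) pe p0 p1 st st1 n s b : get st k = rcons s b ->
    run (if b then p1 else p0) (put st k s) st1 n -> run (Case k pe p0 p1) st st1 n.+1
| RLoopE (k : 'I_nk) p0 p1 st : get st k = [::] -> run (Loop k p0 p1) st st 1
| RLoop (k : 'I_nk) p0 p1 st st1 st2 n m s b : get st k = rcons s b ->
    run (if b then p1 else p0) (put st k s) st1 n -> run (Loop k p0 p1) st1 st2 m ->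
    run (Loop k p0 p1) st st2 (n + m).+1.

Definition code_at (C : seq (instr nk)) (a : nat) (s : seq (instr nk)) : Prop :=
  forall i, i < size s -> onth C (a + i) = onth s i.

Lemma onth_cat (A : Type) (s1 s2 : seq A) i :
  onth (s1 ++ s2) i = if i < size s1 then onth s1 i else onth s2 (i - size s1).
Proof. by elim: s1 i => [|x s1 IH] [|i] //=; rewrite ?subn0 // IH. Qed.

Lemma code_at_cat C a s1 s2 : code_at C a (s1 ++ s2) -> code_at C a s1 /\ code_at C (a + size s1) s2.
Proof.
move=> H; split=> i Hi.
  by rewrite H ?size_cat ?ltn_addr // onth_cat Hi.
rewrite -addnA H; last by rewrite size_cat ltn_add2l.
by rewrite onth_cat ifN ?addKn //; lia.
Qed.

Lemma code_at_cons C a x s : code_at C a (x :: s) -> onth C a = Some x /\ code_at C a.+1 s.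
Proof.
move=> H; split; first by have := H 0 isT; rewrite addn0.
by move=> i Hi; rewrite addSnnS; exact: H.
Qed.

Lemma compile_sim C p st st' n : run p st st' n -> forall a e, code_at C a (compile p a e) ->
  isteps C n a st e st'.
Proof.
elim=> {p st st' n}.
- by move=> k b st a e /code_at_cons [H _]; apply: isteps1; exact: SPush.
- by move=> st a e /code_at_cons [H _]; apply: isteps1; exact: SJmp.
- move=> p q st st1 st2 n m _ IHp _ IHq a e /code_at_cat [Hp]; rewrite size_compile => Hq.
  exact: isteps_trans (IHp _ _ Hp) (IHq _ _ Hq).
- move=> k pe p0 p1 st st1 n E _ IH a e /code_at_cons [H /code_at_cat [He _]].
  by apply: IStep (IH _ _ He); exact: SPopE H E.
- move=> k pe p0 p1 st st1 n s b E _ IH a e /code_at_cons [H /code_at_cat [_]].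
  rewrite size_compile => /code_at_cat [H0]; rewrite size_compile => H1.
  by apply: (IStep (SPop H E)); case: b {E} IH => IH; apply: IH.
- by move=> k p0 p1 st E a e /code_at_cons [H _]; apply: isteps1; exact: SPopE H E.
- move=> k p0 p1 st st1 st2 n m s b E _ IHb _ IHl a e Ha.
  have /code_at_cons [H /code_at_cat [H0]] := Ha; rewrite size_compile => H1.
  apply: (IStep (SPop H E)); apply: isteps_trans (IHl _ _ Ha).
  by case: b {E} IHb => IHb; apply: IHb.
Qed.

Definition exec (p : prog) (st st' : stacks) (t : nat) : Prop := exists2 n, n <= t & run p st st' n.

Lemma exec_le p st st' t t' : t <= t' -> exec p st st' t -> exec p st st' t'.
Proof. by move=> Ht [n Hn R]; exists n => //; exact: leq_trans Ht. Qed.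

Lemma exec_push k b st : exec (Push k b) st (put st k (rcons (get st k) b)) 1.
Proof. by exists 1 => //; constructor. Qed.

Lemma exec_skip st : exec Skip st st 1.
Proof. by exists 1 => //; constructor. Qed.

Lemma exec_seq p q st st1 st2 t1 t2 : exec p st st1 t1 -> exec q st1 st2 t2 -> exec (Seq p q) st st2 (t1 + t2).
Proof. by move=> [n Hn R] [m Hm R']; exists (n + m); [exact: leq_add|exact: RSeq R R']. Qed.

Lemma exec_caseE (k : 'I_nk) pe p0 p1 st st1 t : get st k = [::] -> exec pe st st1 t -> exec (Case k pe p0 p1) st st1 t.+1.
Proof. by move=> E [n Hn R]; exists n.+1 => //; exact: RCaseE. Qed.

Lemma exec_case (k : 'I_nk) pe p0 p1 st st1 t s b : get st k = rcons s b ->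
  exec (if b then p1 else p0) (put st k s) st1 t -> exec (Case k pe p0 p1) st st1 t.+1.
Proof. by move=> E [n Hn R]; exists n.+1 => //; exact: RCase E R. Qed.

(* [J s a] is the state whose stack [k] holds [s] while the rest encodes the accumulator [a]. *)
Lemma exec_loop (A : Type) (k : 'I_nk) p0 p1 (J : seq bool -> A -> stacks) (stp : A -> bool -> A)
    (P : seq bool -> A -> Prop) t :
  (forall s a, get (J s a) k = s) -> (forall s s' a, put (J s a) k s' = J s' a) ->
  (forall s a b, P (rcons s b) a ->
     exec (if b then p1 else p0) (J s a) (J s (stp a b)) t /\ P s (stp a b)) ->
  forall s a, P s a -> exec (Loop k p0 p1) (J s a) (J [::] (foldl stp a (rev s))) (size s * t.+1).+1.
Proof.
move=> Hg Hp Hb; elim/last_ind => [|s b IH] a Pa; first by exists 1 => //; apply: RLoopE; rewrite Hg.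
have [[n Hn R] Ps] := Hb s a b Pa; have [m Hm R'] := IH _ Ps.
exists (n + m).+1; first by rewrite size_rcons mulSn; lia.
by rewrite rev_rcons; apply: (@RLoop _ _ _ _ (J s (stp a b)) _ _ _ s b); rewrite ?Hg ?Hp.
Qed.

Fixpoint pushes (k : 'I_nk) (s : seq bool) : prog :=
  if s is b :: s' then Seq (Push k b) (pushes k s') else Skip.

Lemma put_put st k s s' : put (put st k s) k s' = put st k s'.
Proof.
apply: (@eq_from_nth _ [::]); first by rewrite !size_set_nth; lia.
by move=> i _; have := get_put; rewrite /get => H; rewrite !H; case: eqP.
Qed.

Lemma put_get st k : k < size st -> put st k (get st k) = st.
Proof.
move=> Hk; apply: (@eq_from_nth _ [::]); first by rewrite size_set_nth; apply/maxn_idPr.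
by move=> i _; have := get_put; rewrite /get => H; rewrite !H; case: eqP => [->|].
Qed.

Lemma exec_pushes (k : 'I_nk) s st : k < size st -> exec (pushes k s) st (put st k (get st k ++ s)) (size s).+1.
Proof.
move=> Hk; elim: s st Hk => [|b s IH] st Hk /=; first by rewrite cats0 put_get //; exact: exec_skip.
rewrite -[(size s).+2]add1n; apply: exec_seq (exec_push k b st) _.
have := IH (put st k (rcons (get st k) b)); rewrite put_put get_put eqxx cat_rcons.
by apply; rewrite size_set_nth; lia.
Qed.

End Language.

(** * The program computing the reduction *)

Definition bits (n : nat) : seq bool := nbits n n.

Lemma nbits_fuel f g k : k <= f -> k <= g -> nbits f k = nbits g k.
Proof.
elim: f g k => [|f IH] [|g] [|k] //= Hf Hg.
by congr (_ :: _); apply: IH; rewrite uphalfE; lia.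
Qed.

Lemma bitsE n : 0 < n -> bits n = odd n :: bits n./2.
Proof. by case: n => // n _; rewrite /bits /=; congr (_ :: _); apply: nbits_fuel => //; rewrite uphalfE; lia. Qed.

(** Zero has the empty code, so without [0 < c] the case [p = false] would produce a spurious
    leading zero. *)
Lemma bits_double c (p : bool) : 0 < c -> bits (c.*2 + p) = p :: bits c.
Proof.
move=> c0; have -> : c.*2 + p = p + c.*2 by lia.
have pos : 0 < p + c.*2 by lia.
by rewrite (bitsE pos) half_bit_double oddD odd_double addbF oddb.
Qed.

Lemma size_bits n : size (bits n) <= n.
Proof.
rewrite /bits; move: {2}n => k.
by elim: n k => [|n IH] [|k] //=; rewrite ltnS.
Qed.

Lemma enc_natE n : enc_nat n = flatten [seq [:: true; b] | b <- bits n] ++ [:: false].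
Proof. by []. Qed.

Fixpoint add_carry (c : bool) (s : seq bool) : seq bool :=
  if s is b :: s' then (c (+) b) :: add_carry (c && b) s' else nseq c true.

Lemma add_carry0 s : add_carry false s = s.
Proof. by elim: s => //= b s ->. Qed.

Lemma bitsS n : add_carry true (bits n) = bits n.+1.
Proof.
elim/ltn_ind: n => n IH; rewrite [RHS]bitsE //.
case: (posnP n) => [->|n0] //; rewrite bitsE //= uphalf_half.
case: (boolP (odd n)) => /= _; last by rewrite add_carry0.
by rewrite IH //; lia.
Qed.

Definition carry_step (a : bool * seq bool) (b : bool) : bool * seq bool :=
  (a.1 && b, rcons a.2 (a.1 (+) b)).

Lemma foldl_carry s c t : let a := foldl carry_step (c, t) s in
  a.2 ++ nseq a.1 true = t ++ add_carry c s.
Proof.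
elim: s c t => [|b s IH] c t //=.
by have /= -> := IH (c && b) (rcons t (c (+) b)); rewrite cat_rcons.
Qed.

Lemma foldl_rcons (T : Type) (s t : seq T) : foldl rcons t s = t ++ s.
Proof. by elim: s t => [|b s IH] t /=; rewrite ?cats0 // IH cat_rcons. Qed.

Lemma rcons_nseq (T : Type) a (b : T) : rcons (nseq a b) b = nseq a.+1 b.
Proof. by elim: a => //= a ->. Qed.

(** Roles of the stacks: [kX] input, [kY] its copy and later its length in unary, [kU] and [kV]
    unary numbers, [kC] binary counter, [kT] the counter in reverse, [kF] carry flag, [kO]
    output. *)
Notation kX := (@Ordinal 8 0 isT).
Notation kY := (@Ordinal 8 1 isT).
Notation kU := (@Ordinal 8 2 isT).
Notation kV := (@Ordinal 8 3 isT).
Notation kC := (@Ordinal 8 4 isT).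
Notation kT := (@Ordinal 8 5 isT).
Notation kF := (@Ordinal 8 6 isT).
Notation kO := (@Ordinal 8 7 isT).

Definition regs (x y u v c t f o : seq bool) : seq (seq bool) := [:: x; y; u; v; c; t; f; o].

Definition both (k : 'I_8) (p : prog 8) : prog 8 := Loop k p p.
Definition restore : prog 8 := Loop kT (Push kC false) (Push kC true).

Lemma exec_restore x y u v c t f o :
  exec restore (regs x y u v c t f o) (regs x y u v (c ++ rev t) [::] f o) (size t * 2).+1.
Proof.
have := @exec_loop _ _ kT (Push kC false) (Push kC true) (fun s a => regs x y u v a s f o) rcons
  (fun _ _ => True) 1 (fun _ _ => erefl) (fun _ _ _ => erefl).
move=> H; have {H} := H _ t c I; rewrite foldl_rcons; apply.
by move=> s a b _; split=> //; case: b; exact: exec_push.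
Qed.

Definition emit_bit (b : bool) : prog 8 := Seq (Push kO true) (Seq (Push kO b) (Push kT b)).

(* Stack [kC] holds the counter with its least significant bit on top, the order in which
   [enc_nat] writes it; doubling the counter only prepends a bit. *)
Definition emit_num (p : bool) : prog 8 :=
  Seq (pushes kO [:: true; p]) (Seq (Loop kC (emit_bit false) (emit_bit true)) (Seq restore (Push kO false))).

Lemma exec_emit_num p x y u v c f o : 0 < c ->
  exec (emit_num p) (regs x y u v (rev (bits c)) [::] f o)
    (regs x y u v (rev (bits c)) [::] f (o ++ enc_nat (c.*2 + p))) (10 * c + 20).
Proof.
move=> c0; set o1 := o ++ [:: true; p].
set o2 := o1 ++ flatten [seq [:: true; b] | b <- bits c].
have -> : o ++ enc_nat (c.*2 + p) = rcons o2 false.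
  by rewrite enc_natE bits_double //= /o2 /o1 -cats1 -!catA.
have L : exec (Loop kC (emit_bit false) (emit_bit true)) (regs x y u v (rev (bits c)) [::] f o1)
    (regs x y u v [::] (bits c) f o2) (size (rev (bits c)) * 4).+1.
  pose stp (a : seq bool * seq bool) b := (rcons a.1 b, a.2 ++ [:: true; b]).
  have := @exec_loop _ _ kC (emit_bit false) (emit_bit true) (fun s a => regs x y u v s a.1 f a.2) stp
    (fun _ _ => True) 3 (fun _ _ => erefl) (fun _ _ _ => erefl).
  move=> H; have {H} := H _ (rev (bits c)) ([::], o1) I; rewrite revK.
  have E s t q : foldl stp (t, q) s = (t ++ s, q ++ flatten [seq [:: true; b] | b <- s]).
    elim: s t q => [|b s IH] t q /=; first by rewrite !cats0.
    by rewrite IH cat_rcons -catA.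
  rewrite E; apply; move=> s a b _; split=> //.
  have H b' : exec (emit_bit b') (regs x y u v s a.1 f a.2) (regs x y u v s (rcons a.1 b') f (a.2 ++ [:: true; b'])) 3.
    rewrite /emit_bit; apply: (exec_seq (t1 := 1) (t2 := 2) (exec_push _ _ _)).
    apply: (exec_seq (t1 := 1) (t2 := 1) (exec_push _ _ _)).
    by rewrite -cat_rcons cats1; exact: exec_push.
  by case: b; exact: H.
have R := exec_restore x y u v [::] (bits c) f o2; rewrite cat0s in R.
apply: (exec_le (t := 3 + ((size (rev (bits c)) * 4).+1 + ((size (bits c) * 2).+1 + 1)))).
  by rewrite size_rev; have := size_bits c; lia.
apply: exec_seq (exec_seq L (exec_seq R (exec_push _ _ _))).
exact: (@exec_pushes _ kO [:: true; p] (regs _ _ _ _ _ _ _ o) isT).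
Qed.

(* Stack [kF] is nonempty as long as there is a carry. *)
Definition incr : prog 8 :=
  Seq (Push kF true)
  (Seq (Loop kC (Case kF (Push kT false) (Skip 8) (Push kT true))
                (Case kF (Push kT true) (Skip 8) (Seq (Push kT false) (Push kF true))))
  (Seq (Case kF (Skip 8) (Skip 8) (Push kT true)) restore)).

Lemma exec_incr x y u v c o :
  exec incr (regs x y u v (rev (bits c)) [::] [::] o) (regs x y u v (rev (bits c.+1)) [::] [::] o) (10 * c + 20).
Proof.
pose J s (a : bool * seq bool) := regs x y u v s a.2 (nseq a.1 true) o.
have := @exec_loop _ _ kC (Case kF (Push kT false) (Skip 8) (Push kT true))
  (Case kF (Push kT true) (Skip 8) (Seq (Push kT false) (Push kF true))) J carry_step
  (fun _ _ => True) 3 (fun _ _ => erefl) (fun _ _ _ => erefl).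
move=> H; have {H} := H _ (rev (bits c)) (true, [::]) I; rewrite revK size_rev.
have := foldl_carry (bits c) true [::]; rewrite bitsS.
case: (foldl _ _ _) => cr t /= Et H.
have {H} L : exec (Loop kC (Case kF (Push kT false) (Skip 8) (Push kT true))
  (Case kF (Push kT true) (Skip 8) (Seq (Push kT false) (Push kF true))))
  (J (rev (bits c)) (true, [::])) (J [::] (cr, t)) (size (bits c) * 4).+1.
  apply: H => s [[] a] [] _; split=> //.
  - apply: (@exec_case _ kF _ _ _ _ _ 2 [::] true) => //.
    exact: (exec_seq (t1 := 1) (t2 := 1) (exec_push _ _ _) (exec_push _ _ _)).
  - by apply: (exec_le (t := 2)) => //; apply: (@exec_case _ kF _ _ _ _ _ 1 [::] true) => //; exact: exec_push.
  - by apply: (exec_le (t := 2)) => //; apply: exec_caseE => //; exact: exec_push.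
  - by apply: (exec_le (t := 2)) => //; apply: exec_caseE => //; exact: exec_push.
have D : exec (Case kF (Skip 8) (Skip 8) (Push kT true)) (J [::] (cr, t)) (regs x y u v [::] (bits c.+1) [::] o) 2.
  rewrite -Et /J; case: cr {L Et} => /=.
    apply: (@exec_case _ kF _ _ _ _ _ 1 [::] true) => //.
    by rewrite cats1; exact: exec_push.
  by rewrite cats0; apply: exec_caseE => //; exact: exec_skip.
have R := exec_restore x y u v [::] (bits c.+1) [::] o; rewrite cat0s in R.
apply: (exec_le (t := 1 + ((size (bits c) * 4).+1 + (2 + (size (bits c.+1) * 2).+1)))).
  by have := size_bits c; have := size_bits c.+1; lia.
apply: exec_seq (exec_seq L (exec_seq D R)); exact: exec_push.
Qed.

(** Templates for families of tiles indexed by the counter [c] in [kC]: literal text, the code of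
    [c.*2 + p], and the passage to [c.+1]. *)
Inductive item := IStr of seq bool | INum of bool | IInc.

Definition emit_item (i : item) : prog 8 :=
  match i with IStr s => pushes kO s | INum p => emit_num p | IInc => incr end.

Fixpoint emit (its : seq item) : prog 8 :=
  if its is i :: its' then Seq (emit_item i) (emit its') else (Skip 8).

Fixpoint item_out (its : seq item) (c : nat) : seq bool :=
  match its with
  | [::] => [::]
  | IStr s :: r => s ++ item_out r c
  | INum p :: r => enc_nat (c.*2 + p) ++ item_out r c
  | IInc :: r => item_out r c.+1
  end.

Fixpoint item_incr (its : seq item) : nat :=
  match its with [::] => 0 | IInc :: r => (item_incr r).+1 | _ :: r => item_incr r end.

Fixpoint item_weight (its : seq item) : nat :=
  match its with
  | [::] => 1
  | IStr s :: r => (size s).+1 + item_weight r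
  | _ :: r => (item_weight r).+1
  end.

Definition item_cost (its : seq item) (M : nat) : nat := item_weight its * (10 * M + 20).

Lemma exec_emit its x y u v c o M : 0 < c -> c + item_incr its <= M ->
  exec (emit its) (regs x y u v (rev (bits c)) [::] [::] o)
    (regs x y u v (rev (bits (c + item_incr its))) [::] [::] (o ++ item_out its c)) (item_cost its M).
Proof.
rewrite /item_cost; elim: its c o => [|i its IH] c o c0 HM.
  rewrite /= addn0 cats0; apply: (exec_le (t := 1)); first by lia.
  exact: exec_skip.
case: i HM => [s|p|] /= HM.
- rewrite mulnDl catA; apply: exec_seq (IH _ _ c0 HM).
  apply: (exec_le (t := (size s).+1)); first by rewrite leq_pmulr //; lia.
  exact: (@exec_pushes _ kO s (regs _ _ _ _ _ _ _ o) isT).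
- rewrite mulSn catA; apply: exec_seq (IH _ _ c0 HM).
  by apply: (exec_le _ (exec_emit_num p x y u v [::] o c0)); lia.
- rewrite mulSn addnS -addSn; apply: exec_seq (IH _ _ _ _); rewrite ?addSn -?addnS //.
  by apply: (exec_le _ (exec_incr x y u v c o)); lia.
Qed.

(** * Computing the witness bound in unary *)

Definition copy_count : prog 8 :=
  Seq (Push kV true)
  (Seq (Loop kX (Seq (Push kY false) (Push kV true)) (Seq (Push kY true) (Push kV true)))
       (Loop kY (Push kX false) (Push kX true))).

Definition times_succ : prog 8 := Seq (both kU copy_count) (both kV (Push kU true)).

(** Reading a stack destroys it, so [kX] is poured into [kY] and back; [kV] grows by one per symbol,
    and by one more for the successor. *)
Lemma exec_copy_count x u a c t f o :
  exec copy_count (regs x [::] u (nseq a true) c t f o)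
    (regs x [::] u (nseq (a + (size x).+1) true) c t f o) (5 * size x + 3).
Proof.
pose J s (b : seq bool * nat) := regs s b.1 u (nseq b.2 true) c t f o.
pose stp (b : seq bool * nat) (e : bool) := (rcons b.1 e, b.2.+1).
have := @exec_loop _ _ kX (Seq (Push kY false) (Push kV true)) (Seq (Push kY true) (Push kV true)) J stp
  (fun _ _ => True) 2 (fun _ _ => erefl) (fun _ _ _ => erefl).
move=> H; have {H} := H _ x ([::], a.+1) I.
have E s q m : foldl stp (q, m) s = (q ++ s, m + size s).
  elim: s q m => [|b s IH] q m /=; first by rewrite cats0 addn0.
  by rewrite IH cat_rcons addSnnS.
rewrite E size_rev => H; have {H} L1 : exec (Loop kX (Seq (Push kY false) (Push kV true)) (Seq (Push kY true) (Push kV true)))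
  (regs x [::] u (nseq a.+1 true) c t f o) (regs [::] (rev x) u (nseq (a.+1 + size x) true) c t f o) (size x * 3).+1.
  apply: H => s b e _; split=> //; rewrite /J /stp -rcons_nseq /=.
  by case: e; exact: (exec_seq (t1 := 1) (t2 := 1) (exec_push _ _ _) (exec_push _ _ _)).
have := @exec_loop _ _ kY (Push kX false) (Push kX true) (fun s b => regs b s u (nseq (a.+1 + size x) true) c t f o) rcons
  (fun _ _ => True) 1 (fun _ _ => erefl) (fun _ _ _ => erefl).
move=> H; have {H} := H _ (rev x) [::] I; rewrite foldl_rcons revK cat0s size_rev => L2.
rewrite -addSnnS; apply: (exec_le (t := 1 + ((size x * 3).+1 + (size x * 2).+1))); first by lia.
apply: exec_seq (exec_seq L1 (L2 _)); last by move=> s b [] _; split=> //; exact: exec_push.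
by rewrite -rcons_nseq; exact: exec_push.
Qed.

Lemma exec_times_succ x m c t f o :
  exec times_succ (regs x [::] (nseq m true) [::] c t f o)
    (regs x [::] (nseq (m * (size x).+1) true) [::] c t f o) (10 * (m * (size x).+1) + 2).
Proof.
have := @exec_loop _ _ kU copy_count copy_count (fun s a => regs x [::] s (nseq a true) c t f o)
  (fun a _ => a + (size x).+1) (fun _ _ => True) (5 * size x + 3) (fun _ _ => erefl) (fun _ _ _ => erefl).
move=> H; have {H} := H _ (nseq m true) 0 I; rewrite size_nseq.
have E (s : seq bool) a : foldl (fun a _ => a + (size x).+1) a s = a + size s * (size x).+1.
  by elim: s a => [|b s IH] a /=; [rewrite addn0|rewrite IH; lia].
rewrite E size_rev size_nseq add0n => L1.
have := @exec_loop _ _ kV (Push kU true) (Push kU true) (fun s a => regs x [::] (nseq a true) s c t f o)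
  (fun a _ => a.+1) (fun _ _ => True) 1 (fun _ _ => erefl) (fun _ _ _ => erefl).
move=> H; have {H} := H _ (nseq (m * (size x).+1) true) 0 I; rewrite size_nseq.
have E' (s : seq bool) a : foldl (fun a _ => a.+1) a s = a + size s.
  by elim: s a => [|b s IH] a /=; [rewrite addn0|rewrite IH; lia].
rewrite E' size_rev size_nseq add0n => L2.
apply: (exec_le (t := (m * (5 * size x + 3).+1).+1 + (m * (size x).+1 * 2).+1)); first by nia.
apply: exec_seq (L1 _) (L2 _).
  by move=> s a b _; split=> //; case: b; exact: exec_copy_count.
by move=> s a b _; split=> //; rewrite -rcons_nseq; case: b; exact: exec_push.
Qed.

Fixpoint power_prog (k : nat) : prog 8 :=
  if k is k'.+1 then Seq (power_prog k') times_succ else (Skip 8).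

Lemma exec_power x m k c t f o :
  exec (power_prog k) (regs x [::] (nseq m true) [::] c t f o)
    (regs x [::] (nseq (m * (size x).+1 ^ k) true) [::] c t f o) (k * (10 * (m * (size x).+1 ^ k) + 2)).+1.
Proof.
elim: k => [|k IH]; first by rewrite expn0 muln1; exact: exec_skip.
have H := exec_times_succ x (m * (size x).+1 ^ k) c t f o.
have E : m * (size x).+1 ^ k * (size x).+1 = m * (size x).+1 ^ k.+1 by rewrite expnS; lia.
rewrite E in H; apply: exec_le (exec_seq IH H).
have : m * (size x).+1 ^ k <= m * (size x).+1 ^ k.+1 by rewrite -E leq_pmulr.
by move: (m * _ ^ k) (m * _ ^ k.+1) => u v; nia.
Qed.

(** * Writing out the instance *)

Section Assembler.
Variables (e g : nat) (pre str suf : seq bool) (wit mid fin : seq item) (inp : bool -> seq item).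
Hypotheses (g0 : 0 < g) (wit1 : item_incr wit = 1) (mid1 : item_incr mid = 1)
  (inp1 : forall b, item_incr (inp b) = 1) (fin0 : item_incr fin = 0).

Fixpoint wit_out (c m : nat) : seq bool :=
  if m is m'.+1 then item_out wit c ++ wit_out c.+1 m' else [::].

Fixpoint inp_out (c : nat) (X : seq bool) : seq bool :=
  if X is b :: X' then item_out (inp b) c ++ inp_out c.+1 X' else [::].

(** The consumed number is saved in [kV], as [inp_loop] saves the input length in [kY]: the
    strengths are written after the tiles, and their number depends on both again. *)
Definition wit_loop : prog 8 := both kU (Seq (Push kV true) (emit wit)).
Definition inp_loop : prog 8 :=
  Loop kX (Seq (Push kY true) (emit (inp false))) (Seq (Push kY true) (emit (inp true))).

Lemma exec_wit_loop x y m o M : g + m < M ->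
  exec wit_loop (regs x y (nseq m true) [::] (rev (bits g)) [::] [::] o)
    (regs x y [::] (nseq m true) (rev (bits (g + m))) [::] [::] (o ++ wit_out g m)) (m * (item_cost wit M).+2).+1.
Proof.
move=> HM; pose J s (a : nat * seq bool) := regs x y s (nseq a.1 true) (rev (bits (g + a.1))) [::] [::] a.2.
pose stp (a : nat * seq bool) (b : bool) := (a.1.+1, a.2 ++ item_out wit (g + a.1)).
have := @exec_loop _ _ kU (Seq (Push kV true) (emit wit)) (Seq (Push kV true) (emit wit)) J stp
  (fun s a => g + a.1 + size s < M) (item_cost wit M).+1 (fun _ _ => erefl) (fun _ _ _ => erefl).
move=> H; have {H} := H _ (nseq m true) (0, o); rewrite size_nseq.
have E s k q : foldl stp (k, q) s = (k + size s, q ++ wit_out (g + k) (size s)).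
  elim: s k q => [|b s IH] k q /=; first by rewrite addn0 cats0.
  by rewrite IH -catA addnS !addSnnS.
rewrite E size_rev size_nseq add0n /J /= addn0 => H; apply: H => //.
move=> s [k q] b; rewrite size_rcons [(k, q).1]/= => Hs; split; last by rewrite /=; lia.
have k0 : 0 < g + k by lia.
have kM : g + k + item_incr wit <= M by lia.
have H := exec_emit x y s (rcons (nseq k true) true) q k0 kM.
rewrite wit1 rcons_nseq addn1 -addnS in H.
have {}H : exec (Seq (Push kV true) (emit wit)) (J s (k, q)) (J s (stp (k, q) b)) (item_cost wit M).+1.
  by apply: (exec_seq (t1 := 1) _ H); rewrite -rcons_nseq; exact: exec_push.
by case: b H.
Qed.

Lemma exec_inp_loop x v c o M : 0 < c -> c + size x < M ->
  exec inp_loop (regs x [::] [::] v (rev (bits c)) [::] [::] o)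
    (regs [::] (nseq (size x) true) [::] v (rev (bits (c + size x))) [::] [::] (o ++ inp_out c (rev x)))
    (size x * (item_cost (inp false) M + item_cost (inp true) M).+2).+1.
Proof.
move=> c0 HM; pose J s (a : nat * seq bool) := regs s (nseq a.1 true) [::] v (rev (bits (c + a.1))) [::] [::] a.2.
pose stp (a : nat * seq bool) (b : bool) := (a.1.+1, a.2 ++ item_out (inp b) (c + a.1)).
have := @exec_loop _ _ kX (Seq (Push kY true) (emit (inp false))) (Seq (Push kY true) (emit (inp true))) J stp
  (fun s a => c + a.1 + size s < M) (item_cost (inp false) M + item_cost (inp true) M).+1
  (fun _ _ => erefl) (fun _ _ _ => erefl).
move=> H; have {H} := H _ x (0, o).
have E s k q : foldl stp (k, q) s = (k + size s, q ++ inp_out (c + k) s).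
  elim: s k q => [|b s IH] k q /=; first by rewrite addn0 cats0.
  by rewrite IH -catA addnS !addSnnS.
rewrite E size_rev add0n /J /= addn0 => H; apply: H => //.
move=> s [k q] b; rewrite size_rcons [(k, q).1]/= => Hs; split; last by rewrite /=; lia.
have k0 : 0 < c + k by lia.
have kM : c + k + item_incr (inp b) <= M by rewrite inp1; lia.
have H := exec_emit s (rcons (nseq k true) true) [::] v q k0 kM.
rewrite inp1 rcons_nseq addn1 -addnS in H.
have {}H : exec (Seq (Push kY true) (emit (inp b))) (J s (k, q)) (J s (stp (k, q) b)) (item_cost (inp b) M).+1.
  by apply: (exec_seq (t1 := 1) _ H); rewrite -rcons_nseq; exact: exec_push.
by case: b kM H => _ H; apply: exec_le H; lia.
Qed.

Lemma exec_str_loops m k c o :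
  exec (Seq (both kV (pushes kO str)) (both kY (pushes kO str)))
    (regs [::] (nseq k true) [::] (nseq m true) c [::] [::] o)
    (regs [::] [::] [::] [::] c [::] [::] (o ++ flatten (nseq m str) ++ flatten (nseq k str)))
    ((m * (size str).+2).+1 + (k * (size str).+2).+1).
Proof.
have E s q : foldl (fun (a : seq bool) (_ : bool) => a ++ str) q s = q ++ flatten (nseq (size s) str).
  by elim: s q => [|b s IH] q /=; rewrite ?cats0 // IH -catA.
have := @exec_loop _ _ kV (pushes kO str) (pushes kO str)
  (fun s a => regs [::] (nseq k true) [::] s c [::] [::] a) (fun a _ => a ++ str) (fun _ _ => True) (size str).+1
  (fun _ _ => erefl) (fun _ _ _ => erefl).
move=> H; have {H} := H _ (nseq m true) o I; rewrite E size_rev size_nseq => L1.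
have := @exec_loop _ _ kY (pushes kO str) (pushes kO str)
  (fun s a => regs [::] s [::] [::] c [::] [::] a) (fun a _ => a ++ str) (fun _ _ => True) (size str).+1
  (fun _ _ => erefl) (fun _ _ _ => erefl).
move=> H; have {H} := H _ (nseq k true) (o ++ flatten (nseq m str)) I; rewrite E size_rev size_nseq -catA => L2.
apply: exec_seq (L1 _) (L2 _).
  move=> s a b _; split=> //; case: b; exact: (@exec_pushes _ kO str (regs _ _ _ _ _ _ _ a) isT).
move=> s a b _; split=> //; case: b; exact: (@exec_pushes _ kO str (regs _ _ _ _ _ _ _ a) isT).
Qed.

Definition assembler : prog 8 :=
  Seq (pushes kU (nseq e true)) (Seq (power_prog e) (Seq (pushes kC (rev (bits g))) (Seq (pushes kO pre)
  (Seq wit_loop (Seq (emit mid) (Seq inp_loop (Seq (emit fin)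
  (Seq (Seq (both kV (pushes kO str)) (both kY (pushes kO str))) (pushes kO suf))))))))).

Definition assembler_out (x : seq bool) : seq bool :=
  let B := e * (size x).+1 ^ e in
  pre ++ wit_out g B ++ item_out mid (g + B) ++ inp_out (g + B).+1 (rev x) ++
  item_out fin ((g + B).+1 + size x) ++ flatten (nseq B str) ++ flatten (nseq (size x) str) ++ suf.

Definition assembler_cost (n : nat) : nat :=
  let B := e * n.+1 ^ e in let M := g + B + n + 2 in
  e.+1 + ((e * (10 * B + 2)).+1 + (g.+1 + ((size pre).+1 + ((B * (item_cost wit M).+2).+1 +
  (item_cost mid M + ((n * (item_cost (inp false) M + item_cost (inp true) M).+2).+1 + (item_cost fin M +
  (((B * (size str).+2).+1 + (n * (size str).+2).+1) + (size suf).+1)))))))).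

Lemma exec_assembler x :
  exec assembler (regs x [::] [::] [::] [::] [::] [::] [::])
    (regs [::] [::] [::] [::] (rev (bits ((g + e * (size x).+1 ^ e).+1 + size x))) [::] [::] (assembler_out x))
    (assembler_cost (size x)).
Proof.
rewrite /assembler_cost /assembler_out /=; set B := e * _; set M := g + B + size x + 2.
have pu (k : 'I_8) s st : k < size st -> exec (pushes k s) st (put st k (get st k ++ s)) (size s).+1.
  exact: exec_pushes.
have H1 := pu kU (nseq e true) (regs x [::] [::] [::] [::] [::] [::] [::]) isT.
rewrite size_nseq in H1; apply: (exec_seq H1).
apply: (exec_seq (exec_power x e e [::] [::] [::] [::])); rewrite -/B.
have H2 := pu kC (rev (bits g)) (regs x [::] (nseq B true) [::] [::] [::] [::] [::]) isT.
rewrite size_rev in H2; have {}H2 := exec_le (_ : (size (bits g)).+1 <= g.+1) H2.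
apply: (exec_seq (H2 (size_bits g))).
apply: (exec_seq (pu kO pre (regs x [::] (nseq B true) [::] (rev (bits g)) [::] [::] [::]) isT)).
have M1 : g + B < M by rewrite /M; lia.
apply: (exec_seq (exec_wit_loop x [::] pre M1)).
have M2 : g + B + item_incr mid <= M by rewrite mid1 /M; lia.
have gB : 0 < g + B by lia.
have H3 := exec_emit x [::] [::] (nseq B true) (pre ++ wit_out g B) gB M2.
rewrite mid1 addn1 in H3; apply: (exec_seq H3).
have M3 : (g + B).+1 + size x < M by rewrite /M; lia.
apply: (exec_seq (exec_inp_loop (nseq B true) _ (ltn0Sn _) M3)).
have M4 : (g + B).+1 + size x + item_incr fin <= M by rewrite fin0 addn0 ltnW.
have gBx : 0 < (g + B).+1 + size x by lia.
have H4 := exec_emit [::] (nseq (size x) true) [::] (nseq B true)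
  (((pre ++ wit_out g B) ++ item_out mid (g + B)) ++ inp_out (g + B).+1 (rev x)) gBx M4.
rewrite fin0 addn0 in H4; apply: (exec_seq H4).
apply: (exec_seq (exec_str_loops _ _ _ _)).
set o := _ ++ flatten (nseq B str) ++ flatten (nseq (size x) str).
have H5 := pu kO suf (regs [::] [::] [::] [::] (rev (bits ((g + B).+1 + size x))) [::] [::] o) isT.
by move: H5; rewrite /put /get /= /o -!catA.
Qed.

End Assembler.

(** * The reduction *)

Definition poly_bounded (f : nat -> nat) : Prop := exists c, forall n, f n <= c * n.+1 ^ c.

Lemma leq_poly a b c d n : a <= b -> c <= d -> a * n.+1 ^ c <= b * n.+1 ^ d.
Proof. by move=> ab cd; apply: leq_mul => //; rewrite leq_pexp2l. Qed.

Lemma poly_bounded_const k : poly_bounded (fun=> k).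
Proof. by exists k => n; rewrite leq_pmulr // expn_gt0. Qed.

Lemma poly_bounded_id : poly_bounded id.
Proof. by exists 1 => n; rewrite mul1n expn1. Qed.

Lemma poly_bounded_add f g : poly_bounded f -> poly_bounded g -> poly_bounded (fun n => f n + g n).
Proof.
move=> [a Ha] [b Hb]; exists (a + b) => n; rewrite mulnDl.
by apply: leq_add; [apply: leq_trans (Ha n) _|apply: leq_trans (Hb n) _]; apply: leq_poly; lia.
Qed.

Lemma poly_bounded_mul f g : poly_bounded f -> poly_bounded g -> poly_bounded (fun n => f n * g n).
Proof.
move=> [a Ha] [b Hb]; exists (a * b + (a + b)) => n.
apply: leq_trans (leq_mul (Ha n) (Hb n)) _; rewrite mulnACA -expnD.
by apply: leq_poly; lia.
Qed.

(** The exponent [k] itself would fail for [k = 0], as the constant also serves as the factor. *)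
Lemma poly_bounded_exp k : poly_bounded (fun n => n.+1 ^ k).
Proof. by exists k.+1 => n; rewrite -[X in X <= _]mul1n; apply: leq_poly. Qed.

Lemma poly_bounded_S f : poly_bounded f -> poly_bounded (fun n => (f n).+1).
Proof.
move=> Hf; have [c Hc] := poly_bounded_add (poly_bounded_const 1) Hf.
by exists c => n; exact: Hc.
Qed.

Ltac poly := repeat first
  [ exact: poly_bounded_const | exact: poly_bounded_id | exact: poly_bounded_exp
  | apply: poly_bounded_S | apply: poly_bounded_add | apply: poly_bounded_mul ].

Lemma poly_bounded_assembler e g pre str suf wit mid fin inp :
  poly_bounded (assembler_cost e g pre str suf wit mid fin inp).
Proof. by rewrite /assembler_cost /item_cost; poly. Qed.

Lemma labels_ok_compile nk (p : prog nk) : labels_ok (compile p 0 (psize p)).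
Proof.
move=> l i; have H := @compile_labels nk p 0 (psize p) (psize p) (leqnn _) (leqnn _).
rewrite size_compile => E; have : label_le (psize p) i.
  elim: (compile p 0 (psize p)) l H E => [|j s IH] [|l] //= /andP [Hj Hs]; first by case=> <-.
  exact: IH.
by case: i {E}.
Qed.

Lemma prog_poly_computable (p : prog 8) (f : seq bool -> seq bool) (cost : nat -> nat) :
  poly_bounded cost ->
  (forall x, exists2 st, exec p (regs x [::] [::] [::] [::] [::] [::] [::]) st (cost (size x)) & get st 7 = f x) ->
  poly_computable f.
Proof.
move=> Hc Hp; pose kX := @Ordinal 8 0 isT; pose kO := @Ordinal 8 7 isT.
have [c Hcc] : poly_bounded (fun n => cost n * (2 * (n + cost n) + 5) + (n + cost n) + 5) by poly; exact: Hc.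
exists (TM_of (@sm_delta 8 (compile p 0 (psize p)) kX kO)), c => x.
have [st [m Hm R] Ef] := Hp x.
have Sp : isteps (compile p 0 (psize p)) m 0 (regs x [::] [::] [::] [::] [::] [::] [::])
    (size (compile p 0 (psize p))) st.
  rewrite size_compile; apply: (compile_sim R) => i _; by rewrite add0n.
have Hst (k : nat) : get (regs x [::] [::] [::] [::] [::] [::] [::]) k = if k == kX then x else [::].
  by do 9?[case: k => [|k] //].
have ok : labels_ok (compile p 0 (psize p)) by exact: labels_ok_compile.
have [t [Ht Hh Ho]] := stack_machine_run kO ok Hst Sp.
exists t; split; last by rewrite -Ef.
apply: leq_trans (Hcc (size x)); apply: leq_trans Ht _.
by move: Hm; move: (cost _) => u; nia.
Qed.

(** * The verifier as a machine with an entering state *)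

Section Verifier.
Variable M : TM.

(** [None] is the entering state: from cell -1 it moves right into the start state, so [k.+1] steps
    here are [k] steps of [M]. *)
Definition vdelta (q : option 'I_(tm_Q M).+3) (s : 'I_(tm_S M).+3) :
    option 'I_(tm_Q M).+3 * 'I_(tm_S M).+3 * 'I_3 :=
  match q with
  | None => (Some (inord 0), s, o2)
  | Some q => let: (q', s', m) := @tm_delta M q s in (Some q', s', m)
  end.

Definition vhalt (q : option 'I_(tm_Q M).+3) : bool := if q is Some q then @halting M q else false.
Definition vacc (q : option 'I_(tm_Q M).+3) : bool := if q is Some q then val q == 1 else false.

Lemma vacc_halt q : vacc q -> vhalt q.
Proof. by case: q => //= q; rewrite /halting => ->. Qed.

Definition lift_conf (c : tm_conf M) : mconf (option 'I_(tm_Q M).+3) 'I_(tm_S M).+3 :=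
  MConf (Some (tc_state c)) (@tc_tape M c) (tc_head c).

Notation vinit := (init_mconf (inord 0 : 'I_(tm_S M).+3) (@sym_of_bit M) None).

Lemma lift_step c : mstep vdelta vhalt (lift_conf c) = lift_conf (tm_step c).
Proof.
rewrite /mstep /tm_step /=; case: (halting (tc_state c)) => //.
by case: (tm_delta _ _) => [[q s] m].
Qed.

Lemma lift_run y k : iter k.+1 (mstep vdelta vhalt) (vinit y) = lift_conf (tm_run M y k).
Proof.
elim: k => [|k IH]; last by rewrite iterS IH lift_step.
rewrite /= /mstep /= /lift_conf; congr MConf.
apply: functional_extensionality => -[z|z] /=; last by case: ifP.
by [].
Qed.

Lemma accepts_run y : accepts vdelta vhalt vacc (inord 0) (@sym_of_bit M) None y <->
  exists k, val (tc_state (tm_run M y k)) = 1.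
Proof.
split=> [[[|k]]|[k Hk]]; first by [].
  by rewrite lift_run /= => /eqP Hk; exists k.
by exists k.+1; rewrite lift_run /=; apply/eqP.
Qed.

Lemma run_halted y k d : halting (tc_state (tm_run M y k)) -> tm_run M y (k + d) = tm_run M y k.
Proof.
move=> H; elim: d => [|d IH]; first by rewrite addn0.
by rewrite addnS /tm_run iterS -/(tm_run M y (k + d)) IH /tm_step H.
Qed.

(** A halted run is constant, so the halting time supplied by a decider and any accepting time show
    the same state. *)
Lemma accepts_halted y t : halting (tc_state (tm_run M y t)) ->
  accepts vdelta vhalt vacc (inord 0) (@sym_of_bit M) None y <-> val (tc_state (tm_run M y t)) = 1.
Proof.
move=> Ht; split=> [/accepts_run [k Hk]|H]; last by apply/accepts_run; exists t.
have Hkh : halting (tc_state (tm_run M y k)) by rewrite /halting Hk.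
case: (leqP k t) => Hkt.
  by rewrite -(subnKC Hkt) run_halted.
by rewrite -(run_halted (k - t) Ht) subnKC // ltnW.
Qed.

End Verifier.

Arguments enc_nat : simpl never.
Arguments letter_glue : simpl never.

(** * The encoded instance and the program that writes it *)

Section Encoded.
Variables (Q Sym : finType) (delta : Q -> Sym -> Q * Sym * 'I_3) (halt acc : pred Q).
Variables (blank : Sym) (bit : bool -> Sym) (enter : Q) (e : nat).
Notation base := (gbase Q Sym).
Notation bit_glue b := (letter_glue (bit_letter Q bit b)).

Definition bound (x : seq bool) : nat := e * (size x).+1 ^ e.
Definition tiles_of (x : seq bool) : seq tile :=
  tile_set delta halt acc blank bit enter (rev x) (bound x).
Definition alpha_asm : config := [:: (Posz 0, Posz 0, alpha Q Sym)].
Definition instance_of (x : seq bool) : seq bool :=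
  enc_instance (one_bin (strengths Q Sym (rev x) (bound x)) (tiles_of x)) alpha_asm.

(** [inl] stands for a fixed glue, [inr p] for the numbered glue [c.*2 + p] of the running counter
    [c]. *)
Definition glue_item (g : nat + bool) : item :=
  match g with inl g => IStr (enc_nat g) | inr p => INum p end.
Definition tile_items (n e s w : nat + bool) : seq item :=
  [:: IStr [:: true]; glue_item n; glue_item e; glue_item s; glue_item w].
(** The increment comes before the west glue, because the last tile of a family is linked there to
    the next counter value. *)
Definition last_tile_items (n e : nat + bool) : seq item :=
  [:: IStr [:: true]; glue_item n; glue_item e; IStr (enc_nat 0); IInc; INum false].

Definition wit_items : seq item :=
  tile_items (inl (bit_glue false)) (inl 4) (inl 0) (inr false) ++
  tile_items (inl (bit_glue false)) (inr false) (inl 0) (inr true) ++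
  tile_items (inl (bit_glue true)) (inr false) (inl 0) (inr true) ++
  last_tile_items (inl (bit_glue true)) (inr true).
Definition mid_items : seq item :=
  tile_items (inl (bit_glue false)) (inl 4) (inl 0) (inr false) ++ last_tile_items (inl (bit_glue false)) (inr false).
Definition inp_items (b : bool) : seq item :=
  tile_items (inl (bit_glue b)) (inr false) (inl 0) (inr true) ++ last_tile_items (inl (bit_glue true)) (inr true).

Notation enc_tiles T := (flatten [seq true :: enc_tile t | t <- T]).
Notation enc_nats s := (flatten [seq true :: enc_nat t | t <- s]).

Definition fixed_strengths : seq nat :=
  [:: 0; 2; 2; 2; 2; 2; 2] ++ nseq (nletters Q Sym + nstates Q) 1 ++ nseq (base + 3) 2.
(** The two [false] bits close the list of tiles and the one-element list of tile sets; [z] then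
    opens the list of strengths. *)
Definition start_items (z : seq bool) : seq item :=
  tile_items (inl (letter_glue (start_letter blank enter))) (inr false) (inl 0) (inl 3) ++ [:: IStr ([:: false; false] ++ z)].
Definition fin_items : seq item := start_items (enc_nats fixed_strengths).
Definition pre_string : seq bool :=
  enc_nat 4 ++ enc_nat 1 ++
  enc_seq (fun e : nat * nat * nat => enc_nat e.1.1 ++ enc_nat e.1.2 ++ enc_nat e.2)
    [:: (0, 0, 0); (1, 0, 0); (2, 0, 0)] ++ [:: true] ++ enc_tiles (fixed_tiles delta halt acc blank).
(** Two entries at a time, since [nstrong] grows by two with each unit of the witness bound and with
    each input bit. *)
Definition str_string : seq bool := (true :: enc_nat 2) ++ (true :: enc_nat 2).
Definition suf_string : seq bool := [:: false] ++ enc_nat 2 ++ enc_config alpha_asm.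

Lemma enc_double c : enc_nat c.*2 = enc_nat (c.*2 + false). Proof. by rewrite addn0. Qed.
Lemma enc_doubleS c : enc_nat c.*2.+1 = enc_nat (c.*2 + true). Proof. by rewrite addn1. Qed.

Lemma enc_tile_cons n e' s w r :
  true :: enc_tile (n, e', s, w) ++ r = [:: true] ++ enc_nat n ++ enc_nat e' ++ enc_nat s ++ enc_nat w ++ r.
Proof. by rewrite /enc_tile /tN /tE /tS /tW /= -!catA. Qed.

Lemma enc_tiles_cons t T : enc_tiles (t :: T) = true :: enc_tile t ++ enc_tiles T. Proof. by []. Qed.
Lemma enc_tiles_nil : enc_tiles ([::] : seq tile) = [::]. Proof. by []. Qed.

Lemma enc_tiles_cat T T' : enc_tiles (T ++ T') = enc_tiles T ++ enc_tiles T'.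
Proof. by rewrite map_cat flatten_cat. Qed.

Lemma item_wit c : item_out wit_items c = enc_tiles (witness_tiles Q bit c).
Proof.
rewrite /witness_tiles !enc_tiles_cons enc_tiles_nil !enc_tile_cons !enc_doubleS !enc_double.
by rewrite /wit_items /= ?cats0.
Qed.

Lemma item_mid c : item_out mid_items c = enc_tiles (middle_tiles Q bit c).
Proof.
rewrite /middle_tiles !enc_tiles_cons enc_tiles_nil !enc_tile_cons !enc_double.
by rewrite /mid_items /= ?cats0.
Qed.

Lemma item_inp b c : item_out (inp_items b) c = enc_tiles (input_tiles Q bit b c).
Proof.
rewrite /input_tiles !enc_tiles_cons enc_tiles_nil !enc_tile_cons !enc_doubleS !enc_double.
by rewrite /inp_items /= ?cats0.
Qed.

Lemma wit_outE c m : wit_out wit_items c m = enc_tiles (all_witness_tiles Q bit c m).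
Proof.
elim: m c => [|m IH] c //.
have -> : wit_out wit_items c m.+1 = item_out wit_items c ++ wit_out wit_items c.+1 m by [].
by rewrite IH item_wit -enc_tiles_cat.
Qed.

Lemma inp_outE c X : inp_out inp_items c X = enc_tiles (all_input_tiles Q bit c X).
Proof.
elim: X c => [|b X IH] c //.
have -> : inp_out inp_items c (b :: X) = item_out (inp_items b) c ++ inp_out inp_items c.+1 X by [].
by rewrite IH item_inp -enc_tiles_cat.
Qed.

Lemma enc_nats_cat s s' : enc_nats (s ++ s') = enc_nats s ++ enc_nats s'.
Proof. by rewrite map_cat flatten_cat. Qed.

Lemma enc_nats_str m : enc_nats (nseq m.*2 2) = flatten (nseq m str_string).
Proof. by elim: m => //= m ->. Qed.

Lemma item_start z c : item_out (start_items z) c =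
  (true :: enc_tile (start_tile blank enter c)) ++ [:: false; false] ++ z.
Proof.
rewrite /start_tile cat_cons enc_tile_cons enc_double /start_items.
by rewrite /= cats0.
Qed.

Lemma enc_seq1 (A : Type) (f : A -> seq bool) a : enc_seq f [:: a] = true :: f a ++ [:: false].
Proof. by rewrite /enc_seq /= cats0. Qed.

Lemma assembler_outE x :
  assembler_out e base pre_string str_string suf_string wit_items mid_items fin_items inp_items x = instance_of x.
Proof.
rewrite /assembler_out wit_outE item_mid inp_outE -/(bound x).
rewrite /instance_of /enc_instance /enc_staged.
rewrite [st_r _]/= [st_b _]/= [st_edges _]/= [st_tiles _]/= [st_strs _]/= [st_tau _]/=.
have -> : enc_seq enc_nat (strengths Q Sym (rev x) (bound x)) =
    enc_nats fixed_strengths ++ flatten (nseq (bound x) str_string) ++ flatten (nseq (size x) str_string) ++ [:: false].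
  rewrite /enc_seq /strengths /nstrong /fixed_strengths size_rev -!enc_nats_str.
  rewrite (nseqD (_ + _)) (nseqD (base + 3)); move: (nseq (nletters _ _ + _) 1) (nseq (base + 3) 2) => s1 s2.
  by rewrite !enc_nats_cat -!catA.
have -> : enc_seq (enc_seq enc_tile) [:: tiles_of x] =
    [:: true] ++ enc_tiles (fixed_tiles delta halt acc blank) ++
    enc_tiles (all_witness_tiles Q bit base (bound x)) ++
    enc_tiles (middle_tiles Q bit (base + bound x)) ++
    enc_tiles (all_input_tiles Q bit (base + bound x).+1 (rev x)) ++
    (true :: enc_tile (start_tile blank enter ((base + bound x).+1 + size x))) ++ [:: false; false].
  rewrite enc_seq1 /enc_seq /tiles_of /tile_set size_rev.
  move: (fixed_tiles _ _ _ _) (all_witness_tiles _ _ _ _) (middle_tiles _ _ _) => z1 z2 z3.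
  move: (all_input_tiles _ _ _ _) (start_tile _ _ _) => z4 z5.
  rewrite !enc_tiles_cat enc_tiles_cons enc_tiles_nil cats0; move: enc_tile => en.
  by rewrite /= -!catA.
rewrite item_start.
rewrite /pre_string /suf_string.
move: (fixed_tiles _ _ _ _) (all_witness_tiles _ _ _ _) (middle_tiles _ _ _) => z1 z2 z3.
move: (all_input_tiles _ _ _ _) (start_tile _ _ _) fixed_strengths str_string => z4 z5 z6 z7.
move: (enc_config _) => z8; move: enc_tile enc_nat => et en.
by rewrite -!catA /= -!catA.
Qed.

Lemma instance_poly_computable : poly_computable instance_of.
Proof.
apply: (@prog_poly_computable
  (assembler e base pre_string str_string suf_string wit_items mid_items fin_items inp_items) _ _
  (poly_bounded_assembler e base pre_string str_string suf_string wit_items mid_items fin_items inp_items)) => x.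
eexists; first exact: exec_assembler.
exact: assembler_outE.
Qed.

Hypothesis acc_halt : forall q, acc q -> halt q.

Lemma instance_unique x :
  staged_UAV_4_2 (instance_of x) <->
  ~ exists w, size w <= bound x /\ accepts delta halt acc blank bit enter (enc_pair x w).
Proof.
set T := tiles_of x; set strs := strengths Q Sym (rev x) (bound x).
have Tk := @tile_set_kinded Q Sym delta halt acc blank bit enter (rev x) (bound x).
have G := @alpha_grid Q Sym delta halt acc blank bit enter (rev x) (bound x) acc_halt; rewrite revK in G.
have term X : terminal strs 2 (single_tiles T) X <-> asm_eq X alpha_asm /\
    ~ exists w, size w <= bound x /\ accepts delta halt acc blank bit enter (enc_pair x w).
  rewrite -G; apply: terminal_tiles => //.
  - exact: strengthsE.
  - exact: alpha_mem.
  - exact: alpha_cell.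
  - exact: tile_set_row_ext.
  - exact: tile_set_col_ext.
  - exact: tile_set_cell_ext.
have U := one_bin_unique (T := T) (strs := strs) (A := alpha_asm) isT term.
split=> [[G' [A' [E [_ [_ [_ H]]]]]]|H].
  by have [EG EA] := enc_instance_inj E; apply/U; rewrite -EG -EA in H.
by exists (one_bin strs T), alpha_asm; do 4!split=> //; apply/U.
Qed.

End Encoded.

Theorem mainTheorem3 : coNP_hard staged_UAV_4_2.
Proof.
move=> L [V [c [[M [cV HV]] HL]]].
exists (instance_of (@vdelta M) (@vhalt M) (@vacc M) (inord 0) (@sym_of_bit M) None c).
split; first exact: instance_poly_computable.
move=> x; rewrite instance_unique; last exact: vacc_halt.
have -> : (exists w, size w <= bound c x /\
    accepts (@vdelta M) (@vhalt M) (@vacc M) (inord 0) (@sym_of_bit M) None (enc_pair x w)) <-> ~ L x.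
  rewrite HL; split=> -[w [sw Hw]]; exists w; split=> //;
    have [t [_ [Ht HVt]]] := HV (enc_pair x w).
    by apply/HVt; apply/(accepts_halted Ht).
  by apply/(accepts_halted Ht); apply/HVt.
by split=> [Lx|/NNPP].
Qed.
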